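(* Fix a finite metric abelian group $(A,q)$ and the data of one of the following: Family $\mathrm I^\epsilon$ ($\epsilon\in\{\pm1\}$, $Q\in\mathcal Q^\epsilon(q)$), Family $\mathrm{II}_E$ (an admissible datum $(E,Q_E,P_E)$), or Family $\mathrm{III}$. Then there is a deterministic classical algorithm which, given $n\ge1$ and a braid word $\xi=\sigma_{i_\ell}^{\delta_\ell}\cdots\sigma_{i_1}^{\delta_1}\in\mathcal B_n$ ($\delta_k\in\{\pm1\}$) of length $\ell$, computes exactly the corresponding coefficient-trace link invariant $$\mathcal I(\widehat\xi)=\alpha^{-\mathrm{wr}(\xi)}\beta^{-n}D^n\,\varepsilon_n(\rho_n(\xi))$$ in time polynomial in $n+\ell$.
   Context: $\mathrm U(1)$ = complex numbers of modulus one. A finite metric abelian group $(A,q)$: $A$ finite abelian (additive), $q:A\to\mathrm U(1)$ with $q(-a)=q(a)$ and $\langle a,b\rangle:=\frac{q(a+b)}{q(a)q(b)}$ a nondegenerate symmetric bicharacter. $\mathcal Q^{+1}(q)=\{q\chi\}$ and $\mathcal Q^{-1}(q)=\{q^{-1}\chi\}$, $\chi\in\mathrm{Hom}(A,\mathrm U(1))$. $\gamma(F)=|A|^{-1/2}\sum_{a\in A}F(a)$. An admissible datum $(E,Q_E,P_E)$ consists of $E\in\mathrm{Aut}(A)$ with $\langle Ex,y\rangle=\langle x,Ey\rangle$ and $Q_E,P_E:A\to\mathrm U(1)$ with $Q_E(x+y)=Q_E(x)Q_E(y)\langle Ex,y\rangle$ and $P_E(x+y)=P_E(x)P_E(y)\langle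 E^{-1}x,y\rangle$. Towers. For a finite abelian group $G$, a normalized $\mathrm U(1)$-valued 2-cocycle $\nu$ and a $\mathrm U(1)$-valued bicharacter $\tau$ on $G$, $\mathcal T_n(G;\nu,\tau)$ ($n\ge1$) is the unital complex algebra generated by $U_i^g$ ($1\le i<n$, $g\in G$) with $U_i^0=1$, $U_i^gU_i^h=\nu(g,h)U_i^{g+h}$, $U_i^gU_j^h=U_j^hU_i^g$ for $|i-j|>1$, $U_i^gU_{i+1}^h=\tau(g,h)U_{i+1}^hU_i^g$; the monomials $U_1^{g_1}\cdots U_{n-1}^{g_{n-1}}$ form a basis ($\mathcal T_1=\mathbb C$). $\varepsilon_n(x)$ is the coefficient of the identity monomial in $x$. For $f:G\to\mathbb C$ put $r_i=\sum_{g\in G}f(g)U_i^g$. Family data. $\mathrm I^\epsilon$: $G=A$, $\nu=1$, $\tau(a,b)=\langle a,b\rangle$, $f(a)=|A|^{-1/2}Q(a)$, $(D,\alpha,\beta)=(|A|,1,\sqrt{|A|})$. $\mathrm{II}_E$: $G=A\oplus A$, $\nu=1$, $\tau((t,c),(t',c'))=\langle c,t'\rangle\langle c',t\rangle$, $f(t,c)=\overline{\gamma(P_E)}|A|^{-1}Q_E(t)P_E(c)$, $(D,\alpha,\beta)=(|A|,\overline{\gamma(P_E)},1)$. $\mathrm{III}$: $G=A\oplus A$, $\nu((a,b),(c,d))=\langle a,c\rangle\langle b,c\rangle\langle b,d\rangle$, $\tau((a,b),(c,d))=\langle b,c\rangle\langle a,d\rangle^{-1}$, $f(a,b)=|A|^{-1}$,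 $(D,\alpha,\beta)=(|A|^2,1,|A|)$. In each case the $r_i$ are invertible and satisfy the braid relations, and $\rho_n:\mathcal B_n\to\mathcal T_n^\times$ is the homomorphism $\sigma_i\mapsto r_i$ (trivial for $n=1$). $\mathrm{wr}(\xi)$ is the exponent sum (writhe) of $\xi$ and $\widehat\xi$ its closure; $\mathcal I$ is an oriented link invariant. The group and phases are fixed (not part of the input); ''exactly'' means that the output is an exact representation of the algebraic number $\mathcal I(\widehat\xi)$ in a number field depending only on the fixed data, and time is bit complexity. *)

(* Defs.v *)
From HB Require Import structures.
From mathcomp Require Import all_boot all_order all_algebra all_fingroup all_field.
From mathcomp Require Import boolp reals complex zify ring.

Set Implicit Arguments.
Unset Strict Implicit.
Unset Printing Implicit Defensive.

Import Order.TTheory GRing.Theory Num.Theory.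
Local Open Scope ring_scope.

(* Makes products of finite abelian groups finite abelian groups. *)
HB.saturate prod.

Section MetricGroups.
Variable C : numClosedFieldType.
Implicit Types (G A : zmodType).

Definition U1_valued (T : Type) (f : T -> C) := forall x, `|f x| = 1.

Definition U1_character G (chi : G -> C) :=
  U1_valued chi /\ {morph chi : a b / a + b >-> a * b}.

Definition U1_bicharacter G (tau : G -> G -> C) :=
  (forall a, U1_character (tau a)) /\ (forall b, U1_character (tau^~ b)).

Definition pairing_of G (q : G -> C) (a b : G) : C := q (a + b) / (q a * q b).

Record metric_form (A : finZmodType) := MetricForm {
  qform :> A -> C;
  qform_U1 : U1_valued qform;
  qformN : forall a, qform (- a) = qform a;
  qform_bichar : U1_bicharacter (pairing_of qform);
  qform_nondeg : forall a, (forall b, pairing_of qform a b = 1) -> a = 0 }.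

Variables (A : finZmodType) (q : metric_form A).

Local Notation "<| a , b |>" := (pairing_of q a b).

Definition Qset (eps : int) (Q : A -> C) :=
  exists2 chi : A -> C, U1_character chi & forall a, Q a = q a ^ eps * chi a.

Definition gauss (F : A -> C) : C := (sqrtC #|A|%:R)^-1 * \sum_a F a.

Record admissible (E : {perm A}) (QE PE : A -> C) : Prop := Admissible {
  adm_add : {morph E : x y / x + y};
  adm_self_adjoint : forall x y, <| E x, y |> = <| x, E y |>;
  adm_QE_U1 : U1_valued QE;
  adm_PE_U1 : U1_valued PE;
  adm_QE : forall x y, QE (x + y) = QE x * QE y * <| E x, y |>;
  adm_PE : forall x y, PE (x + y) = PE x * PE y * <| (E^-1)%g x, y |> }.

Lemma pairing_U1 : forall a b, `| <| a, b |> | = 1.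
Proof. by move=> a b; have [h _] := qform_bichar q; have [] := h a. Qed.

Lemma pairing_neq0 a b : <| a, b |> != 0.
Proof. by rewrite -normr_eq0 pairing_U1 oner_eq0. Qed.

Lemma pairingDr a b c : <| a, b + c |> = <| a, b |> * <| a, c |>.
Proof. by have [h _] := qform_bichar q; have [_ ->] := h a. Qed.

Lemma pairingDl a b c : <| a + b, c |> = <| a, c |> * <| b, c |>.
Proof. by have [_ h] := qform_bichar q; have [_ ->] := h c. Qed.

Lemma pairing0r a : <| a, 0 |> = 1.
Proof.
by apply: (mulfI (pairing_neq0 a 0)); rewrite -pairingDr addr0 mulr1.
Qed.

Lemma pairing0l a : <| 0, a |> = 1.
Proof.
by apply: (mulfI (pairing_neq0 0 a)); rewrite -pairingDl addr0 mulr1.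
Qed.

Lemma pairingC a b : <| a, b |> = <| b, a |>.
Proof. by rewrite /pairing_of addrC [q a * _]mulrC. Qed.

End MetricGroups.

Record tower_data (C : numClosedFieldType) := TowerData {
  tgrp : finZmodType;
  tnu : tgrp -> tgrp -> C;
  ttau : tgrp -> tgrp -> C;
  tnu_U1 : forall g h, `|tnu g h| = 1;
  tnu0g : forall g, tnu 0 g = 1;
  tnug0 : forall g, tnu g 0 = 1;
  tnu_cocycle : forall g h k,
    tnu g h * tnu (g + h) k = tnu h k * tnu g (h + k);
  ttau_bichar : U1_bicharacter ttau }.

Section Tower.
Variables (C : numClosedFieldType) (X : tower_data C) (n : nat).
Local Notation G := (tgrp X).
Local Notation nu := (@tnu C X).
Local Notation tau := (@ttau C X).

(* The generators U_1, ..., U_(n-1) are indexed from 0. *)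
Definition mexp := {ffun 'I_n.-1 -> G}.

HB.instance Definition _ := GRing.Zmodule.copy mexp {ffun 'I_n.-1 -> G}.
HB.instance Definition _ := Finite.copy mexp {ffun 'I_n.-1 -> G}.

(* The element x stands for \sum_g x g U_1^(g_1) ... U_(n-1)^(g_(n-1)). *)
Definition tower := {ffun mexp -> C^o}.

HB.instance Definition _ := GRing.Lmodule.copy tower {ffun mexp -> C^o}.

(* The scalar in U^g U^h = mcoc g h U^(g + h): the factor U_i^(h_i) is moved  *)
(* to the left across U_(i+1)^(g_(i+1)) only.                                 *)
Definition mcoc (g h : mexp) : C :=
  (\prod_(i < n.-1) nu (g i) (h i)) *
  \prod_(i < n.-1) \prod_(j < n.-1 | val j == i.+1) (tau (h i) (g j))^-1.

Definition mon (g : mexp) : tower := [ffun k : mexp => (k == g)%:R].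

Definition tower_mul (x y : tower) : tower :=
  [ffun k => \sum_(g : mexp) x g * y (k - g) * mcoc g (k - g)].

Lemma tauDr a b c : tau a (b + c) = tau a b * tau a c.
Proof. by have [h _] := ttau_bichar X; have [_ ->] := h a. Qed.

Lemma tauDl a b c : tau (a + b) c = tau a c * tau b c.
Proof. by have [_ h] := ttau_bichar X; have [_ ->] := h c. Qed.

Lemma tau_neq0 a b : tau a b != 0.
Proof.
by rewrite -normr_eq0; have [h _] := ttau_bichar X; have [-> _] := h a; apply: oner_neq0.
Qed.

Lemma tau0r a : tau a 0 = 1.
Proof. by apply: (mulfI (tau_neq0 a 0)); rewrite -tauDr addr0 mulr1. Qed.

Lemma tau0l a : tau 0 a = 1.
Proof. by apply: (mulfI (tau_neq0 0 a)); rewrite -tauDl addr0 mulr1. Qed.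

Lemma mcoc0g g : mcoc 0 g = 1.
Proof.
rewrite /mcoc !big1 ?mulr1 // => i _; last by rewrite ffunE tnu0g.
by rewrite big1 // => j _; rewrite ffunE tau0r invr1.
Qed.

Lemma mcocg0 g : mcoc g 0 = 1.
Proof.
rewrite /mcoc !big1 ?mulr1 // => i _; last by rewrite ffunE tnug0.
by rewrite big1 // => j _; rewrite ffunE tau0l invr1.
Qed.

Lemma mcoc_cocycle g h k :
  mcoc g h * mcoc (g + h) k = mcoc h k * mcoc g (h + k).
Proof.
rewrite /mcoc mulrACA [RHS]mulrACA; congr (_ * _).
  rewrite -!big_split /=; apply: eq_bigr => i _.
  by rewrite !ffunE tnu_cocycle.
rewrite -!big_split /=; apply: eq_bigr => i _.
rewrite -!big_split /=; apply: eq_bigr => j _.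
rewrite !ffunE tauDl tauDr !invfM.
by rewrite [RHS]mulrCA [(tau (k i) (h j))^-1 * _]mulrC.
Qed.

Fact tower_mulA : associative tower_mul.
Proof.
move=> x y z; apply/ffunP => k; rewrite !ffunE.
under eq_bigr => a _ do rewrite ffunE mulr_sumr mulr_suml.
under [RHS]eq_bigr => g _ do rewrite ffunE !mulr_suml.
rewrite [RHS]exchange_big /=; apply: eq_bigr => a _.
rewrite [RHS](reindex_inj (addrI a)) /=; apply: eq_bigr => b _.
rewrite [a + b]addrC addrK [b + a]addrC opprD addrA.
have := mcoc_cocycle a b (k - a - b).
rewrite [b + _]addrC subrK => e.
move: (mcoc a b) (mcoc (a + b) _) (mcoc b _) (mcoc a _) e => c1 c2 c3 c4 e.
rewrite -!mulrA; congr (_ * (_ * _)).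
by rewrite [RHS]mulrCA; congr (_ * _); rewrite e.
Qed.

Fact tower_mul1x : left_id (mon 0) tower_mul.
Proof.
move=> x; apply/ffunP => k; rewrite ffunE (bigD1 0) //= big1 ?addr0.
  by rewrite ffunE eqxx mul1r subr0 mcoc0g mulr1.
by move=> g /negPf g0; rewrite ffunE g0 !mul0r.
Qed.

Fact tower_mulx1 : right_id (mon 0) tower_mul.
Proof.
move=> x; apply/ffunP => k; rewrite ffunE (bigD1 k) //= big1 ?addr0.
  by rewrite ffunE subrr eqxx mulr1 mcocg0 mulr1.
move=> g gk; rewrite ffunE subr_eq0 eq_sym (negPf gk).
by rewrite mulr0 mul0r.
Qed.

Fact tower_mulDl : left_distributive tower_mul +%R.
Proof.
move=> x y z; apply/ffunP => k; rewrite !ffunE -big_split /=.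
by apply: eq_bigr => g _; rewrite ffunE !mulrDl.
Qed.

Fact tower_mulDr : right_distributive tower_mul +%R.
Proof.
move=> x y z; apply/ffunP => k; rewrite !ffunE -big_split /=.
by apply: eq_bigr => g _; rewrite ffunE mulrDr mulrDl.
Qed.

Fact tower_1neq0 : mon 0 != 0.
Proof.
by apply/eqP => /ffunP/(_ 0); rewrite !ffunE eqxx => /eqP; rewrite oner_eq0.
Qed.

HB.instance Definition _ := GRing.Zmodule_isNzRing.Build tower
  tower_mulA tower_mul1x tower_mulx1 tower_mulDl tower_mulDr tower_1neq0.

Lemma tower_mulE (x y : tower) k :
  (x * y) k = \sum_(g : mexp) x g * y (k - g) * mcoc g (k - g).
Proof. by rewrite [LHS]ffunE. Qed.

Fact tower_scaleAl (a : C) (x y : tower) : a *: (x * y) = a *: x * y.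
Proof.
apply/ffunP => k; rewrite !ffunE [LHS]mulr_sumr.
by apply: eq_bigr => g _; rewrite ffunE /= !mulrA.
Qed.

Fact tower_scaleAr (a : C) (x y : tower) : a *: (x * y) = x * (a *: y).
Proof.
apply/ffunP => k; rewrite !ffunE [LHS]mulr_sumr.
by apply: eq_bigr => g _; rewrite ffunE /= !mulrA [a * x g]mulrC.
Qed.

HB.instance Definition _ := GRing.Lmodule_isLalgebra.Build C tower tower_scaleAl.
HB.instance Definition _ := GRing.Lalgebra_isAlgebra.Build C tower tower_scaleAr.

(* The inverse is chosen classically, and x^-1 = x if x is not invertible.    *)
Definition tower_unit : pred tower :=
  fun x => `[< exists y, y * x = 1 /\ x * y = 1 >].
Definition tower_inv (x : tower) : tower :=
  if pselect (exists y, y * x = 1 /\ x * y = 1) is left e then projT1 (cid e) else x.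

Fact tower_mulVr : {in tower_unit, left_inverse 1 tower_inv *%R}.
Proof.
move=> x /asboolP ex; rewrite /tower_inv; case: pselect => // e.
by case: (cid e) => y [].
Qed.

Fact tower_mulrV : {in tower_unit, right_inverse 1 tower_inv *%R}.
Proof.
move=> x /asboolP ex; rewrite /tower_inv; case: pselect => // e.
by case: (cid e) => y [].
Qed.

Fact tower_unitP x y : y * x = 1 /\ x * y = 1 -> tower_unit x.
Proof. by move=> xy; apply/asboolP; exists y. Qed.

Fact tower_inv_out : {in [predC tower_unit], tower_inv =1 id}.
Proof.
move=> x; rewrite inE /= => /asboolPn nx.
by rewrite /tower_inv; case: pselect.
Qed.

HB.instance Definition _ := GRing.NzRing_hasMulInverse.Build tower
  tower_mulVr tower_mulrV tower_unitP tower_inv_out.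

Definition single (i : 'I_n.-1) (g : G) : mexp :=
  [ffun j => if j == i then g else 0].

Definition Ugen (i : 'I_n.-1) (g : G) : tower := mon (single i g).

Definition epsn (x : tower) : C := x 0.

(* The lemmas Ugen0, UgenM, Ugen_far, Ugen_near, mon_prodE and mon_basis show *)
(* that tower is the algebra presented by the generators Ugen i g and the     *)
(* defining relations, with the ordered monomials as a basis.                 *)

Lemma monM g h : mon g * mon h = mcoc g h *: mon (g + h).
Proof.
apply/ffunP => k; rewrite tower_mulE (bigD1 g) //= big1 ?addr0.
  rewrite !ffunE eqxx mul1r subr_eq [h + g]addrC.
  case: eqP => [-> | _]; last by rewrite mul0r scaler0.
  by rewrite mul1r [g + h]addrC addrK [RHS]mulr1.
by move=> a /negPf ag; rewrite ffunE ag !mul0r.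
Qed.

Lemma mon_basis (x : tower) : x = \sum_g x g *: mon g.
Proof.
apply/ffunP => k; rewrite sum_ffunE (bigD1 k) //= big1 ?addr0.
  by rewrite !ffunE eqxx [RHS]mulr1.
by move=> g gk; rewrite !ffunE eq_sym (negPf gk) scaler0.
Qed.

Lemma single0 i : single i 0 = 0.
Proof. by apply/ffunP => j; rewrite !ffunE if_same. Qed.

Lemma singleD i g h : single i (g + h) = single i g + single i h.
Proof. by apply/ffunP => j; rewrite !ffunE; case: eqP; rewrite ?addr0. Qed.

Lemma mcoc_single (i j : 'I_n.-1) g h :
  mcoc (single i g) (single j h) =
  (if i == j then nu g h else 1) * (if val i == j.+1 then (tau h g)^-1 else 1).
Proof.
rewrite /mcoc; congr (_ * _).
  rewrite (bigD1 i) //= big1 ?mulr1 => [|k /negPf ki]; last first.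
    by rewrite ffunE ki tnu0g.
  by rewrite !ffunE eqxx; case: eqP; rewrite // tnug0.
rewrite (bigD1 j) //= [X in _ * X]big1 ?mulr1 => [|k /negPf kj]; last first.
  by rewrite big1 // => l _; rewrite ffunE kj tau0l invr1.
case: ifP => ij.
  rewrite (bigD1 i) //= big1 ?mulr1; first by rewrite !ffunE !eqxx.
  by move=> l /andP[_ /negPf li]; rewrite [single i g l]ffunE li tau0r invr1.
rewrite big1 // => l /eqP lj; rewrite [single i g l]ffunE.
case: eqP => [li|_]; last by rewrite tau0r invr1.
by rewrite -li lj eqxx in ij.
Qed.

Lemma Ugen0 i : Ugen i 0 = 1.
Proof. by rewrite /Ugen single0. Qed.

Lemma UgenM i g h : Ugen i g * Ugen i h = nu g h *: Ugen i (g + h).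
Proof.
by rewrite monM mcoc_single eqxx ltn_eqF // mulr1 -singleD.
Qed.

Lemma Ugen_far (i j : 'I_n.-1) g h :
  (i.+1 < j)%N || (j.+1 < i)%N -> Ugen i g * Ugen j h = Ugen j h * Ugen i g.
Proof.
move=> ij; rewrite !monM !mcoc_single [single j h + _]addrC.
have [nij nji] : (i == j = false) /\ (j == i = false).
  by rewrite -!val_eqE /=; case/orP: ij; lia.
have [-> ->] : (val i == j.+1 = false) /\ (val j == i.+1 = false).
  by case/orP: ij => /=; lia.
by rewrite nij nji.
Qed.

Lemma Ugen_near (i j : 'I_n.-1) g h :
  val j = i.+1 -> Ugen i g * Ugen j h = tau g h *: (Ugen j h * Ugen i g).
Proof.
move=> ij; rewrite !monM !mcoc_single [single j h + _]addrC.
have [-> ->] : (i == j = false) /\ (j == i = false).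
  by rewrite -!val_eqE /= -/(val j) ij; lia.
have -> : (val i == j.+1) = false by rewrite -/(val j) ij /=; lia.
by rewrite ij eqxx !mul1r scalerA divff ?tau_neq0.
Qed.

Lemma mon_prodE (g : mexp) : \prod_(i < n.-1) Ugen i (g i) = mon g.
Proof.
pose cut k : mexp := [ffun i : 'I_n.-1 => if (i < k)%N then g i else 0].
have cutT : cut n.-1 = g by apply/ffunP => i; rewrite ffunE ltn_ord.
suff H k : (k <= n.-1)%N ->
    \prod_(i < n.-1 | (i < k)%N) Ugen i (g i) = mon (cut k).
  by rewrite -[in RHS]cutT -H //; apply: eq_bigl => i; rewrite ltn_ord.
elim: k => [_ | k IH kn].
  by rewrite big_pred0 //; congr mon; apply/ffunP => i; rewrite !ffunE.
move: (IH (ltnW kn)); rewrite (big_ord_narrow (ltnW kn)) (big_ord_narrow kn).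
rewrite big_ord_recr /= => {}IH.
pose m := widen_ord kn ord_max.
transitivity (mon (cut k) * Ugen m (g m)).
  rewrite -IH; congr (_ * _); apply: eq_bigr => i _.
  by have -> : widen_ord kn (widen_ord (leqnSn k) i) = widen_ord (ltnW kn) i
    by apply: val_inj.
have cutm (j : 'I_n.-1) : (k <= j)%N -> cut k j = 0.
  by move=> kj; rewrite ffunE ltnNge kj.
rewrite monM; have -> : mcoc (cut k) (single m (g m)) = 1.
  rewrite /mcoc !big1 ?mulr1 // => i _; last first.
    rewrite [single _ _ i]ffunE; case: eqP => [->|_]; last by rewrite tnug0.
    by rewrite cutm // tnu0g.
  rewrite big1 // => j /eqP ji; rewrite [single _ _ i]ffunE.
  case: eqP => [im|_]; last by rewrite tau0l invr1.
  by rewrite [cut k j]cutm ?tau0r ?invr1 // -[nat_of_ord j]/(val j) ji im /=.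
rewrite scale1r; congr mon; apply/ffunP => i; rewrite !ffunE ltnS -val_eqE /=.
case: ltngtP => [||ik]; rewrite ?addr0 // add0r.
by congr (g _); apply: val_inj; rewrite /= ik.
Qed.

End Tower.

(* Letters are listed from left to right; (i, true) is sigma_(i+1) and        *)
(* (i, false) is its inverse.                                                 *)
Definition braid_word (n : nat) := seq ('I_n.-1 * bool).

Definition writhe (n : nat) (w : braid_word n) : int :=
  \sum_(s <- w) (if s.2 then 1 else -1).

Record link_data (C : numClosedFieldType) := LinkData {
  ldata :> tower_data C;
  lf : tgrp ldata -> C;
  lD : C;
  lalpha : C;
  lbeta : C }.

Section Invariant.
Variables (C : numClosedFieldType) (L : link_data C) (n : nat).

Definition rgen (i : 'I_n.-1) : tower L n := \sum_g lf g *: Ugen i g.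

Definition rho (w : braid_word n) : tower L n :=
  \prod_(s <- w) (if s.2 then rgen s.1 else (rgen s.1)^-1).

Definition link_invariant (w : braid_word n) : C :=
  lalpha L ^ (- writhe w) * lbeta L ^- n * lD L ^+ n * epsn (rho w).

End Invariant.

Section Families.
Variables (C : numClosedFieldType) (A : finZmodType) (q : metric_form C A).

Local Notation "<| a , b |>" := (pairing_of q a b).

Lemma U1_one (G : zmodType) : U1_character (fun _ : G => 1 : C).
Proof. by split=> [x|x y]; rewrite ?normr1 ?mulr1. Qed.

Lemma U1_mul (G : zmodType) (f g : G -> C) :
  U1_character f -> U1_character g -> U1_character (fun x => f x * g x).
Proof.
move=> [f1 fD] [g1 gD]; split=> [x|x y]; first by rewrite normrM f1 g1 mulr1.
by rewrite fD gD mulrACA.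
Qed.

Lemma U1_inv (G : zmodType) (f : G -> C) :
  U1_character f -> U1_character (fun x => (f x)^-1).
Proof.
by move=> [f1 fD]; split=> [x|x y]; rewrite ?normfV ?f1 ?invr1 ?fD ?invfM.
Qed.

Lemma U1_comp (G H : zmodType) (f : G -> C) (h : H -> G) :
  {morph h : x y / x + y} -> U1_character f -> U1_character (fun x => f (h x)).
Proof. by move=> hD [f1 fD]; split=> [x|x y]; rewrite ?f1 ?hD ?fD. Qed.

Lemma pairing_charr a : U1_character (fun b => <| a, b |>).
Proof. by have [h _] := qform_bichar q; apply: h. Qed.

Lemma pairing_charl b : U1_character (fun a => <| a, b |>).
Proof. by have [_ h] := qform_bichar q; apply: h. Qed.

Fact one_U1 (G : Type) (g h : G) : `|1 : C| = 1.
Proof. exact: normr1. Qed.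

Fact one_cocycle (G : Type) (g h k : G) : 1 * 1 = 1 * 1 :> C.
Proof. by []. Qed.

Definition tower_I : tower_data C :=
  @TowerData C A (fun _ _ => 1) (pairing_of q)
    (@one_U1 A) (fun _ => erefl) (fun _ => erefl) (@one_cocycle A)
    (qform_bichar q).

Definition tau_II (u v : A * A) : C := <| u.2, v.1 |> * <| v.2, u.1 |>.

Fact tau_II_bichar : U1_bicharacter tau_II.
Proof.
split=> u; apply: U1_mul.
- exact: (U1_comp (h := fst) (fun _ _ => erefl) (pairing_charr _)).
- exact: (U1_comp (h := snd) (fun _ _ => erefl) (pairing_charl _)).
- exact: (U1_comp (h := snd) (fun _ _ => erefl) (pairing_charl _)).
- exact: (U1_comp (h := fst) (fun _ _ => erefl) (pairing_charr _)).
Qed.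

Definition tower_II : tower_data C :=
  @TowerData C (A * A)%type (fun _ _ => 1) tau_II
    (@one_U1 _) (fun _ => erefl) (fun _ => erefl) (@one_cocycle _)
    tau_II_bichar.

Definition nu_III (u v : A * A) : C :=
  <| u.1, v.1 |> * <| u.2, v.1 |> * <| u.2, v.2 |>.

Definition tau_III (u v : A * A) : C := <| u.2, v.1 |> * <| u.1, v.2 |>^-1.

Fact nu_III_bichar : U1_bicharacter nu_III.
Proof.
split=> u; (apply: U1_mul; first apply: U1_mul).
- exact: (U1_comp (h := fst) (fun _ _ => erefl) (pairing_charr _)).
- exact: (U1_comp (h := fst) (fun _ _ => erefl) (pairing_charr _)).
- exact: (U1_comp (h := snd) (fun _ _ => erefl) (pairing_charr _)).
- exact: (U1_comp (h := fst) (fun _ _ => erefl) (pairing_charl _)).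
- exact: (U1_comp (h := snd) (fun _ _ => erefl) (pairing_charl _)).
- exact: (U1_comp (h := snd) (fun _ _ => erefl) (pairing_charl _)).
Qed.

Fact nu_III_U1 u v : `|nu_III u v| = 1.
Proof. by have [h _] := nu_III_bichar; have [] := h u. Qed.

Fact nu_III0g u : nu_III 0 u = 1.
Proof. by rewrite /nu_III !pairing0l !mulr1. Qed.

Fact nu_IIIg0 u : nu_III u 0 = 1.
Proof. by rewrite /nu_III !pairing0r !mulr1. Qed.

Fact nu_III_cocycle u v w :
  nu_III u v * nu_III (u + v) w = nu_III v w * nu_III u (v + w).
Proof.
have [h1 h2] := nu_III_bichar.
have [_ ->] := h1 u; have [_ ->] := h2 w.
by rewrite mulrA [RHS]mulrC.
Qed.

Fact tau_III_bichar : U1_bicharacter tau_III.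
Proof.
split=> u; apply: U1_mul.
- exact: (U1_comp (h := fst) (fun _ _ => erefl) (pairing_charr _)).
- exact: (U1_comp (h := snd) (fun _ _ => erefl) (U1_inv (pairing_charr _))).
- exact: (U1_comp (h := snd) (fun _ _ => erefl) (pairing_charl _)).
- exact: (U1_comp (h := fst) (fun _ _ => erefl) (U1_inv (pairing_charl _))).
Qed.

Definition tower_III : tower_data C :=
  @TowerData C (A * A)%type nu_III tau_III
    nu_III_U1 nu_III0g nu_IIIg0 nu_III_cocycle tau_III_bichar.

Local Notation cardA := (#|A|%:R : C).

Definition data_I (Q : A -> C) : link_data C :=
  @LinkData C tower_I (fun a => (sqrtC cardA)^-1 * Q a)
    cardA 1 (sqrtC cardA).

Definition data_II (QE PE : A -> C) : link_data C :=
  @LinkData C tower_II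
    (fun u => (gauss PE)^* * cardA^-1 * QE u.1 * PE u.2)
    cardA (gauss PE)^* 1.

Definition data_III : link_data C :=
  @LinkData C tower_III (fun _ => cardA^-1) (cardA ^+ 2) 1 cardA.

Variant link_family : Type :=
  | FamilyI (eps : int) (Q : A -> C) of eps = 1 \/ eps = -1 & Qset q eps Q
  | FamilyII (E : {perm A}) (QE PE : A -> C) of admissible q E QE PE
  | FamilyIII.

Definition family_data (F : link_family) : link_data C :=
  match F with
  | FamilyI _ Q _ _ => data_I Q
  | FamilyII _ QE PE _ => data_II QE PE
  | FamilyIII => data_III
  end.

Lemma U1_neq0 (G : Type) (f : G -> C) x : U1_valued f -> f x != 0.
Proof. by move=> f1; rewrite -normr_eq0 f1 oner_eq0. Qed.

Lemma U1_0 (G : zmodType) (f : G -> C) : U1_character f -> f 0 = 1.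
Proof.
move=> [f1 fD]; apply: (mulfI (U1_neq0 0 f1)).
by rewrite -fD addr0 mulr1.
Qed.

Lemma U1_N (G : zmodType) (f : G -> C) x : U1_character f -> f (- x) = (f x)^-1.
Proof.
move=> fc; have [f1 fD] := fc; apply: (mulfI (U1_neq0 x f1)).
by rewrite -fD subrr U1_0 // divff // U1_neq0.
Qed.

Lemma sum_U1 (G : finZmodType) (f : G -> C) :
  U1_character f -> ~ (forall x, f x = 1) -> \sum_x f x = 0.
Proof.
move=> [f1 fD] /existsNP[y /eqP fy].
have: \sum_x f x = f y * \sum_x f x.
  rewrite mulr_sumr [LHS](reindex_inj (addrI y)) /=.
  by apply: eq_bigr => x _; rewrite fD.
move=> /eqP; rewrite -subr_eq0 -{1}[\sum_x f x]mul1r -mulrBl mulf_eq0.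
by rewrite subr_eq0 eq_sym (negPf fy) => /eqP.
Qed.

Lemma rgen_unit_gen (L : link_data C) (n : nat) (c : C)
    (F : tgrp L -> C) (beta : tgrp L -> tgrp L -> C) (i : 'I_n.-1) :
  c != 0 -> (forall g, lf g = c * F g) -> U1_valued F ->
  U1_bicharacter beta -> U1_bicharacter (tnu (t := L)) ->
  (forall g h, F (g + h) = F g * F h * beta g h) ->
  (forall k, (forall h, beta h k = tnu k h) -> k = 0) ->
  (forall k, (forall h, beta h k = tnu h k) -> k = 0) ->
  rgen L i \is a GRing.unit.
Proof.
move=> c0 fE F1 bb nb FD nd1 nd2.
pose G := tgrp L.
have [bl br] := bb; have [nl nr] := nb.
have card0 : #|G|%:R != 0 :> C.
  by rewrite pnatr_eq0 -lt0n; apply/card_gt0P; exists 0.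
pose y : tower L n := (c * #|G|%:R)^-1 *:
  \sum_(h : G) ((F (- h))^-1 * (tnu (- h) h)^-1) *: Ugen i h.
have F0 : F 0 = 1.
  apply: (mulfI (U1_neq0 0 F1)); have := FD 0 0.
  by rewrite addr0 (U1_0 (bl 0)) !mulr1.
have FdivN (g k : G) : F (k - g) = F (- g) * F k * (beta g k)^-1.
  by rewrite [k - g]addrC FD (U1_N g (br k)).
have nuNV (g : G) : (tnu (- g) g)^-1 = tnu g g by rewrite (U1_N g (nr g)) invrK.
have sum0 (k : G) (chi : G -> C) : U1_character chi ->
    ((forall h, beta h k = chi h) -> k = 0) -> k != 0 ->
    \sum_h F k * ((beta h k)^-1 * chi h) = 0.
  move=> chic kz k0; rewrite -mulr_sumr sum_U1 ?mulr0 //.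
    exact: U1_mul (U1_inv (br k)) chic.
  move=> h1; case/eqP: k0; apply: kz => h; apply: (mulfI (_ : (beta h k)^-1 != 0)).
    by rewrite invr_eq0; have [b1 _] := br k; exact: U1_neq0 b1.
  by rewrite h1 mulVf //; have [b1 _] := br k; exact: U1_neq0 b1.
have mulU (u v : G -> C) :
    (\sum_g u g *: Ugen i g) * (\sum_h v h *: Ugen i h) =
    \sum_k (\sum_g u g * v (k - g) * tnu g (k - g)) *: Ugen i k :> tower L n.
  rewrite mulr_suml; under [RHS]eq_bigr => k _ do rewrite scaler_suml.
  rewrite exchange_big /=; apply: eq_bigr => g _.
  rewrite mulr_sumr [RHS](reindex_inj (addrI g)) /=; apply: eq_bigr => h _.
  rewrite -scalerAl -scalerAr UgenM !scalerA.
  by rewrite [g + h]addrC addrK.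
have rE : rgen L i = c *: \sum_g F g *: Ugen i g :> tower L n.
  by rewrite scaler_sumr; apply: eq_bigr => g _; rewrite fE scalerA.
have delta (u : G -> C) : u 0 = #|G|%:R -> (forall k, k != 0 -> u k = 0) ->
    c *: ((c * #|G|%:R)^-1 *: \sum_k u k *: Ugen i k) = 1 :> tower L n.
  move=> u0 uk; rewrite (bigD1 0) //= big1 ?addr0 => [|k /uk ->]; last first.
    by rewrite scale0r.
  by rewrite u0 Ugen0 !scalerA invfM mulrA divff // mul1r mulVf // scale1r.
have yl (k g : G) : (F (- g))^-1 * (tnu (- g) g)^-1 * F (k - g) * tnu g (k - g)
    = F k * ((beta g k)^-1 * tnu g k).
  have -> : tnu g k = tnu g g * tnu g (k - g).
    by have [_ <-] := nl g; rewrite addrC subrK.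
  rewrite nuNV FdivN; have := U1_neq0 (- g) F1.
  move: (F (- g)) (F k) ((beta g k)^-1) (tnu g g) (tnu g (k - g)) => x1 x2 x3 x4 x5 x10.
  by field.
have yr (k h : G) : F (k - h) * ((F (- h))^-1 * (tnu (- h) h)^-1) * tnu (k - h) h
    = F k * ((beta h k)^-1 * tnu k h).
  have -> : tnu k h = tnu h h * tnu (k - h) h.
    by have [_ <-] := nr h; rewrite addrC subrK.
  rewrite nuNV FdivN; have := U1_neq0 (- h) F1.
  move: (F (- h)) (F k) ((beta h k)^-1) (tnu h h) (tnu (k - h) h) => x1 x2 x3 x4 x5 x10.
  by field.
have sumk (u : G -> C) (chi : G -> G -> C) :
    (forall k, U1_character (fun h => chi h k)) -> (forall h, chi h 0 = 1) ->
    (forall k, (forall h, beta h k = chi h k) -> k = 0) ->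
    (forall k, u k = \sum_h F k * ((beta h k)^-1 * chi h k)) ->
    c *: ((c * #|G|%:R)^-1 *: \sum_k u k *: Ugen i k) = 1 :> tower L n.
  move=> chic chi0 nd ue; apply: delta => [|k k0]; rewrite ue.
    transitivity (\sum_(g : G) (1 : C)); last by rewrite sumr_const.
    by apply: eq_bigr => g _; rewrite F0 (U1_0 (bl _)) chi0 invr1 !mulr1.
  by apply: sum0 => //; apply: nd.
apply/unitrP; exists y; split.
  rewrite rE -scalerAr -scalerAl mulU.
  apply: (sumk _ (fun h k => tnu h k)) => // [h|k]; first exact: tnug0.
  by apply: eq_bigr => g _; rewrite yl.
rewrite rE -scalerAl -scalerAr mulU.
apply: (sumk _ (fun h k => tnu k h)) => // [h|k]; first exact: tnu0g.
rewrite (reindex_inj (can_inj (subKr k))) /=.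
by apply: eq_bigr => h _; rewrite subKr yr.
Qed.

Lemma card_neq0 : cardA != 0.
Proof. by rewrite pnatr_eq0 -lt0n; apply/card_gt0P; exists 0. Qed.

Lemma sqrt_card_neq0 : (sqrtC cardA)^-1 != 0.
Proof. by rewrite invr_eq0 sqrtC_eq0 card_neq0. Qed.

Lemma gauss_neq0 (F : A -> C) (beta : A -> A -> C) :
  U1_valued F -> U1_bicharacter beta ->
  (forall g h, F (g + h) = F g * F h * beta g h) ->
  (forall k, (forall h, beta h k = 1) -> k = 0) -> gauss F != 0.
Proof.
move=> F1 [bl br] FD nd; rewrite /gauss mulf_neq0 ?sqrt_card_neq0 //.
have F0 : F 0 = 1.
  apply: (mulfI (U1_neq0 0 F1)); have := FD 0 0.
  by rewrite addr0 (U1_0 (bl 0)) !mulr1.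
have : (\sum_a F a) * (\sum_a (F a)^-1) = cardA.
  rewrite mulr_sumr; under eq_bigr => g _.
    rewrite mulr_suml (reindex_inj (addrI g)) /=.
    under eq_bigr => k _ do
      rewrite FD [F g * _]mulrC [_ * F g * _]mulrAC mulfK ?U1_neq0 //.
    over.
  rewrite exchange_big (bigD1 0) //= [X in _ + X]big1 ?addr0 => [|k k0].
    transitivity (\sum_(g : A) (1 : C)); last by rewrite sumr_const.
    by apply: eq_bigr => g _; rewrite F0 (U1_0 (bl _)) mulr1.
  rewrite -mulr_sumr (sum_U1 (br k)) ?mulr0 //.
  by move=> h1; case/eqP: k0; apply: nd.
by move=> e; apply/eqP => e0; move: card_neq0; rewrite -e e0 mul0r eqxx.
Qed.

(* Hence the inverses in rho are genuine inverses.                            *)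
Lemma rgen_unit (F : link_family) (n : nat) (i : 'I_n.-1) :
  rgen (family_data F) i \is a GRing.unit.
Proof.
have ob (G : zmodType) : U1_bicharacter (fun _ _ : G => 1 : C).
  by split=> a; apply: U1_one.
case: F => [eps Q heps [chi [chi1 chiD] QE]|E QE PE adm|] /=.
- have q1 := qform_U1 q; have qn0 x := U1_neq0 x q1.
  apply: (@rgen_unit_gen (data_I Q) n _ Q (fun a b => <| a, b |> ^ eps) i
            sqrt_card_neq0) => //.
  + by move=> x; rewrite QE normrM chi1 mulr1; case: heps => ->;
      rewrite ?normrXz ?normfV q1 ?expr1z ?invr1.
  + case: heps => ->; first by rewrite /= ; exact: qform_bichar.
    by split=> a; apply: U1_inv; [apply: pairing_charr|apply: pairing_charl].
  + move=> a b; rewrite !QE chiD.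
    have -> : q (a + b) = <| a, b |> * (q a * q b).
      by rewrite mulfVK // mulf_neq0.
    move: <| a, b |> (q a) (q b) (chi a) (chi b) => x y z u v.
    by case: heps => ->; rewrite ?expr1z ?exprN1 ?invfM; ring.
  + move=> k /= h; apply: (qform_nondeg (m := q)) => b; rewrite pairingC; move: (h b).
    by case: heps => ->; rewrite ?expr1z ?exprN1 // => /eqP; rewrite invr_eq1 => /eqP.
  + move=> k /= h; apply: (qform_nondeg (m := q)) => b; rewrite pairingC; move: (h b).
    by case: heps => ->; rewrite ?expr1z ?exprN1 // => /eqP; rewrite invr_eq1 => /eqP.
- have [ED Esa QE1 PE1 QED PED] := adm.
  have EVD : {morph (E^-1)%g : x y / x + y}.
    by move=> x y; apply: (@perm_inj _ E); rewrite ED !permKV.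
  have EV_bichar : U1_bicharacter (fun a b => <| (E^-1)%g a, b |>).
    by split=> a; [apply: pairing_charr|apply: U1_comp EVD (pairing_charl a)].
  have E_bichar : U1_bicharacter (fun a b => <| E a, b |>).
    by split=> a; [apply: pairing_charr|apply: U1_comp ED (pairing_charl a)].
  have E_nondeg k : (forall h, <| E h, k |> = 1) -> k = 0.
    move=> h; apply: (qform_nondeg (m := q)) => b; rewrite pairingC.
    by rewrite -[b](permKV E).
  have EV_nondeg k : (forall h, <| (E^-1)%g h, k |> = 1) -> k = 0.
    move=> h; apply: (qform_nondeg (m := q)) => b; rewrite pairingC.
    by rewrite -[b](permK E).
  have gam : (gauss PE)^* / cardA != 0.
    rewrite mulf_neq0 ?invr_eq0 ?card_neq0 // conjC_eq0.
    apply: (@gauss_neq0 PE (fun a b => <| (E^-1)%g a, b |>)) => //.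
  apply: (@rgen_unit_gen (data_II QE PE) n _ (fun u => QE u.1 * PE u.2)
    (fun u v => <| E u.1, v.1 |> * <| (E^-1)%g u.2, v.2 |>) i gam) => //.
  + by move=> u /=; rewrite -mulrA.
  + by move=> u; rewrite normrM QE1 PE1 mulr1.
  + split=> u; apply: U1_mul.
    * exact: (U1_comp (h := fst) (fun _ _ => erefl) (E_bichar.1 _)).
    * exact: (U1_comp (h := snd) (fun _ _ => erefl) (EV_bichar.1 _)).
    * exact: (U1_comp (h := fst) (fun _ _ => erefl) (E_bichar.2 _)).
    * exact: (U1_comp (h := snd) (fun _ _ => erefl) (EV_bichar.2 _)).
  + by move=> u v; rewrite QED PED; ring.
  + move=> [k l] /= h; congr (_, _); [apply: E_nondeg => x | apply: EV_nondeg => x].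
      by have := h (x, 0); rewrite /= (U1_0 (EV_bichar.2 l)) mulr1.
    by have := h (0, x); rewrite /= (U1_0 (E_bichar.2 k)) mul1r.
  + move=> [k l] /= h; congr (_, _); [apply: E_nondeg => x | apply: EV_nondeg => x].
      by have := h (x, 0); rewrite /= (U1_0 (EV_bichar.2 l)) mulr1.
    by have := h (0, x); rewrite /= (U1_0 (E_bichar.2 k)) mul1r.
- apply: (@rgen_unit_gen data_III n cardA^-1 (fun=> 1) (fun _ _ => 1) i) => //.
  + by rewrite invr_eq0 card_neq0.
  + by move=> u /=; rewrite mulr1.
  + by move=> u; rewrite normr1.
  + exact: nu_III_bichar.
  + by move=> u v; rewrite !mulr1.
  + move=> [a b] /= h.
    have b0 : b = 0.
      apply: (qform_nondeg (m := q)) => x.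
      by have := h (0, x); rewrite /nu_III /= !pairing0r !mul1r => /esym.
    rewrite b0; congr (_, _); apply: (qform_nondeg (m := q)) => x.
    by have := h (x, 0); rewrite /nu_III /= b0 pairing0r pairing0l !mulr1 => /esym.
  + move=> [a b] /= h.
    have a0 : a = 0.
      apply: (qform_nondeg (m := q)) => x; rewrite pairingC.
      by have := h (x, 0); rewrite /nu_III /= !pairing0l !mulr1 => /esym.
    rewrite a0; congr (_, _); apply: (qform_nondeg (m := q)) => x; rewrite pairingC.
    by have := h (0, x); rewrite /nu_III /= a0 !pairing0r !mul1r => /esym.
Qed.

End Families.

(* The alphabet of inputs and outputs: two bits and a separator.              *)
Definition letter := option bool.
Local Notation bit b := (Some b : letter).
Local Notation sep := (None : letter).

Variant move := MoveL | MoveN | MoveR.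

(* The machine has tm_ntapes + 1 tapes. The domain of tm_delta is finite,     *)
(* so that it is a finite transition table.                                   *)
Record tm := TM {
  tm_ntapes : nat;
  tm_state : finType;
  tm_work : finType;
  tm_start : tm_state;
  tm_halt : pred tm_state;
  tm_delta : tm_state -> {ffun 'I_tm_ntapes.+1 -> option (letter + tm_work)} ->
    tm_state * ('I_tm_ntapes.+1 -> option (letter + tm_work) * move) }.

Section Machine.
Variable M : tm.

(* In a tape square, None is the blank.                                       *)
Definition tsym := option (letter + tm_work M).

(* A tape infinite in both directions: the squares left of the head, nearest  *)
(* first, the square under the head and the squares right of the head, all    *)
(* other squares being blank.                                                 *)
Record tape := Tape { tleft : seq tsym; thead : tsym; tright : seq tsym }.

Definition write (s : tsym) (t : tape) : tape := Tape (tleft t) s (tright t).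

Definition shift (d : move) (t : tape) : tape :=
  let: Tape l s r := t in
  match d with
  | MoveL => Tape (behead l) (head None l) (s :: r)
  | MoveN => t
  | MoveR => Tape (s :: l) (head None r) (behead r)
  end.

Definition tape_of (w : seq letter) : tape :=
  let s := [seq Some (inl a) | a <- w] in Tape [::] (head None s) (behead s).

Record config := Config {
  cstate : tm_state M;
  ctapes : 'I_(tm_ntapes M).+1 -> tape }.

Definition init_config (w : seq letter) : config :=
  Config (tm_start M) (fun k => tape_of (if k == ord0 then w else [::])).

Definition tm_step (c : config) : config :=
  if tm_halt (cstate c) then c else
  let: (st, act) := tm_delta (cstate c) [ffun k => thead (ctapes c k)] in
  Config st (fun k => shift (act k).2 (write (act k).1 (ctapes c k))).

(* The longest word over letter starting at the head of the tape.             *)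
Fixpoint read_word (s : seq tsym) : seq letter :=
  if s is Some (inl a) :: s' then a :: read_word s' else [::].

(* On the input w on the first tape, M halts after at most t steps with the   *)
(* word out starting at the head of the last tape.                            *)
Definition computes_within (w : seq letter) (t : nat) (out : seq letter) :=
  let c := iter t tm_step (init_config w) in
  tm_halt (cstate c) /\
  out = read_word (thead (ctapes c ord_max) :: tright (ctapes c ord_max)).

End Machine.

(* Binary numerals have the least significant bit first.                      *)
Definition nat_of_bits (s : seq bool) : nat :=
  foldr (fun (b : bool) m => (b + m.*2)%N) 0%N s.

Fixpoint bits_rec (k m : nat) : seq bool :=
  if k is k'.+1 then (if m is 0 then [::] else odd m :: bits_rec k' m./2)
  else [::].

Definition bits_of_nat (m : nat) : seq bool := bits_rec m m.

Lemma bits_of_natK : cancel bits_of_nat nat_of_bits.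
Proof.
suff H k m : (m <= k)%N -> nat_of_bits (bits_rec k m) = m by move=> m; apply: H.
elim: k m => [|k IH] [|m] //= le; rewrite IH; last by lia.
by rewrite -[in RHS](odd_double_half m.+1).
Qed.

Definition code_bits (s : seq bool) : seq letter := rcons [seq bit b | b <- s] sep.

Definition code_braid (n : nat) (w : braid_word n) : seq letter :=
  code_bits (bits_of_nat n) ++
  flatten [seq bit s.2 :: code_bits (bits_of_nat (val s.1).+1) | s <- w].

(* (s, u, v) stands for (-1)^s times the quotient of the numbers written u    *)
(* and v; the fraction need not be in lowest terms.                           *)
Definition fraction := (bool * seq bool * seq bool)%type.

Definition code_fraction (x : fraction) : seq letter :=
  let: (s, u, v) := x in bit s :: code_bits u ++ code_bits v.

Definition fraction_ok (x : fraction) : bool := nat_of_bits x.2 != 0%N.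

Definition rat_of_fraction (x : fraction) : rat :=
  let: (s, u, v) := x in (-1) ^+ s * (nat_of_bits u)%:R / (nat_of_bits v)%:R.

(* out lists the rational coordinates, in the basis b of the number field K   *)
(* embedded by iota, of the complex number z.                                 *)
Definition represents (C : numClosedFieldType) (K : fieldExtType rat)
    (iota : {rmorphism K -> C}) (d : nat) (b : d.-tuple K)
    (out : seq letter) (z : C) : Prop :=
  exists x : d.-tuple fraction,
    [/\ all fraction_ok x, out = flatten [seq code_fraction c | c <- x] &
        z = iota (\sum_(i < d) rat_of_fraction (tnth x i) *: tnth b i)].

(* Main.v *)
Require Import Defs.
From mathcomp Require Import all_boot all_order all_algebra all_fingroup all_solvable all_field.
From mathcomp Require Import boolp reals complex zify ring.

(* In every family each braid generator and its inverse are a constant times a sum of U^g weighted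
   by a quadratic function of g, and the coefficient of the identity is extracted by summing over a
   nondegenerate pairing. Hence, up to explicit factors, the invariant of a word of length l is the
   sum over y in Y^l, where Y = G x G, of a product of quadratic phases of the y_k and bicharacters
   of the pairs (y_j, y_k). With M = 4|Y| all these phases are M-th roots of unity, and the sum lifts
   to a sum over the (Z/M)-combinations u of l|Y| explicit vectors of V(b(c,u)) e(q(u)), where q is
   a quadratic form, b its polar form, c a fixed vector, e an additive character of Z/M and
   initially V = e. Bezout transformations, which are unimodular and so leave the sum unchanged,
   make all vectors but one orthogonal to c; summing over the multiples of the remaining vector v
   gives a sum of the same shape with c = v and a new V, obtained from the old one by one of
   finitely many linear operators on functions on Z/M. Such a function is a table of M numbers,
   which are kept as integer numerators over a common denominator in a basis of a number field.
   Applying an operator adds boundedly many digits, so all the arithmetic is polynomial. *)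

Set Implicit Arguments.
Unset Strict Implicit.
Unset Printing Implicit Defensive.

Import Order.TTheory GRing.Theory Num.Theory.
Local Open Scope ring_scope.

(** * Stack machines and their compilation to Turing machines *)

Section StackMachines.
Variables (K : nat) (S : finType).
Local Open Scope nat_scope.

(** The tower has dimension [|G|^(n-1)], so no product is ever computed in it: the word is turned at
    once into an exponential sum with variables attached to its letters, and n itself survives only
    as the exponent of the scalar D / beta. The coefficients lie in Z/M, which has zero divisors, so
    elimination cannot divide by a pivot, and nothing may be halved; hence matrices of determinant
    one, and a quadratic form kept beside its polar form. The elimination closes up because V sees u
    only through b(c,u): once the other vectors are orthogonal to c, the identity q(yv + u) = y^2
    q(v) + y b(v,u) + q(u) makes the sum over y a function of b(v,u) times e(q(u)). As for M,
    quadratic phases on Y have order dividing 2|Y|, and so have the square roots of b(a,a) that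
    replace the exponent z(z-1)/2; 4|Y| is a multiple of this. Fractions are never reduced: with
    numerators split into positive and negative parts, every operator is a fixed matrix of natural
    numbers, applied to all digits in one pass with bounded carries. All data depending only on the
    group and the phases sit in the transition table. *)

Variant sact := Keep | Pop | Push of S.

Definition stacks := seq (seq S).

Definition sapply (i : nat) (a : sact) (z : stacks) : stacks :=
  match a with
  | Keep => z
  | Pop => set_nth [::] z i (behead (nth [::] z i))
  | Push x => set_nth [::] z i (x :: nth [::] z i)
  end.

(** A state inspects and changes the single stack [midx]. A run ends with a value in a finite type,
    which the next machine may use; such values live in the finite control. *)
Record mach (X : finType) := Mach {
  mst : finType;
  mstart : mst;
  midx : mst -> 'I_K.+1;
  mstep : mst -> option S -> (mst + X) * sact }.

(** The number is an upper bound for the steps, not their exact count: [EvRet] accepts any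
    successor, so bounds can be weakened freely. *)
Inductive evals (X : finType) (m : mach X) : mst m -> stacks -> nat -> X -> stacks -> Prop :=
| EvRet s z t x a :
    mstep s (ohead (nth [::] z (midx s))) = (inr x, a) ->
    evals s z t.+1 x (sapply (midx s) a z)
| EvStep s z t x a s' z' :
    mstep s (ohead (nth [::] z (midx s))) = (inl s', a) ->
    evals s' (sapply (midx s) a z) t x z' -> evals s z t.+1 x z'.

Lemma evals_leq (X : finType) (m : mach X) s z t t' x z' :
  t <= t' -> @evals X m s z t x z' -> evals s z t' x z'.
Proof.
move=> + e; elim: e t' => {s z t x z'} [s z t x a e|s z t x a s' z' e _ IH] [|t'] // tt'.
  exact: EvRet.
by apply: EvStep e _; apply: IH.
Qed.

Definition runs (X : finType) (m : mach X) z t x z' := evals (mstart m) z t x z'.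

Lemma runs_leq (X : finType) (m : mach X) z t t' x z' :
  runs m z t x z' -> t <= t' -> runs m z t' x z'.
Proof. by move=> h tt'; apply: evals_leq h. Qed.

Definition ret (X : finType) (x : X) : mach X :=
  @Mach X unit tt (fun _ => ord0) (fun _ _ => (inr x, Keep)).

Definition pop (i : 'I_K.+1) : mach (option S) :=
  @Mach (option S) unit tt (fun _ => i) (fun _ o => (inr o, Pop)).

Definition push (i : 'I_K.+1) (a : S) : mach unit :=
  @Mach unit unit tt (fun _ => i) (fun _ _ => (inr tt, Push a)).

Lemma runs_ret (X : finType) (x : X) z : runs (ret x) z 1 x z.
Proof. exact: (@EvRet X (ret x) tt z 0 x Keep erefl). Qed.

Section Bind.
Variables (X Y : finType) (m : mach X) (k : X -> mach Y).

(** The continuations [k x] may have different state sets, hence the dependent sum; its tag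
    remembers the returned value. *)
Definition bind_st : finType := (mst m + {x : X & mst (k x)})%type.

Definition bind_idx (s : bind_st) :=
  match s with inl s => midx s | inr (existT x s) => midx s end.

Definition bind_step (s : bind_st) (o : option S) : (bind_st + Y) * sact :=
  match s with
  | inl s =>
    let: (r, a) := mstep s o in
    (match r with
     | inl s' => inl (inl s')
     | inr x => inl (inr (existT _ x (mstart (k x)))) end, a)
  | inr (existT x s) =>
    let: (r, a) := mstep s o in
    (match r with
     | inl s' => inl (inr (existT (fun x => mst (k x)) x s'))
     | inr y => inr y end, a)
  end.

Definition bind : mach Y := @Mach Y bind_st (inl (mstart m)) bind_idx bind_step.

Lemma runs_bind z t1 x z1 t2 y z2 :
  runs m z t1 x z1 -> runs (k x) z1 t2 y z2 -> runs bind z (t1 + t2) y z2.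
Proof.
move=> e1 e2; rewrite /runs /= in e1 *.
elim: e1 e2 => {z t1 x z1} [s z t1 x a e|s z t1 x a s' z' e _ IH] e2; last first.
  by apply: (@EvStep Y bind (inl s) z (t1 + t2) y a (inl s')) (IH e2); rewrite /= e.
rewrite addSn; apply: (@EvStep Y bind (inl s) z _ y a (inr (existT _ x (mstart (k x))))).
  by rewrite /= e.
apply: (@evals_leq _ _ _ _ t2); first exact: leq_addl.
elim: e2 => {z e t2 y z2} [s2 z t2 y a2 e|s2 z t2 y a2 s' z' e _ IH].
  by apply: (@EvRet Y bind (inr (existT _ x s2)) z t2 y a2); rewrite /= e.
by apply: (@EvStep Y bind (inr (existT _ x s2)) z t2 y a2 (inr (existT _ x s'))) IH; rewrite /= e.
Qed.
End Bind.

Section Loop.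
Variables (X Y : finType) (body : X -> mach (X + Y)%type).

Definition loop_st : finType := {x : X & mst (body x)}.

Definition loop_step (s : loop_st) (o : option S) : (loop_st + Y) * sact :=
  let: existT x s := s in
  let: (r, a) := mstep s o in
  (match r with
   | inl s' => inl (existT (fun x => mst (body x)) x s')
   | inr (inl x') => inl (existT _ x' (mstart (body x')))
   | inr (inr y) => inr y end, a).

Definition loop (x : X) : mach Y :=
  @Mach Y loop_st (existT _ x (mstart (body x)))
    (fun s => let: existT x s := s in midx s) loop_step.

(** [loop x] and [loop x'] share their states and transitions and differ only in the initial
    state. *)
Lemma evals_loop_start x x' (s : loop_st) z t y z' :
  @evals Y (loop x) s z t y z' -> @evals Y (loop x') s z t y z'.
Proof.
elim=> {s z t y z'} [s z t y a e|s z t y a s' z' e _ IH]; first exact: (@EvRet Y (loop x')).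
exact: (@EvStep Y (loop x')) e IH.
Qed.

Lemma runs_loop_next x z t1 x1 z1 t2 y z2 :
  runs (body x) z t1 (inl x1) z1 -> runs (loop x1) z1 t2 y z2 ->
  runs (loop x) z (t1 + t2) y z2.
Proof.
move=> e1 e2; rewrite /runs /= in e1 *.
move: e2 => /(evals_loop_start x).
move r : (inl x1 : X + Y) e1 => v e1 e2.
elim: e1 r e2 => {z t1 v z1} [s z t1 v a e|s z t1 v a s' z' e _ IH] r e2; last first.
  by apply: (@EvStep Y (loop x) (existT _ x s) z (t1 + t2) y a (existT _ x s')) (IH r e2); rewrite /= e.
rewrite addSn; apply: (@EvStep Y (loop x) (existT _ x s) z _ y a (existT _ x1 (mstart (body x1)))).
  by rewrite /= e -r.
exact: evals_leq (leq_addl _ _) e2.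
Qed.

Lemma runs_loop_done x z t y z' :
  runs (body x) z t (inr y) z' -> runs (loop x) z t y z'.
Proof.
rewrite /runs /=; move r : (inr y : X + Y) => v e.
elim: e r => {z t v z'} [s z t v a e|s z t v a s' z' e _ IH] r; last first.
  by apply: (@EvStep Y (loop x) (existT _ x s) z t y a (existT _ x s')) (IH r); rewrite /= e.
by apply: (@EvRet Y (loop x) (existT _ x s)); rewrite /= e -r.
Qed.
End Loop.

Lemma runs_pop (i : 'I_K.+1) z X (k : option S -> mach X) t x z' :
  runs (k (ohead (nth [::] z i))) (sapply i Pop z) t x z' ->
  runs (bind (pop i) k) z t.+1 x z'.
Proof.
move=> h; apply: (@runs_bind _ _ _ _ z 1 _ (sapply i Pop z) t _ _ _ h).
exact: (@EvRet _ (pop i) tt z 0).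
Qed.

Lemma runs_push (i : 'I_K.+1) a z X (k : unit -> mach X) t x z' :
  runs (k tt) (sapply i (Push a) z) t x z' ->
  runs (bind (push i a) k) z t.+1 x z'.
Proof.
move=> h; apply: (@runs_bind _ _ _ _ z 1 tt (sapply i (Push a) z) t _ _ _ h).
exact: (@EvRet _ (push i a) tt z 0).
Qed.

Lemma runs_push1 (i : 'I_K.+1) a z : runs (push i a) z 1 tt (sapply i (Push a) z).
Proof. exact: (@EvRet _ (push i a) tt z 0). Qed.

Definition move_stack (i j : 'I_K.+1) : mach unit :=
  loop (fun _ : unit => bind (pop i) (fun o =>
    if o is Some x then bind (push j x) (fun _ => ret (inl tt)) else ret (inr tt : unit + unit)%type)) tt.

Lemma runs_move (i j : 'I_K.+1) z : i != j -> j < size z ->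
  runs (move_stack i j) z (3 * size (nth [::] z i) + 2) tt
    (set_nth [::] (set_nth [::] z i [::]) j (rev (nth [::] z i) ++ nth [::] z j)).
Proof.
move=> ij; have ijn : (i == j :> nat) = false by apply/negbTE.
move zi : (nth [::] z i) => l; elim: l z zi => [|x l IH] z zi jz.
  apply: runs_loop_done; apply: runs_pop; rewrite zi /= zi.
  (* Writing stack [j] back onto itself changes nothing, as [j] differs from [i] and lies within the
     list. *)
  have -> : set_nth [::] (set_nth [::] z i [::]) j (nth [::] z j) = set_nth [::] z i [::].
    apply: (@eq_from_nth _ [::]); first by rewrite !size_set_nth; lia.
    by move=> k _; rewrite !nth_set_nth /= nth_set_nth /=; case: eqP => // ->; rewrite eq_sym ijn.
  exact: runs_ret.
have -> : 3 * size (x :: l) + 2 = 3 + (3 * size l + 2) by rewrite /=; lia.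
pose z1 := set_nth [::] (set_nth [::] z i l) j (x :: nth [::] z j).
apply: (@runs_loop_next _ _ _ _ _ _ tt z1).
  apply: runs_pop; rewrite zi /=; apply: runs_push; rewrite /= zi /= nth_set_nth /= eq_sym ijn.
  exact: runs_ret.
have z1i : nth [::] z1 i = l by rewrite /z1 nth_set_nth /= ifF // nth_set_nth /= eqxx.
have z1j : nth [::] z1 j = x :: nth [::] z j by rewrite /z1 nth_set_nth /= eqxx.
have := IH z1 z1i; rewrite z1j rev_cons cat_rcons.
have -> : set_nth [::] (set_nth [::] z1 i [::]) j (rev l ++ x :: nth [::] z j) =
    set_nth [::] (set_nth [::] z i [::]) j (rev l ++ x :: nth [::] z j).
  apply: (@eq_from_nth _ [::]) => [|k _]; first by rewrite /z1 !size_set_nth; lia.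
  rewrite /z1 !nth_set_nth /=; case: eqP => // kj.
  rewrite !nth_set_nth /=; case: eqP => // ki.
  by rewrite nth_set_nth /= ifN; last exact/eqP; rewrite nth_set_nth /= ifN //; apply/eqP.
by apply; rewrite /z1 !size_set_nth; lia.
Qed.

Fixpoint seq_mach (T : Type) (f : T -> mach unit) (l : seq T) : mach unit :=
  if l is i :: l' then bind (f i) (fun _ => seq_mach f l') else ret tt.

End StackMachines.
Arguments bind {K S X Y} m k : simpl never.
Arguments loop {K S X Y} body x : simpl never.
Arguments move_stack {K S} i j : simpl never.
Arguments pop {K S} i : simpl never.
Arguments push {K S} i a : simpl never.
Arguments ret {K S X} x : simpl never.
Arguments seq_mach {K S T} f l.

Section Compile.
Variables (K : nat) (W : finType).
Let S : finType := (letter + W)%type.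
Variable m : mach K S unit.
Local Open Scope nat_scope.

(* A push takes two steps of the Turing machine, a move and a write; the pending write is part of
   the state. *)
Definition ctm_state : finType := (option (mst m) * option ('I_K.+1 * S))%type.

Definition ctm_delta (st : ctm_state) (h : {ffun 'I_K.+1 -> option S}) :
    ctm_state * ('I_K.+1 -> option S * move) :=
  if st.2 is Some (i, a) then
    ((st.1, None), fun k => (if k == i then Some a else h k, MoveN))
  else if st.1 is Some s then
    let: (r, a) := mstep s (h (midx s)) in
    let nx := if r is inl s' then Some s' else None in
    match a with
    | Keep => ((nx, None), fun k => (h k, MoveN))
    | Pop => ((nx, None), fun k => if k == midx s then (None, MoveR) else (h k, MoveN))
    | Push x => ((nx, Some (midx s, x)), fun k => (h k, if k == midx s then MoveL else MoveN))
    end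
  else (st, fun k => (h k, MoveN)).

Arguments ctm_delta : simpl never.

Lemma ctm_delta_step s (h : {ffun 'I_K.+1 -> option S}) r a : mstep s (h (midx s)) = (r, a) ->
  ctm_delta (Some s, None) h =
  let nx := if r is inl s' then Some s' else None in
  match a with
  | Keep => ((nx, None), fun k => (h k, MoveN))
  | Pop => ((nx, None), fun k => if k == midx s then (None, MoveR) else (h k, MoveN))
  | Push x => ((nx, Some (midx s, x)), fun k => (h k, if k == midx s then MoveL else MoveN))
  end.
Proof. by rewrite /ctm_delta /= => ->. Qed.

Definition ctm : tm :=
  @TM K ctm_state W (Some (mstart m), None)
    (fun st => ~~ isSome st.1 && ~~ isSome st.2) ctm_delta.

(** The top of the stack is under the head and the stack extends to the right. The [j] blanks on the
    left account for squares erased by pops; among the [k] blanks on the right is the one read when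
    the stack is empty. *)
Definition tape_stack (t : tape ctm) (s : seq S) :=
  exists j k, tleft t = nseq j None /\ Defs.thead t :: tright t = map Some s ++ nseq k None.

Definition tapes_stacks (tp : 'I_K.+1 -> tape ctm) (z : stacks S) :=
  forall k : 'I_K.+1, tape_stack (tp k) (nth [::] z k).

Lemma tape_stack_ohead t s : tape_stack t s -> Defs.thead t = ohead s.
Proof. by case=> j [k] [_]; case: s => [|x s] /=; [case: k => [|k] // | ]; case. Qed.

Lemma tape_stack_pop t s : tape_stack t s -> tape_stack (shift MoveR (write None t)) (behead s).
Proof.
case: t => l h r [j] [k] [/= -> e]; exists j.+1.
case: s e => [|x [|y s]] /=.
- case: k => // k [_ ->]; exists k.-1.+1; split => //.
  by case: k.
- by move=> [_ ->]; exists k.-1.+1; split => //; case: k.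
- by move=> [_ ->]; exists k.
Qed.

Lemma tape_stack_push t s x : tape_stack t s ->
  tape_stack (shift MoveN (write (Some x) (shift MoveL (write (Defs.thead t) t)))) (x :: s).
Proof.
case: t => l h r [j] [k] [/= -> e]; exists j.-1, k; split => /=; first by case: j.
by rewrite e.
Qed.

Lemma tape_stack_keep t s : tape_stack t s -> tape_stack (shift MoveN (write (Defs.thead t) t)) s.
Proof. by case: t. Qed.

(** [Keep] and [Pop] cost one step of the Turing machine and [Push] costs two, whence the factor
    2. *)
Lemma ctm_simulates s z t x z' : @evals _ _ _ m s z t x z' ->
  forall tp, tapes_stacks tp z -> exists2 t', t' <= t.*2 & exists2 tp',
    iter t' (@tm_step ctm) (@Config ctm (Some s, None) tp) = @Config ctm (None, None) tp' &
    tapes_stacks tp' z'.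
Proof.
have step s0 z0 a r tp : mstep s0 (ohead (nth [::] z0 (midx s0))) = (r, a) ->
    tapes_stacks tp z0 -> exists2 t', t' <= 2 & exists2 tp',
    iter t' (@tm_step ctm) (@Config ctm (Some s0, None) tp) =
      @Config ctm (if r is inl s' then Some s' else None, None) tp' &
    tapes_stacks tp' (sapply (midx s0) a z0).
  move=> e tz; pose h : {ffun 'I_K.+1 -> option S} := [ffun k => Defs.thead (tp k)].
  have /ctm_delta_step eh : mstep s0 (h (midx s0)) = (r, a).
    by rewrite ffunE (tape_stack_ohead (tz _)) e.
  case: a e eh => [||y] e eh.
  - exists 1 => //; exists (fun k => shift MoveN (write (Defs.thead (tp k)) (tp k))); last first.
      by move=> k; apply: tape_stack_keep.
    rewrite /= /tm_step /= -/h. rewrite eh /=.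
    by congr Config; apply: funext => k; rewrite ffunE.
  - exists 1 => //; exists (fun k => if k == midx s0 then shift MoveR (write None (tp k)) else
      shift MoveN (write (Defs.thead (tp k)) (tp k))); last first.
      move=> k; rewrite /= nth_set_nth /=; case: (altP (k =P midx s0)) => [->|ne].
        by rewrite eqxx; apply: tape_stack_pop.
      by rewrite (inj_eq val_inj) (negPf ne); apply: tape_stack_keep.
    rewrite /= /tm_step /= -/h. rewrite eh /=.
    by congr Config; apply: funext => k; rewrite ffunE; case: eqP.
  exists 2 => //; exists (fun k => if k == midx s0
    then shift MoveN (write (Some y : tsym ctm) (shift MoveL (write (Defs.thead (tp k)) (tp k)))) else
      shift MoveN (write (Defs.thead (tp k)) (tp k))); last first.
    move=> k; rewrite /= nth_set_nth /=; case: (altP (k =P midx s0)) => [->|ne].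
      by rewrite eqxx; apply: tape_stack_push.
    by rewrite (inj_eq val_inj) (negPf ne); apply: tape_stack_keep.
  rewrite /= {2}/tm_step /= -/h eh /=.
  rewrite /tm_step /= andbF /ctm_delta /=.
  congr Config; apply: funext => k; rewrite !ffunE; case: eqP => // _.
elim=> {s z t x z'} [s z t x a e|s z t x a s' z' e _ IH] tp tz.
  have [t' t2 [tp' e' tz']] := step _ _ _ _ _ e tz.
  by exists t'; [rewrite doubleS (leq_trans t2) | exists tp'].
have [t1 t2 [tp1 e1 tz1]] := step _ _ _ _ _ e tz.
have [t' t3 [tp' e' tz']] := IH _ tz1.
exists (t' + t1); first by rewrite doubleS -addn2 leq_add.
by exists tp' => //; rewrite iterD e1.
Qed.

(** The initial tapes represent the stacks with [w] on stack 0. At the end the last tape shows [out]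
    followed by blanks, and [read_word] stops at the first blank. *)
Lemma ctm_computes w t z' out :
  runs m (map inl w :: nseq K [::]) t tt z' -> nth [::] z' K = map inl out ->
  exists2 t', t' <= t.*2 & computes_within ctm w t' out.
Proof.
move=> /ctm_simulates r e; set c := init_config ctm w.
have [k|t' t2 [tp' e' tz']] := r (ctapes c).
  rewrite /c /=; case: k => -[|k] /= k1.
    case: w {r c} => [|a w]; first by exists 0, 1.
    by exists 0, 0; split=> //=; rewrite cats0 -map_comp.
  by exists 0, 1; rewrite nth_nseq if_same.
exists t' => //; rewrite /computes_within -/c.
have -> : c = @Config ctm (Some (mstart m), None) (ctapes c) by [].
have [j [k []]] := tz' ord_max; rewrite [nth _ _ _]e => _ et.
rewrite e'; split=> //; rewrite [X in read_word X]et.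
elim: out {e et} => [|a out IH] /=; last by rewrite -IH.
by case: k.
Qed.
End Compile.

(** * Number fields *)

Section NumberField.
Variable C : numClosedFieldType.
Local Notation pQ := (map_poly (ratr : rat -> C)).

(** Induction on [s]: the primitive element theorem in characteristic 0 gives an n for which both x
    and z are polynomials in [x *+ n - z]. *)
Lemma primitive_element_seq (s : seq C) :
  {in s, forall x, algebraicOver ratr x} ->
  exists2 z, algebraicOver ratr z & {in s, forall x, exists p, x = (pQ p).[z]}.
Proof.
elim: s => [_|x s IH algs]; first by exists 0 => //; apply: algebraic0.
have /IH[z algz Dz] : {in s, forall x, algebraicOver ratr x}.
  by move=> y ys; apply: algs; rewrite inE ys orbT.
have algx : algebraicOver ratr x by apply: algs; rewrite mem_head.
have [px nz_px px0] := algx; have [pz nz_pz pz0] := algz.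
have [n [[p Dp] [q Dq]]] := pchar0_PET nz_pz pz0 nz_px px0 (@pchar_num _).
pose zn := x *+ n - z; exists zn.
  apply: algebraic_sub => //; rewrite -mulr_natl; apply: algebraic_mul => //.
  by rewrite -(ratr_nat C n); apply: algebraic_id.
move=> y; rewrite inE => /predU1P[->|/Dz[r ->]]; first by exists q.
by exists (r \Po p); rewrite map_comp_poly horner_comp -Dp.
Qed.

(** The field is Q(z) for a primitive element z, realised as Q[X]/(q) with q of least size among the
    nonzero polynomials vanishing at z, which makes q irreducible. *)
Lemma number_field_seq (s : seq C) :
  {in s, forall x, algebraicOver ratr x} ->
  exists (K : fieldExtType rat) (iota : {rmorphism K -> C}),
    {in s, forall x, exists y, x = iota y}.
Proof.
move=> /primitive_element_seq[z [p nz_p pz] Ds].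
have [q [qz nz_q] qmin] : exists2 q : {poly rat}, root (pQ q) z /\ q != 0 &
    forall r, root (pQ r) z -> r != 0 -> (size q <= size r)%N.
  have ex : exists n, `[< exists q : {poly rat}, [/\ root (pQ q) z, q != 0 & size q = n] >].
    by exists (size p); apply/asboolP; exists p.
  case: (ex_minnP ex) => n /asboolP[q [qz nz_q sz]] nmin.
  by exists q => // r rz nz_r; rewrite sz; apply: nmin; apply/asboolP; exists r.
have irr_q : irreducible_poly q by apply/(subfx_irreducibleP qz nz_q).
exists (SubFieldExtType qz irr_q), (@subfx_inj _ _ ratr z q) => x /Ds[r ->].
by exists (subfx_eval ratr z q r); symmetry; apply: subfx_inj_eval.
Qed.

End NumberField.

(** * Gauss sums over lattices *)

Section LatticeSums.
Variables (C : comNzRingType) (R : finComNzRingType) (U : lmodType R).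
Implicit Types (f : U -> C) (u v : U) (vs : seq U).

(* The sum of f over all linear combinations of vs, counted with multiplicity. *)
Fixpoint lsum f vs : C :=
  if vs is v :: vs' then \sum_(x : R) lsum (fun u => f (x *: v + u)) vs' else f 0.

Lemma eq_lsum f f' vs : f =1 f' -> lsum f vs = lsum f' vs.
Proof.
by elim: vs f f' => [|v vs IH] f f' e /=; rewrite ?e //; apply: eq_bigr => x _; apply: IH => u.
Qed.

Lemma lsum_swap f u v vs : lsum f [:: u, v & vs] = lsum f [:: v, u & vs].
Proof.
rewrite /= exchange_big; apply: eq_bigr => x _; apply: eq_bigr => y _.
by apply: eq_lsum => w; rewrite addrCA.
Qed.

Lemma lsum_cons_eq f v vs vs' :
  (forall g, lsum g vs = lsum g vs') -> lsum f (v :: vs) = lsum f (v :: vs').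
Proof. by move=> e /=; apply: eq_bigr => x _. Qed.

Lemma lsum_catCA f u vs vs' : lsum f (vs ++ u :: vs') = lsum f (u :: vs ++ vs').
Proof.
elim: vs f => [|v vs IH] f //; rewrite cat_cons lsum_swap.
exact: lsum_cons_eq.
Qed.

(** The coefficients of u and v undergo a substitution of determinant 1, a bijection of R x R; its
    inverse [h'] comes from the adjugate matrix. *)
Lemma lsum_bezout f (p q s t : R) u v vs : p * t - q * s = 1 ->
  lsum f [:: u, v & vs] = lsum f [:: p *: u + s *: v, q *: u + t *: v & vs].
Proof.
move=> det; rewrite /= !pair_big /=.
pose h (z : R * R) := (z.1 * p + z.2 * q, z.1 * s + z.2 * t).
pose h' (z : R * R) := (z.1 * t - z.2 * q, z.2 * p - z.1 * s).
have hK : cancel h h'.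
  move=> [x y]; rewrite /h /h' /=; congr (_, _).
    by rewrite -[RHS](mulr1 x) -det; ring.
  by rewrite -[RHS](mulr1 y) -det; ring.
rewrite (reindex_inj (can_inj hK)) /=; apply: eq_bigr => -[x y] _ /=.
apply: eq_lsum => w; congr f; rewrite !scalerDr !scalerDl !scalerA !addrA.
by congr (_ + _); rewrite -!addrA; congr (_ + _); rewrite addrCA addrA.
Qed.

Section Round.
Variables (bez : R -> R -> R * R * R * R).

(** A linear form is carried along by its values: [g] at the pivot [c], and each first component in
    [rest] at its vector. Every step yields a new pivot and one vector, put into [acc], on which the
    form vanishes. *)
Fixpoint bezout_fold (g : R) (c : U) acc (rest : seq (R * U)) : R * U * seq U :=
  if rest is (l, u) :: rest' then
    let: (p, q, s, t) := bez g l in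
    bezout_fold (p * g + s * l) (p *: c + s *: u) (q *: c + t *: u :: acc) rest'
  else (g, c, acc).

Hypothesis bezP : forall a b, let: (p, q, s, t) := bez a b in
  p * t - q * s = 1 /\ q * a + t * b = 0.

Lemma bezout_fold_lsum f g c acc rest :
  lsum f (c :: acc ++ map snd rest) =
  let: (g', c', acc') := bezout_fold g c acc rest in lsum f (c' :: acc').
Proof.
elim: rest g c acc => [|[l u] rest IH] g c acc; first by rewrite cats0.
rewrite [bezout_fold _ _ _ _]/=; have := bezP g l; case: (bez g l) => [[[p q] s] t] [det _].
rewrite -IH map_cons (lsum_cons_eq _ _ (fun _ => lsum_catCA _ _ _ _)).
by rewrite (lsum_bezout _ _ _ _ det).
Qed.

Lemma bezout_fold_form (lin : U -> R) g c acc rest :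
  (forall x y u v, lin (x *: u + y *: v) = x * lin u + y * lin v) ->
  lin c = g -> {in acc, forall u, lin u = 0} -> {in rest, forall z, lin z.2 = z.1} ->
  let: (g', c', acc') := bezout_fold g c acc rest in
  lin c' = g' /\ {in acc', forall u, lin u = 0}.
Proof.
move=> linP; elim: rest g c acc => [|[l u] rest IH] g c acc //= cg acc0 rl.
have := bezP g l; case: (bez g l) => [[[p q] s] t] [_ eq0].
have ul : lin u = l by have /= := rl _ (mem_head _ _).
apply: IH; first by rewrite linP cg ul.
  by move=> w; rewrite inE => /predU1P[->|/acc0//]; rewrite linP cg ul.
by move=> z zr; apply: rl; rewrite inE zr orbT.
Qed.

Variables (qf : U -> R) (bf : U -> U -> R) (e : R -> C).
Hypothesis bfP : forall w x y u v, bf w (x *: u + y *: v) = x * bf w u + y * bf w v.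
Hypothesis qfP : forall x u v, qf (x *: u + v) = x * x * qf u + x * bf u v + qf v.
Hypothesis eD : {morph e : x y / x + y >-> x * y}.

Definition gauss_fn (V : R -> C) (c u : U) : C := V (bf c u) * e (qf u).

(** The table left after summing over the multiples y v of a vector v, where g = b(c,v), s = q(v)
    and x stands for b(v,u). *)
Definition gauss_step (g s : R) (V : R -> C) (x : R) : C :=
  \sum_y V (y * g) * e (y * y * s + y * x).

Lemma bf0 w : bf w 0 = 0.
Proof. by have := bfP w 0 0 0 0; rewrite !scale0r !mul0r !addr0. Qed.

Lemma eq_lsum_in f f' (P : U -> Prop) vs : P 0 ->
  (forall x v u, v \in vs -> P u -> P (x *: v + u)) ->
  (forall u, P u -> f u = f' u) -> lsum f vs = lsum f' vs.
Proof.
move=> P0; elim: vs f f' => [|v vs IH] f f' PD ef /=; first exact: ef.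
apply: eq_bigr => x _; apply: IH => [y w u wv|u Pu].
  by apply: PD; rewrite inE wv orbT.
by apply/ef/PD; rewrite ?mem_head.
Qed.

(** Every combination u of [vs] is orthogonal to c, so b(c, yv + u) = y b(c,v) no longer depends on
    u; the expansion of q(yv + u) supplies the rest. *)
Lemma lsum_peel V c v vs : {in vs, forall u, bf c u = 0} ->
  lsum (gauss_fn V c) (v :: vs) = lsum (gauss_fn (gauss_step (bf c v) (qf v) V) v) vs.
Proof.
move=> c0 /=; have lsumD (F : R -> U -> C) : \sum_x lsum (F x) vs = lsum (fun u => \sum_x F x u) vs.
  elim: vs {c0} F => [|w vs IH] F //=.
  by rewrite exchange_big; apply: eq_bigr => y _; rewrite IH.
rewrite lsumD; apply: (@eq_lsum_in _ _ (fun u => bf c u = 0)) => [|x w u /c0 w0 u0|u u0].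
- exact: bf0.
- by have := bfP c x 1 w u; rewrite scale1r w0 u0 !mulr0 addr0.
rewrite /gauss_fn /gauss_step mulr_suml; apply: eq_bigr => y _.
have := bfP c y 1 v u; rewrite scale1r u0 mulr0 addr0 => ->.
by rewrite qfP -[RHS]mulrA -eD.
Qed.

(** The fold runs on the linear form b(c,-), so that afterwards only the pivot may fail to be
    orthogonal to c. *)
Lemma lsum_round V c v vs :
  lsum (gauss_fn V c) (v :: vs) =
  let: (g, c', vs') := bezout_fold (bf c v) v [::] [seq (bf c u, u) | u <- vs] in
  lsum (gauss_fn (gauss_step g (qf c') V) c') vs'.
Proof.
have := bezout_fold_lsum (gauss_fn V c) (bf c v) v [::] [seq (bf c u, u) | u <- vs].
have := @bezout_fold_form (bf c) (bf c v) v [::] [seq (bf c u, u) | u <- vs].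
rewrite -map_comp map_id_in // => /(_ (bfP c) erefl).
case: bezout_fold => [[g c'] vs'] H ->.
have [//|z /mapP[u _ ->] //|cg c0] := H.
by rewrite lsum_peel // cg.
Qed.

End Round.
End LatticeSums.

(** * Bezout matrices over Z/M *)

Section Bezout.
Variable m : nat.
Local Notation R := 'I_m.+2.

(** Residues are lifted to natural numbers, where the extended Euclidean identity u a = v b + gcd
    can be divided by the gcd; this division is not possible in Z/M itself. *)
Lemma exists_bezout (a b : R) : exists z : R * R * R * R,
  let: (p, q, s, t) := z in p * t - q * s = 1 /\ q * a + t * b = 0.
Proof.
have nR (x : R) : x = (x : nat)%:R by rewrite natr_Zp.
case: (posnP a) => [a0|a_gt0].
  (* For a = 0 the two vectors are exchanged, up to a sign that keeps the determinant 1. *)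
  exists (0, 1, -1, 0); split; first by ring.
  by rewrite [a]nR a0; ring.
case: (egcdnP b a_gt0) => u v euv _.
have /dvdnP[a' ea] := dvdn_gcdl a b; have /dvdnP[b' eb] := dvdn_gcdr a b.
have g_gt0 : (0 < gcdn a b)%N by rewrite gcdn_gt0 a_gt0.
have e1 : (u * a' = v * b' + 1)%N.
  apply/eqP; rewrite -(eqn_pmul2r g_gt0) mulnDl -!mulnA -ea -eb mul1n; apply/eqP.
  by rewrite euv; congr (_ + _)%N.
exists (u%:R, - b'%:R, - v%:R, a'%:R); split.
  have : (u * a')%:R = (v * b' + 1)%:R :> R by rewrite e1.
  by rewrite natrD !natrM => ->; ring.
rewrite [a]nR [b]nR {1}ea {2}eb !natrM; ring.
Qed.

(** The classical choice does no harm to computability: the ring is finite, and the function is a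
    table built into the machine. *)
Definition bezout (a b : R) : R * R * R * R := projT1 (cid (exists_bezout a b)).

Lemma bezoutP a b : let: (p, q, s, t) := bezout a b in
  p * t - q * s = 1 /\ q * a + t * b = 0.
Proof. exact: projT2 (cid (exists_bezout a b)). Qed.

End Bezout.

(** * The invariant as a sum of quadratic phases *)

Section QuadraticLetters.
Variables (C : numClosedFieldType) (L : link_data C).
Local Notation G := (tgrp L).
Local Notation nu := (@tnu C L).
Local Notation tau := (@ttau C L).

Definition letter_gen n (s : 'I_n.-1 * bool) : tower L n :=
  if s.2 then rgen L s.1 else (rgen L s.1)^-1.

(** The uniform shape of all families: a letter of either sign ([true] for the generator) is a
    constant times a sum of U^g weighted by a quadratic function with bicharacter [ql_form]. The
    nondegenerate [ql_pair] serves to detect 0 in G. *)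
Record quadratic_letters := QuadraticLetters {
  ql_const : bool -> C;
  ql_fun : bool -> G -> C;
  ql_form : bool -> G -> G -> C;
  ql_pair : G -> G -> C;
  ql_fun_U1 : forall s, U1_valued (ql_fun s);
  ql_form_bichar : forall s, U1_bicharacter (ql_form s);
  ql_funD : forall s g h, ql_fun s (g + h) = ql_fun s g * ql_fun s h * ql_form s g h;
  ql_gen : forall n (s : 'I_n.-1 * bool),
    letter_gen s = ql_const s.2 *: \sum_g ql_fun s.2 g *: Ugen s.1 g;
  ql_pair_bichar : U1_bicharacter ql_pair;
  ql_pair_nondeg : forall k, (forall h, ql_pair h k = 1) -> k = 0;
  ql_nu_bichar : U1_bicharacter nu }.

Lemma card_finZmod_neq0 (Z : finZmodType) : #|Z|%:R != 0 :> C.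
Proof. by rewrite pnatr_eq0 -lt0n; apply/card_gt0P; exists 0. Qed.

(** The inverse generator has weights [(F (- g))^-1 * nu g g] and constant [(c * #|G|%:R)^-1]. In
    the product with the generator, the coefficient of U^k is a multiple of the sum over g of
    beta(g,k)^-1 nu(g,k), a character sum that vanishes for k different from 0 by the nondegeneracy
    assumption. *)
Lemma exists_quadratic_letters (c : C) (F : G -> C) (beta pr : G -> G -> C) :
  (forall n (i : 'I_n.-1), rgen L i \is a GRing.unit) ->
  c != 0 -> (forall g, lf g = c * F g) -> U1_valued F ->
  U1_bicharacter beta -> U1_bicharacter nu ->
  (forall g h, F (g + h) = F g * F h * beta g h) ->
  (forall k, (forall h, beta h k = nu h k) -> k = 0) ->
  U1_bicharacter pr -> (forall k, (forall h, pr h k = 1) -> k = 0) ->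
  exists ql : quadratic_letters,
    ql_const ql = (fun s => if s then c else (c * #|G|%:R)^-1).
Proof.
move=> ru c0 fE F1 bb nb FD nd prb prnd.
have [bl br] := bb; have [nl nr] := nb.
pose F' (g : G) := (F (- g))^-1 * nu g g.
pose beta' (g h : G) := (beta g h)^-1 * (nu g h * nu h g).
have F0 : F 0 = 1.
  apply: (mulfI (U1_neq0 0 F1)); have := FD 0 0.
  by rewrite addr0 (U1_0 (bl 0)) !mulr1.
unshelve (eexists (@QuadraticLetters (fun s => if s then c else (c * #|G|%:R)^-1)
   (fun s => if s then F else F') (fun s => if s then beta else beta') pr _ _ _ _ prb prnd nb)) => //.
- case=> // g; rewrite /F' normrM normfV F1 invr1 mul1r.
  by have [h _] := nl g; apply: h.
- case=> //; split=> g; apply: U1_mul.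
  + exact: U1_inv.
  + exact: U1_mul.
  + exact: U1_inv.
  + exact: U1_mul.
- case=> // g h; rewrite /F' /beta' opprD FD (U1_N g (br _)) (U1_N h (bl _)) invrK.
  by rewrite (nl (g + h)).2 !(nr _).2 !invfM; ring.
move=> n [i s] /=; rewrite /letter_gen /=; case: s => /=.
  by rewrite scaler_sumr; apply: eq_bigr => g _; rewrite fE scalerA.
have /divrr rr := ru n i; set y := _ *: _.
(* The generator is already known to be a unit, so a left inverse is the inverse. *)
suff yr : y * rgen L i = 1 by rewrite -[LHS]mul1r -yr -mulrA rr mulr1.
have -> : y * rgen L i = \sum_k ((c * #|G|%:R)^-1 * c *
    \sum_g F k * ((beta g k)^-1 * nu g k)) *: Ugen i k.
  rewrite /y /rgen -scalerAl mulr_suml scaler_sumr.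
  under [RHS]eq_bigr => k _ do rewrite mulr_sumr scaler_suml.
  rewrite exchange_big /=; apply: eq_bigr => g _.
  rewrite mulr_sumr scaler_sumr [RHS](reindex_inj (addrI g)) /=; apply: eq_bigr => h _.
  rewrite -scalerAl -scalerAr UgenM !scalerA fE; congr (_ *: _).
  rewrite /F' FD (bl g).2 (nl g).2 !invfM.
  have Fg0 := U1_neq0 g F1; have FN0 := U1_neq0 (- g) F1.
  have -> : (F (- g))^-1 = F g * (beta g g)^-1.
    apply: (mulIf FN0); rewrite mulVf // mulrAC.
    by rewrite -(U1_N g (bl g)) -FD subrr F0.
  have bg h' : beta g h' != 0 by have [h1 _] := bl g; exact: U1_neq0 h1.
  move: (F g) (F h) (beta g g) (beta g h) (nu g g) (nu g h) (#|G|%:R^-1) (bg g) (bg h)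
    => x1 x2 x3 x4 x5 x6 x7 b1 b2.
  by field; rewrite ?c0 ?b1 ?b2.
rewrite (bigD1 0) //= [X in _ + X]big1 ?addr0 => [|k k0].
  rewrite Ugen0 [X in _ * X](eq_bigr (fun=> 1)) => [|g _]; last first.
    by rewrite F0 (U1_0 (bl g)) (U1_0 (nl g)) invr1 !mulr1.
  have e1 (x : C) : x != 0 -> (c * x)^-1 * c * x = 1 by move=> x0; field; rewrite ?c0 ?x0.
  by rewrite sumr_const e1 ?scale1r // card_finZmod_neq0.
rewrite -mulr_sumr sum_U1 ?mulr0 ?scale0r //; first exact: U1_mul (U1_inv (br k)) (nr k).
move=> h1; case/eqP: k0; apply: nd => h; have b0 : beta h k != 0.
  by have [h2 _] := bl h; exact: U1_neq0 h2.
by apply: (mulfI (_ : (beta h k)^-1 != 0)); rewrite ?invr_eq0 // h1 mulVf.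
Qed.
End QuadraticLetters.

(** * Orders of characters and of quadratic functions *)

Section RootsOfUnity.
Variables (C : numClosedFieldType) (G : finZmodType).

(** Translation by g permutes G and adds |G| g to the sum of all elements. *)
Lemma mulrn_card (g : G) : g *+ #|G| = 0.
Proof.
apply: (addrI (\sum_(h : G) h)); rewrite addr0 [RHS](reindex_inj (addIr g)) /=.
by rewrite big_split /= sumr_const.
Qed.

Lemma U1_mulrn (chi : G -> C) g n : U1_character chi -> chi (g *+ n) = chi g ^+ n.
Proof.
move=> chic; elim: n => [|n IH]; first by rewrite mulr0n expr0 U1_0.
by rewrite mulrS exprS (chic.2) IH.
Qed.

Lemma U1_card (chi : G -> C) g : U1_character chi -> chi g ^+ #|G| = 1.
Proof. by move=> chic; rewrite -U1_mulrn // mulrn_card U1_0. Qed.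

Section Quadratic.
Variables (F : G -> C) (beta : G -> G -> C).
Hypotheses (F1 : U1_valued F) (bb : U1_bicharacter beta).
Hypothesis FD : forall g h, F (g + h) = F g * F h * beta g h.

Lemma quadratic0 : F 0 = 1.
Proof.
apply: (mulfI (U1_neq0 0 F1)); have := FD 0 0.
by rewrite addr0 (U1_0 (bb.1 0)) !mulr1.
Qed.

Lemma quadratic_mulrn g n : F (g *+ n) = F g ^+ n * beta g g ^+ 'C(n, 2).
Proof.
elim: n => [|n IH]; first by rewrite mulr0n quadratic0 bin0n !expr0 mulr1.
rewrite mulrSr FD IH; have /= -> := U1_mulrn g n (bb.2 g).
by rewrite binS bin1 exprS exprD; ring.
Qed.

(** With N = |G|, F(Ng) = 1 is F(g)^N b(g,g)^(N(N-1)/2). Squaring turns the second exponent into a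
    multiple of N, and b(g,g)^N = 1. *)
Lemma quadratic_card g : F g ^+ (2 * #|G|) = 1.
Proof.
have : F (g *+ #|G|) ^+ 2 = 1 by rewrite mulrn_card quadratic0 expr1n.
rewrite quadratic_mulrn exprMn -!exprM mulnC [('C(_, _) * _)%N]mulnC -mul_bin_diag bin1.
by rewrite [in X in _ * X]exprM (U1_card _ (bb.1 g)) expr1n mulr1.
Qed.

End Quadratic.
End RootsOfUnity.

(** * The three families have quadratic letters *)

Section FamilyLetters.
Variable C : numClosedFieldType.
Local Notation alg := (algebraicOver (ratr : rat -> C)).

Lemma algebraic_exp_nat (x : C) (n k : nat) : x ^+ n.+1 = k%:R -> alg x.
Proof.
move=> xn; exists ('X^(n.+1) - k%:R%:P); first by rewrite monic_neq0 // monicXnsubC.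
by rewrite rmorphB rmorphXn /= map_polyX map_polyC /= ratr_nat /root !hornerE xn subrr.
Qed.

Lemma algebraic_nat k : alg k%:R.
Proof. exact: (@algebraic_exp_nat _ 0). Qed.

Lemma algebraic_sum (I : finType) (F : I -> C) : (forall i, alg (F i)) -> alg (\sum_i F i).
Proof.
by move=> Fa; elim/big_ind: _ => // [|x y]; [apply: algebraic0 | apply: algebraic_add].
Qed.

Lemma algebraic_conj (x : C) : alg x -> alg x^*.
Proof.
case=> p p0 px; exists p => //; move: px; rewrite /root => /eqP px.
have -> : map_poly ratr p = map_poly Num.conj (map_poly ratr p) :> {poly C}.
  by rewrite -map_poly_comp; apply: eq_map_poly => a; rewrite /= fmorph_rat.
by rewrite horner_map px rmorph0.
Qed.

Variables (A : finZmodType) (q : metric_form C A).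
Local Notation "<| a , b |>" := (pairing_of q a b).

Lemma U1_one_bichar (G : zmodType) : U1_bicharacter (fun _ _ : G => 1 : C).
Proof. by split=> a; split=> [x|x y]; rewrite ?normr1 ?mulr1. Qed.

Lemma pairing_nondeg k : (forall h, <| h, k |> = 1) -> k = 0.
Proof. by move=> h; apply: (qform_nondeg (m := q)) => b; rewrite pairingC. Qed.

Definition pairing2 (u v : A * A) : C := <| u.1, v.1 |> * <| u.2, v.2 |>.

Lemma pairing2_bichar : U1_bicharacter pairing2.
Proof.
split=> u; apply: U1_mul.
- exact: (U1_comp (h := fst) (fun _ _ => erefl) (pairing_charr q _)).
- exact: (U1_comp (h := snd) (fun _ _ => erefl) (pairing_charr q _)).
- exact: (U1_comp (h := fst) (fun _ _ => erefl) (pairing_charl q _)).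
- exact: (U1_comp (h := snd) (fun _ _ => erefl) (pairing_charl q _)).
Qed.

Lemma pairing2_nondeg k : (forall h, pairing2 h k = 1) -> k = 0.
Proof.
case: k => k l h; congr (_, _); apply: pairing_nondeg => x.
  by have := h (x, 0); rewrite /pairing2 /= pairing0l mulr1.
by have := h (0, x); rewrite /pairing2 /= pairing0l mul1r.
Qed.

(** In Families I and II nu is trivial and nondegeneracy comes from the quadratic function; in
    Family III the function is constant and nondegeneracy comes from the triangular shape of
    [nu_III]. The constants are algebraic, being built from integers, a square root and a Gauss sum
    of roots of unity. *)
Lemma family_quadratic_letters (F : link_family q) :
  [/\ lalpha (family_data F) != 0, alg (lalpha (family_data F)),
    alg (lD (family_data F) / lbeta (family_data F)) &
    exists ql : quadratic_letters (family_data F), forall s, alg (ql_const ql s)].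
Proof.
have alg_const (L : link_data C) (c : C) : alg c ->
    (exists ql : quadratic_letters L, ql_const ql = (fun s => if s then c else (c * #|tgrp L|%:R)^-1)) ->
    exists ql : quadratic_letters L, forall s, alg (ql_const ql s).
  move=> ca [ql e]; exists ql => s; rewrite e; case: s => //.
  by apply/algebraic_inv/algebraic_mul/algebraic_nat.
have cardA0 := card_neq0 C A.
have alg_card : alg (sqrtC #|A|%:R) by apply: (@algebraic_exp_nat _ 1 #|A|); rewrite sqrtCK.
have unit := @rgen_unit C A q F.
case: F unit => [eps Q heps [chi [chi1 chiD] QE]|E QE PE adm|] unit.
- split; rewrite ?oner_eq0 //; first exact: algebraic1.
    exact: (algebraic_div (algebraic_nat _)).
  have q1 := qform_U1 q; have qn0 x := U1_neq0 x q1.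
  apply: (alg_const _ (sqrtC #|A|%:R)^-1 (algebraic_inv _)) => //.
  have bb : U1_bicharacter (fun a b => <| a, b |> ^ eps).
    case: (heps) => ->; first exact: qform_bichar.
    by split=> a; apply: U1_inv; [apply: pairing_charr|apply: pairing_charl].
  apply: (@exists_quadratic_letters C (data_I q Q) _ Q _ (pairing_of q) unit _ _ _ bb) => //.
  + exact: sqrt_card_neq0.
  + by move=> x; rewrite QE normrM chi1 mulr1; case: (heps) => ->;
      rewrite ?normrXz ?normfV q1 ?expr1z ?invr1.
  + exact: U1_one_bichar.
  + move=> a b; rewrite !QE chiD.
    have -> : q (a + b) = <| a, b |> * (q a * q b).
      by rewrite mulfVK // mulf_neq0.
    move: <| a, b |> (q a) (q b) (chi a) (chi b) => x y z u v.
    by case: (heps) => ->; rewrite ?expr1z ?exprN1 ?invfM; ring.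
  + move=> k /= h; apply: pairing_nondeg => b; move: (h b).
    by case: (heps) => ->; rewrite ?expr1z ?exprN1 // => /eqP; rewrite invr_eq1 => /eqP.
  + exact: qform_bichar.
  + exact: pairing_nondeg.
- have [ED Esa QE1 PE1 QED PED] := adm.
  have EVD : {morph (E^-1)%g : x y / x + y}.
    by move=> x y; apply: (@perm_inj _ E); rewrite ED !permKV.
  have EV_bichar : U1_bicharacter (fun a b => <| (E^-1)%g a, b |>).
    by split=> a; [apply: pairing_charr|apply: U1_comp EVD (pairing_charl q a)].
  have E_bichar : U1_bicharacter (fun a b => <| E a, b |>).
    by split=> a; [apply: pairing_charr|apply: U1_comp ED (pairing_charl q a)].
  have E_nondeg k : (forall h, <| E h, k |> = 1) -> k = 0.
    by move=> h; apply: pairing_nondeg => b; rewrite -[b](permKV E).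
  have EV_nondeg k : (forall h, <| (E^-1)%g h, k |> = 1) -> k = 0.
    by move=> h; apply: pairing_nondeg => b; rewrite -[b](permK E).
  have gam : gauss PE != 0 by apply: (@gauss_neq0 C A PE _ PE1 EV_bichar PED EV_nondeg).
  have alg_gam : alg (gauss PE)^*.
    apply/algebraic_conj/algebraic_mul; first exact: algebraic_inv.
    apply: algebraic_sum => a.
    apply: (@algebraic_exp_nat _ (2 * #|A|).-1 1).
    by rewrite prednK ?muln_gt0 ?(quadratic_card PE1 EV_bichar PED) //; apply/card_gt0P; exists 0.
  split => //; first by rewrite conjC_eq0.
    by rewrite /= divr1; apply: algebraic_nat.
  have alg_c : alg ((gauss PE)^* / #|A|%:R) by apply: algebraic_div => //; apply: algebraic_nat.
  apply: (alg_const _ _ alg_c).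
  apply: (@exists_quadratic_letters C (data_II q QE PE) _ (fun u => QE u.1 * PE u.2)
    (fun u v => <| E u.1, v.1 |> * <| (E^-1)%g u.2, v.2 |>) pairing2 unit) => //.
  + by rewrite mulf_neq0 ?invr_eq0 // conjC_eq0.
  + by move=> u /=; rewrite -mulrA.
  + by move=> u; rewrite normrM QE1 PE1 mulr1.
  + split=> u; apply: U1_mul.
    * exact: (U1_comp (h := fst) (fun _ _ => erefl) (E_bichar.1 _)).
    * exact: (U1_comp (h := snd) (fun _ _ => erefl) (EV_bichar.1 _)).
    * exact: (U1_comp (h := fst) (fun _ _ => erefl) (E_bichar.2 _)).
    * exact: (U1_comp (h := snd) (fun _ _ => erefl) (EV_bichar.2 _)).
  + exact: U1_one_bichar.
  + by move=> u v; rewrite QED PED; ring.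
  + move=> [k l] /= h; congr (_, _); [apply: E_nondeg => x | apply: EV_nondeg => x].
      by have := h (x, 0); rewrite /= (U1_0 (EV_bichar.2 l)) mulr1.
    by have := h (0, x); rewrite /= (U1_0 (E_bichar.2 k)) mul1r.
  + exact: pairing2_bichar.
  + exact: pairing2_nondeg.
- split; rewrite ?oner_eq0 //; first exact: algebraic1.
    by rewrite /= expr2 mulfK //; apply: algebraic_nat.
  have alg_c : alg (#|A|%:R^-1) by apply/algebraic_inv/algebraic_nat.
  apply: (alg_const _ _ alg_c).
  apply: (@exists_quadratic_letters C (data_III q) _ (fun=> 1) (fun _ _ => 1) pairing2 unit) => //.
  + by rewrite invr_eq0.
  + by move=> u /=; rewrite mulr1.
  + by move=> u; rewrite normr1.
  + exact: U1_one_bichar.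
  + exact: nu_III_bichar.
  + by move=> u v; rewrite !mulr1.
  + move=> [a b] /= h.
    have a0 : a = 0.
      apply: pairing_nondeg => x.
      by have := h (x, 0); rewrite /nu_III /= !pairing0l !mulr1 => /esym.
    rewrite a0; congr (_, _); apply: pairing_nondeg => x.
    by have := h (0, x); rewrite /nu_III /= a0 !pairing0r !mul1r => /esym.
  + exact: pairing2_bichar.
  + exact: pairing2_nondeg.
Qed.

End FamilyLetters.

(** * The coefficient of the identity as a sum of phases *)

Section PhaseSum.
Variables (C : numClosedFieldType) (L : link_data C) (ql : quadratic_letters L).
Local Notation G := (tgrp L).
Local Notation nu := (@tnu C L).
Local Notation tau := (@ttau C L).
Local Notation pr := (ql_pair ql).

Section Monomials.
Variable n : nat.
Implicit Types g h : mexp L n.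

Lemma mcocDl g g' h : mcoc (g + g') h = mcoc g h * mcoc g' h.
Proof.
rewrite /mcoc [RHS]mulrACA; congr (_ * _); rewrite -big_split /=.
  by apply: eq_bigr => i _; rewrite ffunE ((ql_nu_bichar ql).2 _).2.
apply: eq_bigr => i _; rewrite -big_split /=.
by apply: eq_bigr => j _; rewrite ffunE tauDr invfM.
Qed.

Lemma mcoc_suml (I : finType) (P : pred I) (F : I -> mexp L n) h :
  mcoc (\sum_(i | P i) F i) h = \prod_(i | P i) mcoc (F i) h.
Proof.
elim/big_rec2: _ => [|i x y _ <-]; first exact: mcoc0g.
exact: mcocDl.
Qed.

(** Multiplying the product of the earlier monomials by the k-th one costs [mcoc] at the sum of
    their exponents, which splits into factors for pairs since [mcoc] is multiplicative in its first
    argument. *)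
Lemma prod_mon l (h : 'I_l -> mexp L n) :
  \prod_(k < l) mon (h k) =
  (\prod_(k < l) \prod_(j < l | (j < k)%N) mcoc (h j) (h k)) *: mon (\sum_(k < l) h k).
Proof.
elim: l h => [|l IH] h; first by rewrite !big_ord0 scale1r.
rewrite [LHS]big_ord_recr [\sum_(k < l.+1) h k]big_ord_recr.
rewrite [\prod_(k < l.+1) \prod_(j < l.+1 | _) _]big_ord_recr /= IH.
rewrite -scalerAl monM scalerA mcoc_suml. congr (_ * _ *: _).
  apply: eq_bigr => k _; rewrite [RHS]big_mkcond big_ord_recr /= [X in _ * X]ifF ?mulr1; last first.
    by rewrite ltnNge ltnW.
  by rewrite -big_mkcond.
rewrite [RHS]big_mkcond big_ord_recr /= ltnn mulr1.
by apply: eq_bigr => j _; rewrite ltn_ord.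
Qed.

End Monomials.

(** [y.1] is the exponent chosen from the letter, [y.2] the dual variable testing whether the
    exponents cancel. *)
Definition letter_phase (s : bool) (y : G * G) : C := ql_fun ql s y.1 * pr y.2 y.1.

(* The first argument tells whether the index of y' is equal to, resp. one more than, that of the
   later letter y. *)
Definition pair_phase (r : bool * bool) (y' y : G * G) : C :=
  (if r.1 then nu y'.1 y.1 * (pr y'.2 y.1 * pr y.2 y'.1) else 1) *
  (if r.2 then (tau y.1 y'.1)^-1 else 1).

Lemma prod_square l (F : 'I_l -> 'I_l -> C) :
  \prod_k \prod_j F j k =
  (\prod_k F k k) * \prod_(k < l) \prod_(j < l | (j < k)%N) (F j k * F k j).
Proof.
rewrite [X in _ * X](eq_bigr (fun k : 'I_l => (\prod_(j < l | (j < k)%N) F j k) *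
  \prod_(j < l | (j < k)%N) F k j)); last by move=> k _; rewrite big_split.
rewrite big_split /= [X in _ * (_ * X)](exchange_big_dep xpredT) //= -!big_split /=.
apply: eq_bigr => k _; rewrite (bigD1 k) //=; congr (_ * _).
rewrite (bigID (fun j : 'I_l => (j < k)%N)) /=; congr (_ * _); apply: eq_bigl => j.
  by rewrite -val_eqE /=; case: ltngtP.
by rewrite -val_eqE /=; case: ltngtP.
Qed.

Section Word.
Variables (n : nat) (w : braid_word n).

Definition word_rel (s' s : 'I_n.-1 * bool) : bool * bool :=
  (s'.1 == s.1, val s'.1 == (val s.1).+1).

Definition word_sum : C :=
  \sum_(y : {ffun 'I_(size w) -> G * G})
    (\prod_(k < size w) letter_phase (tnth (in_tuple w) k).2 (y k)) *
    \prod_(k < size w) \prod_(j < size w | (j < k)%N)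
      pair_phase (word_rel (tnth (in_tuple w) j) (tnth (in_tuple w) k)) (y j) (y k).

Lemma pair_sum0 (g : G) : \sum_h pr h g = (g == 0)%:R * #|G|%:R.
Proof.
have [g0|/eqP g0] := eqVneq g 0.
  rewrite g0 mul1r -sum1_card natr_sum; apply: eq_bigr => h _.
  by rewrite (U1_0 ((ql_pair_bichar ql).1 h)).
rewrite mul0r; apply: sum_U1; first exact: (ql_pair_bichar ql).2.
by move=> h1; apply: g0; apply: (ql_pair_nondeg (q := ql)).
Qed.

Lemma pair_suml h (I : finType) (P : pred I) (g : I -> G) :
  pr h (\sum_(i | P i) g i) = \prod_(i | P i) pr h (g i).
Proof.
have hc := (ql_pair_bichar ql).1 h.
by elim/big_rec2: _ => [|i x y _ <-]; [apply: U1_0 | apply: hc.2].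
Qed.

Let i_ k := (tnth (in_tuple w) k).1.

(** There is one dual variable per letter rather than per generator: the condition that the
    exponents at a generator add up to 0 is imposed once for each letter on it. Repetition does not
    change the indicator, and the number of variables depends on the length of the word alone. *)
Lemma delta_pair (g : {ffun 'I_(size w) -> G}) :
  ((\sum_k single (i_ k) (g k) : mexp L n) == 0)%:R =
  #|G|%:R ^- size w * \sum_(h : {ffun 'I_(size w) -> G})
    \prod_k \prod_j (if i_ j == i_ k then pr (h k) (g j) else 1).
Proof.
have G0 := card_finZmod_neq0 C G.
pose S (k : 'I_(size w)) : G := \sum_(j | i_ j == i_ k) g j.
have tot i : (\sum_k single (i_ k) (g k) : mexp L n) i = \sum_(j | i_ j == i) g j.
  rewrite sum_ffunE [RHS]big_mkcond; apply: eq_bigr => j _.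
  by rewrite ffunE eq_sym.
transitivity (\prod_(k < size w) ((S k == 0)%:R : C)).
  case: eqP => [t0|/eqP t0].
    by rewrite big1 // => k _; rewrite /S -tot t0 ffunE eqxx.
  have [i ti] : exists i, (\sum_k single (i_ k) (g k) : mexp L n) i != 0.
    apply/existsP; apply: contraR t0; rewrite negb_exists => /forallP z.
    by apply/eqP/ffunP => i; rewrite [RHS]ffunE; apply/eqP; rewrite -[_ == _]negbK.
  have [k ik] : exists k, i_ k == i.
    apply/existsP; apply: contraR ti; rewrite negb_exists => /forallP z.
    by rewrite tot big_pred0 // => j; apply/negbTE.
  rewrite (bigD1 k) //= /S (eqP ik) -tot (negPf ti) mul0r //.
under [in RHS]eq_bigr => h _ do under eq_bigr => k _ do rewrite -big_mkcond -pair_suml.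
rewrite -(bigA_distr_bigA (fun k h => pr h (S k))) /=.
have -> : #|G|%:R ^- size w = \prod_(k < size w) (#|G|%:R^-1 : C).
  by rewrite prodr_const card_ord exprVn.
rewrite -big_split /=; apply: eq_bigr => k _.
by rewrite pair_sum0 mulrC mulfK.
Qed.

Lemma epsn_rho :
  epsn (rho L w) = (\prod_(s <- w) ql_const ql s.2) *
   \sum_(g : {ffun 'I_(size w) -> G}) ((\prod_(k < size w) ql_fun ql (tnth (in_tuple w) k).2 (g k)) *
     (\prod_(k < size w) \prod_(j < size w | (j < k)%N)
        mcoc (single (i_ j) (g j) : mexp L n) (single (i_ k) (g k))) *
     ((\sum_k single (i_ k) (g k) : mexp L n) == 0)%:R).
Proof.
rewrite /rho big_tnth (eq_bigr (fun k => ql_const ql (tnth (in_tuple w) k).2 *: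
  \sum_g ql_fun ql (tnth (in_tuple w) k).2 g *: Ugen (i_ k) g)); last first.
  by move=> k _; rewrite -(ql_gen ql (tnth (in_tuple w) k)).
rewrite scaler_prod [in RHS]big_tnth [LHS]ffunE; congr (_ * _).
rewrite bigA_distr_bigA /= sum_ffunE; apply: eq_bigr => g _.
rewrite scaler_prod prod_mon scalerA ffunE; congr (_ * _).
by rewrite ffunE eq_sym.
Qed.

(** Each letter receives one factor [#|G|^-1] from [delta_pair]. In the double product of dual
    phases the diagonal goes into [letter_phase], while the pairs j < k join [mcoc] in
    [pair_phase]. *)
Lemma link_invariantE : lalpha L != 0 ->
  link_invariant L w = (lD L / lbeta L) ^+ n *
  (\prod_(s <- w) ((if s.2 then (lalpha L)^-1 else lalpha L) * ql_const ql s.2 / #|G|%:R)) * word_sum.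
Proof.
move=> a0; rewrite /link_invariant epsn_rho.
have -> : lalpha L ^ (- writhe w) = \prod_(s <- w) (if s.2 then (lalpha L)^-1 else lalpha L).
  rewrite /writhe -sumrN.
  elim: (w : seq _) => [|s w' IH]; first by rewrite !big_nil expr0z.
  rewrite !big_cons expfzDr // IH; congr (_ * _).
  by case: s.2; rewrite ?opprK ?expr1z ?exprN1.
rewrite !big_split /=; set P1 := \prod_(s <- w) _; set P2 := \prod_(s <- w) _.
have -> : \prod_(s <- w) (#|G|%:R^-1 : C) = #|G|%:R ^- size w.
  by rewrite big_const_seq count_predT iter_mulr_1 exprVn.
rewrite expr_div_n; set S := \sum_g _; suff -> : S = #|G|%:R ^- size w * word_sum by ring.
rewrite /S /word_sum.
under eq_bigr => g _ do rewrite delta_pair mulrCA mulr_sumr.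
rewrite -mulr_sumr; congr (_ * _); rewrite pair_big /=.
pose zip2 (z : {ffun 'I_(size w) -> G} * {ffun 'I_(size w) -> G}) := [ffun k => (z.1 k, z.2 k)].
pose unzip (y : {ffun 'I_(size w) -> G * G}) := ([ffun k => (y k).1], [ffun k => (y k).2]).
have zK : cancel unzip zip2.
  by move=> y; apply/ffunP => k; rewrite !ffunE -surjective_pairing.
have zK' : cancel zip2 unzip.
  by move=> [g h]; congr (_, _); apply/ffunP => k; rewrite !ffunE.
rewrite (reindex unzip) /=; last by exists zip2 => y _.
apply: eq_bigr => y _.
rewrite prod_square mulrACA; congr (_ * _).
  by rewrite -big_split; apply: eq_bigr => k _; rewrite /letter_phase !ffunE eqxx.
rewrite -big_split; apply: eq_bigr => k _; rewrite -big_split; apply: eq_bigr => j jk /=.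
rewrite mcoc_single /pair_phase /word_rel /= !ffunE [i_ k == i_ j]eq_sym.
case: (altP (i_ j =P i_ k)) => [e|ne]; last by rewrite !mulr1.
by rewrite mulrAC [pr _ _ * pr _ _]mulrC.
Qed.

End Word.
End PhaseSum.

(** * Lifting phases along a surjection from a free module *)

Section Characters.
Variables (C : numClosedFieldType) (m : nat).
Local Notation R := 'I_m.+2.

(** X^n - 1 splits into n distinct roots, and such a set of n-th roots of unity contains a primitive
    one. *)
Lemma exists_prim_root n : (0 < n)%N -> exists z : C, n.-primitive_root z.
Proof.
move=> n_gt0; pose p : {poly C} := 'X^n - 1; have [r Dp] := closed_field_poly_normal p.
rewrite (monicP _) ?monicXnsubC // scale1r in Dp.
have rn1 : all n.-unity_root r by apply/allP=> z; rewrite -root_prod_XsubC -Dp.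
have sz_r : (n < (size r).+1)%N by rewrite -(size_prod_XsubC r id) -Dp size_XnsubC.
have [|z] := hasP (cyclic.has_prim_root n_gt0 rn1 _ sz_r); last by exists z.
by rewrite -separable_prod_XsubC -Dp cyclotomic.separable_Xn_sub_1 // pnatr_eq0 -lt0n.
Qed.

Variable zeta : C.
Hypothesis zetaP : (m.+2).-primitive_root zeta.

Definition zchar (x : R) : C := zeta ^+ x.

Lemma zchar0 : zchar 0 = 1. Proof. by []. Qed.

Lemma zcharD : {morph zchar : x y / x + y >-> x * y}.
Proof. by move=> x y; rewrite /zchar -exprD /= (prim_expr_mod zetaP). Qed.

Lemma zchar_exp t (x : R) : zchar t ^+ x = zchar (t * x).
Proof. by rewrite /zchar -exprM /= (prim_expr_mod zetaP). Qed.

Lemma zchar_exp_nat t k : zchar t ^+ k = zchar (t * k%:R).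
Proof.
elim: k => [|k IH]; first by rewrite mulr0.
by rewrite exprS IH -zcharD -natr1 mulrDr mulr1 addrC.
Qed.

Lemma zchar_sum (I : finType) (P : pred I) (F : I -> R) :
  zchar (\sum_(i | P i) F i) = \prod_(i | P i) zchar (F i).
Proof. exact: (big_morph _ zcharD zchar0). Qed.

Lemma zchar_log z : z ^+ m.+2 = 1 -> exists t, z = zchar t.
Proof. by move=> z1; have [t ->] := poly.UnityRootTheory.prim_rootP zetaP z1; exists t. Qed.

Section Cover.
Variable Y : finZmodType.
Hypothesis cardY : m.+2 = (4 * #|Y|)%N.

(** Evaluation of formal combinations, from the free Z/M-module on the set Y onto Y; it is additive
    because M annihilates Y. *)
Definition cover (x : Y -> R) : Y := \sum_a a *+ x a.

Lemma mulrn_mod (a : Y) k : a *+ (k %% m.+2) = a *+ k.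
Proof.
have aM : a *+ m.+2 = 0 by rewrite cardY mulnC mulrnA mulrn_card mul0rn.
by rewrite [in RHS](divn_eq k m.+2) mulrnDr mulnC mulrnA aM mul0rn add0r.
Qed.

Lemma coverD (x x' : Y -> R) : cover (fun a => x a + x' a) = cover x + cover x'.
Proof.
rewrite /cover -big_split /=; apply: eq_bigr => a _.
by rewrite -mulrnDr mulrn_mod.
Qed.

Lemma cover_delta (y : Y) : cover (fun a => (a == y)%:R) = y.
Proof.
rewrite /cover (bigD1 y) //= eqxx big1 ?addr0 // => a /negPf ->.
by rewrite mulr0n.
Qed.

Lemma character_cover (chi : Y -> C) x : U1_character chi ->
  chi (cover x) = \prod_a chi a ^+ x a.
Proof.
move=> chic; rewrite /cover; elim/big_rec2: _ => [|a y z _ <-]; first exact: U1_0.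
by rewrite chic.2 U1_mulrn.
Qed.

(** Applied with k = 1 to values of bicharacters, and with k = 2 to quadratic phases and to square
    roots of b(a,a). *)
Lemma root_card (k : nat) (z : C) : (k %| 4)%N -> z ^+ (k * #|Y|) = 1 -> z ^+ m.+2 = 1.
Proof.
by move=> /dvdnP[j e] z1; rewrite cardY e -mulnA mulnC exprM z1 expr1n.
Qed.

Lemma bicharacter_cover (chi : Y -> Y -> C) : U1_bicharacter chi ->
  exists T : Y -> Y -> R, forall x x' : Y -> R,
    chi (cover x) (cover x') = zchar (\sum_a \sum_a' x a * (T a a' * x' a')).
Proof.
move=> [cl cr]; have lg a a' : exists t, chi a a' = zchar t.
  by apply: zchar_log; apply: (@root_card 1) => //; rewrite mul1n (U1_card _ (cl a)).
exists (fun a a' => projT1 (cid (lg a a'))) => x x'.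
rewrite (character_cover _ (cr (cover x'))) zchar_sum; apply: eq_bigr => a _.
rewrite (character_cover _ (cl a)) zchar_sum -prodrXl; apply: eq_bigr => a' _.
by case: (cid _) => t /= ->; rewrite !zchar_exp mulrC.
Qed.

Lemma quadratic_sum (phi : Y -> C) (b : Y -> Y -> C) l (y : 'I_l -> Y) :
  phi 0 = 1 -> U1_bicharacter b -> (forall g h, phi (g + h) = phi g * phi h * b g h) ->
  phi (\sum_i y i) = (\prod_i phi (y i)) * \prod_(i < l) \prod_(j < l | (j < i)%N) b (y j) (y i).
Proof.
move=> phi0 bb phiD; elim: l y => [|l IH] y; first by rewrite !big_ord0 mulr1.
rewrite [\sum_(i < l.+1) _]big_ord_recr [\prod_(i < l.+1) phi _]big_ord_recr.
rewrite [\prod_(k < l.+1) \prod_(j < l.+1 | _) _]big_ord_recr /= phiD IH.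
rewrite -!mulrA; congr (_ * _); rewrite mulrCA; congr (_ * _); congr (_ * _).
  apply: eq_bigr => k _; rewrite [RHS]big_mkcond big_ord_recr /= [X in _ * X]ifF ?mulr1; last first.
    by rewrite ltnNge ltnW.
  by rewrite -big_mkcond.
rewrite [RHS]big_mkcond big_ord_recr /= ltnn mulr1.
have bc := bb.2 (y ord_max).
rewrite (big_morph _ bc.2 (U1_0 bc)).
by apply: eq_bigr => j _; rewrite ltn_ord.
Qed.

(** The phase of a sum of multiples of elements a is the product of the phases of the multiples and
    of b over the pairs. The former are quadratic in the coefficients by [quadratic_mulrn], the
    latter bilinear. *)
Lemma quadratic_cover (phi : Y -> C) (b : Y -> Y -> C) :
  U1_valued phi -> U1_bicharacter b -> (forall g h, phi (g + h) = phi g * phi h * b g h) ->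
  exists (T : Y -> Y -> R) (t : Y -> R), forall x : Y -> R,
    phi (cover x) = zchar (\sum_a x a * t a + \sum_a \sum_a' x a * (T a a' * x a')).
Proof.
move=> phi1 bb phiD.
have lgphi a : exists t, phi a = zchar t.
  by apply: zchar_log; apply: (@root_card 2) => //; rewrite (quadratic_card phi1 bb phiD).
have lgb a a' : exists t, b a a' = zchar t.
  by apply: zchar_log; apply: (@root_card 1) => //; rewrite mul1n (U1_card _ (bb.1 a)).
(* The exponent z(z-1)/2 of b(a,a) makes no sense modulo M, whereas the exponent z(z-1) of a square
   root does. *)
have half a : exists h, b a a = zchar h ^+ 2.
  have [|h eh] := @zchar_log (sqrtC (b a a)); last by exists h; rewrite -eh sqrtCK.
  by apply: (@root_card 2) => //; rewrite exprM sqrtCK (U1_card _ (bb.1 a)).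
pose f a := projT1 (cid (lgphi a)); have fP a : phi a = zchar (f a) by rewrite /f; case: cid.
pose g a a' := projT1 (cid (lgb a a')); have gP a a' : b a a' = zchar (g a a') by rewrite /g; case: cid.
pose h a := projT1 (cid (half a)); have hP a : b a a = zchar (h a) ^+ 2 by rewrite /h; case: cid.
(* The matrix is triangular for the enumeration of Y, so that each pair of distinct elements is
   counted once. *)
exists (fun a a' => if a == a' then h a else if (enum_rank a < enum_rank a')%N then g a a' else 0).
exists (fun a => f a - h a) => x.
have phi_n a (z : R) : phi (a *+ z) = zchar (z * (f a - h a) + z * (h a * z)).
  rewrite (quadratic_mulrn phi1 bb phiD) fP hP zchar_exp -exprM.
  have -> : z * (f a - h a) + z * (h a * z) = f a * z + h a * (z * z - z) by ring.
  rewrite zcharD; congr (_ * _).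
  rewrite zchar_exp_nat -mul_bin_diag bin1; congr (zchar (_ * _)).
  rewrite -[in RHS](natr_Zp z); case: (z : nat) => [|k]; first by rewrite mul0n !mulr0n mulr0 subr0.
  by rewrite natrM -natr1; ring.
rewrite zcharD !zchar_sum.
have enumB : {on [pred _ : Y | true], bijective (@enum_val Y Y)}.
  by exists enum_rank => a _; [apply: enum_valK | apply: enum_rankK].
have -> : cover x = \sum_(i < #|Y|) enum_val i *+ x (enum_val i).
  by rewrite /cover (reindex (@enum_val Y Y)).
rewrite (quadratic_sum _ (quadratic0 phi1 bb phiD) bb phiD).
rewrite (reindex (@enum_val Y Y)) // [X in _ = _ * X](reindex (@enum_val Y Y)) //=.
under [X in _ = _ * X]eq_bigr => i _ do rewrite zchar_sum (reindex (@enum_val Y Y)) //=.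
rewrite prod_square [RHS]mulrA -[in RHS]big_split; congr (_ * _).
  by apply: eq_bigr => i _; rewrite phi_n zcharD eqxx.
apply: eq_bigr => i _; apply: eq_bigr => j ji.
have ne : enum_val i != enum_val j by rewrite (inj_eq enum_val_inj) -val_eqE /= gtn_eqF.
rewrite (negPf ne) eq_sym (negPf ne) !enum_valK ji ltnNge ltnW //= mul0r mulr0 zchar0 mul1r.
have bl := bb.1; have br := bb.2.
rewrite (U1_mulrn _ _ (bl _)); have /= -> := U1_mulrn (enum_val j) (x (enum_val j)) (br (enum_val i)).
by rewrite gP !zchar_exp mulrA [_ * x (enum_val j)]mulrC.
Qed.

End Cover.
End Characters.

(** * One fixed quadratic form for all words *)

Section CellVectors.
Variables (R : finComNzRingType) (Y : finType) (D : nat).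

(* The first component holds the coordinates of a letter, the second one a linear form on them. *)
Definition cell := ({ffun Y -> R^o} * {ffun Y -> R^o})%type.

(** The hyperbolic form. A form given as the sum of x_a l_a(x), with linear l_a, is its pullback
    along x -> (x, l(x)); so the vectors carry the word and the form itself stays fixed. *)
Definition qcell (c : cell) : R := \sum_a c.1 a * c.2 a.
Definition bcell (c d : cell) : R := \sum_a (c.1 a * d.2 a + d.1 a * c.2 a).

Lemma cellD (c d : cell) a : (c + d).1 a = c.1 a + d.1 a /\ (c + d).2 a = c.2 a + d.2 a.
Proof. by rewrite !ffunE. Qed.

Lemma cellZ x (c : cell) a : (x *: c).1 a = x * c.1 a /\ (x *: c).2 a = x * c.2 a.
Proof. by rewrite !ffunE. Qed.

Lemma bcellP c x y u v : bcell c (x *: u + y *: v) = x * bcell c u + y * bcell c v.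
Proof.
rewrite /bcell !mulr_sumr -big_split; apply: eq_bigr => a _.
rewrite !(cellD _ _ _).1 !(cellD _ _ _).2 !(cellZ _ _ _).1 !(cellZ _ _ _).2 /=.
by move: (c.1 a : R) (c.2 a : R) (u.1 a : R) (u.2 a : R) (v.1 a : R) (v.2 a : R) => *; ring.
Qed.

Lemma qcellP x u v : qcell (x *: u + v) = x * x * qcell u + x * bcell u v + qcell v.
Proof.
rewrite /bcell /qcell !mulr_sumr -!big_split; apply: eq_bigr => a _.
rewrite (cellD _ _ _).1 (cellD _ _ _).2 (cellZ _ _ _).1 (cellZ _ _ _).2 /=.
by move: (u.1 a : R) (u.2 a : R) (v.1 a : R) (v.2 a : R) => *; ring.
Qed.

Definition qvec (u : {ffun 'I_D -> cell}) : R := \sum_j qcell (u j).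
Definition bvec (u v : {ffun 'I_D -> cell}) : R := \sum_j bcell (u j) (v j).

Lemma bvecP c x y u v : bvec c (x *: u + y *: v) = x * bvec c u + y * bvec c v.
Proof.
rewrite /bvec !mulr_sumr -big_split; apply: eq_bigr => j _ /=.
by rewrite !ffunE bcellP.
Qed.

Lemma qvecP x u v : qvec (x *: u + v) = x * x * qvec u + x * bvec u v + qvec v.
Proof.
rewrite /bvec /qvec !mulr_sumr -!big_split; apply: eq_bigr => j _ /=.
by rewrite !ffunE qcellP.
Qed.

End CellVectors.

Section LatticeEnum.
Variables (C : comNzRingType) (R : finComNzRingType) (U : lmodType R) (I : finType) (v : I -> U).

(** The coordinates outside [r] are free and only multiply the sum. In the induction a redundant sum
    over c is introduced and absorbed by translating the coordinate at i. *)
Lemma lsum_enum (f : U -> C) (r : seq I) : uniq r ->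
  (\sum_(x : {ffun I -> R}) f (\sum_(i <- r) x i *: v i)) * #|R|%:R ^+ size r =
  #|R|%:R ^+ #|I| * lsum f [seq v i | i <- r].
Proof.
elim: r f => [|i r IH] f /=.
  rewrite expr0 mulr1 => _; under eq_bigr => x _ do rewrite big_nil.
  by rewrite sumr_const card_ffun -[in LHS]mulr_natl natrX.
move=> /andP[ir ur]; rewrite exprS mulrA mulr_sumr.
under [in RHS]eq_bigr => c _ do rewrite -IH //.
rewrite -mulr_suml; congr (_ * _).
transitivity (\sum_(c : R) \sum_(x : {ffun I -> R}) f (\sum_(j <- i :: r) x j *: v j)).
  by rewrite sumr_const -[RHS]mulr_natr.
transitivity (\sum_(c : R) \sum_(x : {ffun I -> R}) f ((x i + c) *: v i + \sum_(j <- r) x j *: v j)).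
  apply: eq_bigr => c _; pose dl : {ffun I -> R} := [ffun j => if j == i then c else 0].
  rewrite (reindex_inj (addIr dl)); apply: eq_bigr => x _; congr f.
  rewrite big_cons !ffunE eqxx; congr (_ + _); apply: eq_big_seq => j jr.
  by rewrite !ffunE; case: eqP => [ji|_]; rewrite ?addr0 //; rewrite -ji jr in ir.
rewrite exchange_big [RHS]exchange_big; apply: eq_bigr => x _ /=.
by rewrite [RHS](reindex_inj (addrI (x i))).
Qed.

End LatticeEnum.

Section WordVectors.
Variables (C : numClosedFieldType) (R : finComNzRingType) (e : R -> C).
Hypotheses (e0 : e 0 = 1) (eD : {morph e : x y / x + y >-> x * y}).
Variables (Y : finZmodType) (cover : (Y -> R) -> Y).
Hypothesis coverD : forall x x', cover (fun a => x a + x' a) = cover x + cover x'.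
Hypothesis cover_delta : forall y, cover (fun a => (a == y)%:R) = y.
Local Notation cell := (cell R Y).

Lemma char_sum (I : finType) (P : pred I) (F : I -> R) :
  e (\sum_(i | P i) F i) = \prod_(i | P i) e (F i).
Proof. exact: (big_morph _ eD e0). Qed.

Variables (phi : bool -> Y -> C) (chi : bool * bool -> Y -> Y -> C).
Variables (own : bool -> Y -> Y -> R) (lin : bool -> Y -> R) (cpl : bool * bool -> Y -> Y -> R).
Hypothesis phiE : forall s (x : Y -> R), phi s (cover x) =
  e (\sum_a x a * lin s a + \sum_a \sum_a' x a * (own s a a' * x a')).
Hypothesis chiE : forall r (x x' : Y -> R), chi r (cover x) (cover x') =
  e (\sum_a \sum_a' x a * (cpl r a a' * x' a')).

Definition own_cell (s : bool) (a : Y) : cell :=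
  ([ffun b => (b == a)%:R], [ffun b => own s b a]).
Definition pair_cell (r : bool * bool) (a : Y) : cell := (0, [ffun b => cpl r b a]).
Definition lin_cell (s : bool) : cell := (0, [ffun b => lin s b]).

Variables (l : nat) (s : 'I_l -> bool) (rel : 'I_l -> 'I_l -> bool * bool).
Local Notation U := {ffun 'I_l -> cell}.

(** The coordinate a of letter k has its own cell at position k and coupling forms at the positions
    j < k only. Thus each pair of letters is counted once, and the vector can be written as soon as
    letter k has been read. *)
Definition word_vec (ka : 'I_l * Y) : U :=
  [ffun j => if j == ka.1 then own_cell (s ka.1) ka.2
             else if (j < ka.1)%N then pair_cell (rel j ka.1) ka.2 else 0].

Definition lin_vec : U := [ffun j => lin_cell (s j)].

Lemma word_vec_comb (x : {ffun 'I_l * Y -> R}) j :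
  (\sum_ka x ka *: word_vec ka) j =
  ([ffun b => x (j, b)], [ffun b => \sum_a own (s j) b a * x (j, a) +
     \sum_(k < l | (j < k)%N) \sum_a cpl (rel j k) b a * x (k, a)]).
Proof.
transitivity (\sum_k \sum_a (x (k, a) *: word_vec (k, a)) j).
  by rewrite sum_ffunE pair_big; apply: eq_bigr => -[k a] _.
rewrite [LHS]surjective_pairing !(big_morph fst (fun _ _ => erefl) erefl).
rewrite !(big_morph snd (fun _ _ => erefl) erefl); congr (_, _); apply/ffunP => b.
  rewrite sum_ffunE ffunE (bigD1 j) //= [X in _ + X]big1 ?addr0 => [|k /negPf kj]; last first.
    rewrite (big_morph fst (fun _ _ => erefl) erefl) sum_ffunE big1 // => a _.
    by rewrite !ffunE /= eq_sym kj; case: ifP => _; rewrite !ffunE /= scaler0.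
  rewrite (big_morph fst (fun _ _ => erefl) erefl) sum_ffunE (bigD1 b) //= big1 ?addr0 => [|a /negPf ab].
    by rewrite !ffunE eqxx /= !ffunE eqxx /= -[LHS]/(_ * _) mulr1.
  by rewrite !ffunE eqxx /= !ffunE eq_sym ab scaler0.
rewrite sum_ffunE ffunE (bigD1 j) //=; congr (_ + _).
  rewrite (big_morph snd (fun _ _ => erefl) erefl) sum_ffunE; apply: eq_bigr => a _.
  by rewrite !ffunE eqxx /= !ffunE mulrC.
rewrite [RHS]big_mkcond [LHS]big_mkcond; apply: eq_bigr => k _.
rewrite (big_morph snd (fun _ _ => erefl) erefl) sum_ffunE.
case: ifPn => [kj|]; last by rewrite negbK => /eqP ->; rewrite ltnn.
case: ifP => jk.
  by apply: eq_bigr => a _; rewrite !ffunE /= eq_sym (negPf kj) jk /= !ffunE mulrC.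
by rewrite big1 // => a _; rewrite !ffunE /= eq_sym (negPf kj) jk !ffunE /= scaler0.
Qed.

(** The polar form with [lin_vec] supplies the linear terms of the exponent, and [qvec] the
    quadratic ones. *)
Lemma gauss_word (x : {ffun 'I_l * Y -> R}) :
  gauss_fn (@qvec R Y l) (@bvec R Y l) e e lin_vec (\sum_ka x ka *: word_vec ka) =
  (\prod_k phi (s k) (cover (fun a => x (k, a)))) *
  \prod_(k < l) \prod_(j < l | (j < k)%N) chi (rel j k) (cover (fun a => x (j, a))) (cover (fun a => x (k, a))).
Proof.
under eq_bigr => k _ do rewrite phiE.
under [X in _ = _ * X]eq_bigr => k _ do under eq_bigr => j _ do rewrite chiE.
under [X in _ = _ * X]eq_bigr => k _ do rewrite -char_sum.
rewrite -!char_sum -eD /gauss_fn -eD; congr (e _).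
rewrite [X in _ = _ + X](exchange_big_dep xpredT) //= /bvec /qvec -!big_split /=.
apply: eq_bigr => j _; rewrite word_vec_comb /bcell /qcell ffunE /= -addrA; congr (_ + _).
  by apply: eq_bigr => a _; rewrite !ffunE mul0r add0r.
rewrite [X in _ + X]exchange_big -big_split; apply: eq_bigr => b _ /=.
rewrite !ffunE mulrDr !mulr_sumr; congr (_ + _).
by apply: eq_bigr => k _; rewrite mulr_sumr.
Qed.

(** [pi] is a surjective homomorphism, so its fibres have equal size; this is shown by averaging
    over the translations by the lifts [sec y]. *)
Lemma sum_words (Psi : {ffun 'I_l -> Y} -> C) :
  #|Y|%:R ^+ l * \sum_(x : {ffun 'I_l * Y -> R}) Psi [ffun k => cover (fun a => x (k, a))] =
  #|R|%:R ^+ (l * #|Y|) * \sum_y Psi y.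
Proof.
pose pi (x : {ffun 'I_l * Y -> R}) : {ffun 'I_l -> Y} := [ffun k => cover (fun a => x (k, a))].
have piD x x' : pi (x + x') = pi x + pi x'.
  apply/ffunP => k; rewrite !ffunE -coverD.
  by congr cover; apply: funext => a; rewrite ffunE.
pose sec (y : {ffun 'I_l -> Y}) : {ffun 'I_l * Y -> R} := [ffun ka => (ka.2 == y ka.1)%:R].
have secK y : pi (sec y) = y.
  apply/ffunP => k; rewrite ffunE -[RHS]cover_delta.
  by congr cover; apply: funext => a; rewrite ffunE.
transitivity (\sum_(y : {ffun 'I_l -> Y}) \sum_x Psi (pi x)).
  by rewrite sumr_const card_ffun card_ord -[RHS]mulr_natl natrX.
transitivity (\sum_(y : {ffun 'I_l -> Y}) \sum_x Psi (pi x + y)).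
  apply: eq_bigr => y _; rewrite (reindex_inj (addIr (sec y))); apply: eq_bigr => x _.
  by rewrite piD secK.
rewrite exchange_big /=; transitivity (\sum_(x : {ffun 'I_l * Y -> R}) \sum_y Psi y).
  by apply: eq_bigr => x _; rewrite [RHS](reindex_inj (addrI (pi x))).
by rewrite sumr_const card_ffun card_prod card_ord -[LHS]mulr_natl natrX.
Qed.

(** The enumeration [r] is arbitrary since the machine writes the vectors in an order of its own. *)
Lemma word_sum_lsum (r : seq ('I_l * Y)) : uniq r -> size r = (l * #|Y|)%N ->
  \sum_(y : {ffun 'I_l -> Y}) (\prod_(k < l) phi (s k) (y k)) *
    (\prod_(k < l) \prod_(j < l | (j < k)%N) chi (rel j k) (y j) (y k)) =
  (#|Y|%:R / #|R|%:R ^+ #|Y|) ^+ l *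
  @lsum C R _ (gauss_fn (@qvec R Y l) (@bvec R Y l) e e lin_vec) [seq word_vec i | i <- r].
Proof.
move=> ur sr; set f := gauss_fn _ _ _ _ _.
have M0 := card_finZmod_neq0 C R.
have cI : #|{: 'I_l * Y}| = size r by rewrite sr card_prod card_ord.
have pr : perm_eq (index_enum ('I_l * Y)%type) r.
  rewrite perm_sym; apply: uniq_perm; rewrite ?index_enum_uniq // => i.
  have sub : {subset r <= enum {: 'I_l * Y}} by move=> k; rewrite mem_enum.
  have [|_ ->] := uniq_min_size ur sub; first by rewrite -cardE cI.
  by rewrite mem_index_enum mem_enum.
have := lsum_enum word_vec f ur.
rewrite cI mulrC => /(mulfI (expf_neq0 _ M0)) <-.
pose Psi (y : {ffun 'I_l -> Y}) := (\prod_(k < l) phi (s k) (y k)) *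
  \prod_(k < l) \prod_(j < l | (j < k)%N) chi (rel j k) (y j) (y k).
rewrite -[LHS]/(\sum_y Psi y).
have eP := sum_words Psi.
have -> : \sum_y Psi y = (#|R|%:R ^+ (l * #|Y|))^-1 * (#|Y|%:R ^+ l *
    \sum_(x : {ffun 'I_l * Y -> R}) Psi [ffun k => cover (fun a => x (k, a))]).
  by rewrite eP mulKf // expf_neq0.
rewrite mulrA; congr (_ * _); first by rewrite expr_div_n -exprM mulnC mulrC.
apply: eq_bigr => x _; rewrite /f -(perm_big _ pr) /= gauss_word /Psi.
congr (_ * _); first by apply: eq_bigr => k _; rewrite ffunE.
by apply: eq_bigr => k _; apply: eq_bigr => j _; rewrite !ffunE.
Qed.

End WordVectors.

(** * Columnwise binary arithmetic *)

Notation st_in := (@Ordinal 11 0 isT).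
Notation st_vec := (@Ordinal 11 1 isT).
Notation st_out := (@Ordinal 11 2 isT).
Notation st_carry := (@Ordinal 11 3 isT).
Notation st_prev := (@Ordinal 11 4 isT).
Notation st_tmp := (@Ordinal 11 5 isT).
Notation st_num := (@Ordinal 11 6 isT).
Notation st_num' := (@Ordinal 11 7 isT).
Notation st_past := (@Ordinal 11 8 isT).
Notation st_cur := (@Ordinal 11 9 isT).
Notation st_res := (@Ordinal 11 10 isT).

Section Symbols.
Variables (H R J : finType).

(* Besides the letters the tapes hold vector entries, coefficients, columns of binary digits and
   pairs of candidate digits. *)
Definition work : finType := (H + R + {ffun J -> bool} + (bool * bool))%type.
Definition symbol : finType := (letter + work)%type.
Definition sym_letter (a : letter) : symbol := inl a.
Definition sym_cell (c : H) : symbol := inr (inl (inl (inl c))).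
Definition sym_coef (r : R) : symbol := inr (inl (inl (inr r))).
Definition sym_digits (d : {ffun J -> bool}) : symbol := inr (inl (inr d)).
Definition sym_pair (b : bool * bool) : symbol := inr (inr b).
Definition machine (X : finType) := @mach 10 symbol X.

(** A column holds one binary digit of every entry of the table, the least significant column coming
    first; a matrix can thus act on all entries in a single pass. *)
Definition column_val (ds : seq {ffun J -> bool}) (j : J) : nat :=
  nat_of_bits [seq d j | d : {ffun J -> bool} <- ds].

Definition get_digits (o : option symbol) : {ffun J -> bool} :=
  if o is Some (inr (inl (inr d))) then d else [ffun=> false].

Section Apply.
Variables (B : nat) (M : J -> J -> nat).
Local Open Scope nat_scope.

Definition digit_total (c : {ffun J -> 'I_B.+1}) (d : {ffun J -> bool}) (j : J) : nat :=
  \sum_i M j i * d i + c j.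

Definition apply_body (c : {ffun J -> 'I_B.+1}) : machine ({ffun J -> 'I_B.+1} + unit)%type :=
  bind (pop st_num) (fun o =>
    if (o == None) && (c == [ffun=> ord0]) then ret (inr tt)
    else let t := digit_total c (get_digits o) in
      bind (push st_num' (sym_digits [ffun j => odd (t j)]))
           (fun _ => ret (inl [ffun j => inord (t j)./2]))).

Definition apply_matrix : machine unit :=
  bind (loop apply_body [ffun=> ord0]) (fun _ => move_stack st_num' st_num).

Hypothesis MB : forall j, \sum_i M j i <= B.

Implicit Type a : seq symbol.

(** A row sum and a carry of at most B give a total of at most 2B, hence again a carry of at most B:
    the carries fit into the finite control. *)
Lemma digit_total_half c d j : (digit_total c d j)./2 <= B.
Proof.
rewrite /digit_total; have : \sum_i M j i * d i <= B.
  apply: leq_trans (MB j); apply: leq_sum => i _.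
  by case: (d i); rewrite ?muln1 ?muln0.
by have := ltn_ord (c j); lia.
Qed.

Lemma column_val_nil j : column_val [::] j = 0. Proof. by []. Qed.

Lemma column_val_cons d ds j : column_val (d :: ds) j = d j + (column_val ds j).*2.
Proof. by []. Qed.

(** With the input exhausted, the carries are halved until they vanish; the bound k on them drops by
    at least one each time. *)
Lemma apply_flush k (c : {ffun J -> 'I_B.+1}) acc a0 a1 a2 a3 a4 a5 a8 a9 a10 :
  (forall j, c j <= k) ->
  exists2 ds', size ds' <= k.+1 /\ (forall j, column_val ds' j = c j) &
    runs (loop apply_body c)
      [:: a0; a1; a2; a3; a4; a5; [::]; map sym_digits acc; a8; a9; a10]
      (3 * k.+1) tt
      [:: a0; a1; a2; a3; a4; a5; [::]; map sym_digits (rev ds' ++ acc); a8; a9; a10].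
Proof.
elim: k c acc => [|k IH] c acc ck.
  have c0 : c = [ffun=> ord0].
    by apply/ffunP => j; apply: val_inj; rewrite ffunE /=; have := ck j; lia.
  exists [::]; first by split=> // j; rewrite c0 ffunE.
  apply: runs_loop_done; apply: (@runs_leq _ _ _ _ _ 2) => //.
  by apply: runs_pop; rewrite /= c0 eqxx; apply: runs_ret.
have [c0|cn0] := eqVneq c [ffun=> ord0].
  exists [::]; first by split=> // j; rewrite c0 ffunE.
  apply: runs_loop_done; apply: (@runs_leq _ _ _ _ _ 2) => //.
  by apply: runs_pop; rewrite /= c0 eqxx; apply: runs_ret.
pose d0 : {ffun J -> bool} := [ffun=> false].
pose c' : {ffun J -> 'I_B.+1} := [ffun j => inord (digit_total c d0 j)./2].
have t0 j : digit_total c d0 j = c j.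
  by rewrite /digit_total big1 // => i _; rewrite ffunE muln0.
have c'E j : c' j = (c j)./2 :> nat.
  by rewrite ffunE inordK ?ltnS ?digit_total_half // t0.
have [j|ds' [sz val] r] := IH c' (([ffun j => odd (digit_total c d0 j)] : {ffun J -> bool}) :: acc).
  by rewrite c'E; have := ck j; lia.
exists (([ffun j => odd (digit_total c d0 j)] : {ffun J -> bool}) :: ds'); last first.
  have -> : 3 * k.+2 = 3 + 3 * k.+1 by lia.
  apply: (@runs_loop_next _ _ _ _ _ _ _ _ c'); last by rewrite rev_cons cat_rcons; exact: r.
  by apply: runs_pop; rewrite /= (negPf cn0); apply: runs_push; apply: runs_ret.
split=> // j; rewrite column_val_cons val c'E.
by rewrite ffunE t0 odd_double_half.
Qed.

Lemma apply_loop ds (c : {ffun J -> 'I_B.+1}) acc a0 a1 a2 a3 a4 a5 a8 a9 a10 :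
  exists2 ds',
    size ds' <= size ds + B.+1 /\
      forall j, column_val ds' j = \sum_i M j i * column_val ds i + c j &
    runs (loop apply_body c)
      [:: a0; a1; a2; a3; a4; a5; map sym_digits ds; map sym_digits acc; a8; a9; a10]
      (3 * (size ds + B.+1)) tt
      [:: a0; a1; a2; a3; a4; a5; [::]; map sym_digits (rev ds' ++ acc); a8; a9; a10].
Proof.
elim: ds c acc => [|d ds IH] c acc.
  have cB j : c j <= B by rewrite -ltnS.
  have [ds' [sz val] r] := apply_flush acc a0 a1 a2 a3 a4 a5 a8 a9 a10 cB.
  exists ds' => //; split=> // j; rewrite val big1 // => i _.
  by rewrite column_val_nil muln0.
pose c' : {ffun J -> 'I_B.+1} := [ffun j => inord (digit_total c d j)./2].
have [ds' [sz val] r] := IH c' (([ffun j => odd (digit_total c d j)] : {ffun J -> bool}) :: acc).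
exists (([ffun j => odd (digit_total c d j)] : {ffun J -> bool}) :: ds'); last first.
  have -> : 3 * (size (d :: ds) + B.+1) = 3 + 3 * (size ds + B.+1) by rewrite /=; lia.
  apply: (@runs_loop_next _ _ _ _ _ _ _ _ c'); last by rewrite rev_cons cat_rcons; exact: r.
  by apply: runs_pop; rewrite /=; apply: runs_push; apply: runs_ret.
split=> // j; rewrite column_val_cons val ffunE /= ffunE inordK ?ltnS ?digit_total_half //.
rewrite doubleD addnCA odd_double_half /digit_total addnA; congr (_ + _).
rewrite -muln2 big_distrl -big_split /=; apply: eq_bigr => i _.
by rewrite column_val_cons -muln2; ring.
Qed.

Lemma runs_apply ds a0 a1 a2 a3 a4 a5 a8 a9 a10 :
  exists2 ds',
    size ds' <= size ds + B.+1 /\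
      forall j, column_val ds' j = \sum_i M j i * column_val ds i &
    runs apply_matrix
      [:: a0; a1; a2; a3; a4; a5; map sym_digits ds; [::]; a8; a9; a10]
      (6 * (size ds + B.+1) + 2) tt
      [:: a0; a1; a2; a3; a4; a5; map sym_digits ds'; [::]; a8; a9; a10].
Proof.
have [ds' [sz val] r] := apply_loop ds [ffun=> ord0] [::] a0 a1 a2 a3 a4 a5 a8 a9 a10.
exists ds'; first by split=> // j; rewrite val ffunE addn0.
apply: runs_leq; first apply: runs_bind; first exact: r.
  have := @runs_move 10 symbol st_num' st_num
   [:: a0; a1; a2; a3; a4; a5; [::]; map sym_digits (rev ds' ++ [::]); a8; a9; a10] isT isT.
  by rewrite /= !cats0 -map_rev revK; exact.
by rewrite ?cats0 ?size_rev ?size_map ?size_rev; lia.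
Qed.

End Apply.
End Symbols.

(** * Subtraction and output of fractions *)

Section Subtraction.
Local Open Scope nat_scope.

Definition sub_digit (b x y : bool) : bool := x (+) y (+) b.
Definition sub_borrow (b x y : bool) : bool := ~~ x && (y || b) || y && b.

Fixpoint sub_bits (b : bool) (s : seq (bool * bool)) : seq bool * bool :=
  if s is (x, y) :: s' then
    let: (d, b') := sub_bits (sub_borrow b x y) s' in (sub_digit b x y :: d, b')
  else ([::], b).

Lemma nat_of_bits_lt s : nat_of_bits s < 2 ^ size s.
Proof. by elim: s => [|x s IH] //=; rewrite expnS; case: x; lia. Qed.

Lemma sub_bitsP b s : let: (d, b') := sub_bits b s in
  size d = size s /\
  nat_of_bits (map fst s) + 2 ^ size s * b' = nat_of_bits d + nat_of_bits (map snd s) + b.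
Proof.
elim: s b => [|[x y] s IH] b /=; first by rewrite mul1n add0n.
have := IH (sub_borrow b x y); case: sub_bits => d b' [sz e] /=; split; first by rewrite sz.
by rewrite expnS; move: e; rewrite /sub_borrow /sub_digit; case: x; case: y; case: b => /=; lia.
Qed.

(* The final borrow tells which of the two differences is not negative. *)
Lemma sub_bits_abs s (d1 d2 : seq bool) b1 b2 :
  sub_bits false s = (d1, b1) -> sub_bits false [seq (z.2, z.1) | z <- s] = (d2, b2) ->
  let u := nat_of_bits (if b1 then d2 else d1) in
  if b1 then nat_of_bits (map snd s) = u + nat_of_bits (map fst s)
  else nat_of_bits (map fst s) = u + nat_of_bits (map snd s).
Proof.
move=> e1 e2; have := sub_bitsP false s; have := sub_bitsP false [seq (z.2, z.1) | z <- s].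
rewrite e1 e2 -!map_comp size_map /= => -[sz2 v2] [sz1 v1].
have := nat_of_bits_lt d1; have := nat_of_bits_lt d2; rewrite sz1 sz2.
move: v1 v2; rewrite (eq_map (_ : fst \o _ =1 snd)) // (eq_map (_ : snd \o _ =1 fst)) //.
by case: b1 {e1} => /=; case: b2 {e2} => /=; lia.
Qed.

End Subtraction.

Section OutputFraction.
Variables (H R J : finType).
Local Notation symbol := (symbol H R J).
Local Notation machine := (machine H R J).
Local Notation sym_letter := (sym_letter H R J).
Local Notation sym_digits := (@sym_digits H R J).
Local Notation sym_pair := (@sym_pair H R J).
Variables (jden jpos jneg : J).
Local Open Scope nat_scope.

(** The sign is known only from the last borrow, so both differences are computed in the same pass
    and their digits stored as pairs. *)
Definition sub_body (b : bool * bool) : machine (bool * bool + bool)%type :=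
  bind (pop st_num) (fun o =>
    if o is Some (inr (inl (inr d))) then
      bind (push st_num' (sym_digits d)) (fun _ =>
      bind (push st_tmp (sym_pair (sub_digit b.1 (d jpos) (d jneg), sub_digit b.2 (d jneg) (d jpos)))) (fun _ =>
      ret (inl (sub_borrow b.1 (d jpos) (d jneg), sub_borrow b.2 (d jneg) (d jpos)))))
    else ret (inr b.1)).

Definition den_body (_ : unit) : machine (unit + unit)%type :=
  bind (pop st_num') (fun o =>
    if o is Some (inr (inl (inr d))) then
      bind (push st_num (sym_digits d)) (fun _ =>
      bind (push st_res (sym_letter (Some (d jden)))) (fun _ => ret (inl tt)))
    else ret (inr tt)).

Definition num_body (b : bool) (_ : unit) : machine (unit + unit)%type :=
  bind (pop st_tmp) (fun o =>
    if o is Some (inr (inr z)) then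
      bind (push st_res (sym_letter (Some (if b then z.2 else z.1)))) (fun _ => ret (inl tt))
    else ret (inr tt)).

(** The output stack is filled from the end: denominator, numerator, sign. Reading the denominator
    also puts the columns back in place for the next coordinate. *)
Definition out_fraction : machine unit :=
  bind (loop sub_body (false, false)) (fun b =>
  bind (push st_res (sym_letter None)) (fun _ =>
  bind (loop den_body tt) (fun _ =>
  bind (push st_res (sym_letter None)) (fun _ =>
  bind (loop (num_body b) tt) (fun _ =>
  push st_res (sym_letter (Some b))))))).

Implicit Types (ds : seq {ffun J -> bool}).

Definition signed_pairs ds := [seq (d jpos, d jneg) | d : {ffun J -> bool} <- ds].

Lemma sub_loop ds (b : bool * bool) acc acc' a0 a1 a2 a3 a4 a8 a9 a10 :
  let x := sub_bits b.1 (signed_pairs ds) in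
  let y := sub_bits b.2 [seq (z.2, z.1) | z <- signed_pairs ds] in
  runs (loop sub_body b)
    [:: a0; a1; a2; a3; a4; map sym_pair acc'; map sym_digits ds; map sym_digits acc; a8; a9; a10]
    (4 * size ds + 2) x.2
    [:: a0; a1; a2; a3; a4; map sym_pair (rev (zip x.1 y.1) ++ acc'); [::];
        map sym_digits (rev ds ++ acc); a8; a9; a10].
Proof.
elim: ds b acc acc' => [|d ds IH] b acc acc' /=.
  by apply: runs_loop_done; apply: runs_pop; apply: runs_ret.
have -> : 4 * (size ds).+1 + 2 = 4 + (4 * size ds + 2) by lia.
apply: (@runs_loop_next _ _ _ _ _ _ _ _
  (sub_borrow b.1 (d jpos) (d jneg), sub_borrow b.2 (d jneg) (d jpos))).
  by apply: runs_pop; apply: runs_push; apply: runs_push; apply: runs_ret.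
have := IH (sub_borrow b.1 (d jpos) (d jneg), sub_borrow b.2 (d jneg) (d jpos)) (d :: acc)
  ((sub_digit b.1 (d jpos) (d jneg), sub_digit b.2 (d jneg) (d jpos)) :: acc').
rewrite /=; case: sub_bits => x1 x2; case: sub_bits => y1 y2 /=.
by rewrite !rev_cons !cat_rcons.
Qed.

Lemma den_loop ds acc a0 a1 a2 a3 a4 a5 a8 a9 o :
  runs (loop den_body tt)
    [:: a0; a1; a2; a3; a4; a5; map sym_digits acc; map sym_digits ds; a8; a9; o]
    (4 * size ds + 2) tt
    [:: a0; a1; a2; a3; a4; a5; map sym_digits (rev ds ++ acc); [::]; a8; a9;
        map sym_letter [seq Some (d jden) | d : {ffun J -> bool} <- rev ds] ++ o].
Proof.
elim: ds acc o => [|d ds IH] acc o /=.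
  by apply: runs_loop_done; apply: runs_pop; apply: runs_ret.
have -> : 4 * (size ds).+1 + 2 = 4 + (4 * size ds + 2) by lia.
apply: (@runs_loop_next _ _ _ _ _ _ _ _ tt).
  by apply: runs_pop; apply: runs_push; apply: runs_push; apply: runs_ret.
have := IH (d :: acc) (sym_letter (Some (d jden)) :: o).
by rewrite !rev_cons !map_rcons !cat_rcons.
Qed.

Lemma num_loop (b : bool) (zs : seq (bool * bool)) a0 a1 a2 a3 a4 a6 a7 a8 a9 o :
  runs (loop (num_body b) tt)
    [:: a0; a1; a2; a3; a4; map sym_pair zs; a6; a7; a8; a9; o]
    (3 * size zs + 2) tt
    [:: a0; a1; a2; a3; a4; [::]; a6; a7; a8; a9;
        map sym_letter [seq Some (if b then z.2 else z.1) | z <- rev zs] ++ o].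
Proof.
elim: zs o => [|z zs IH] o /=.
  by apply: runs_loop_done; apply: runs_pop; apply: runs_ret.
have -> : 3 * (size zs).+1 + 2 = 3 + (3 * size zs + 2) by lia.
apply: (@runs_loop_next _ _ _ _ _ _ _ _ tt).
  by apply: runs_pop; apply: runs_push; apply: runs_ret.
have := IH (sym_letter (Some (if b then z.2 else z.1)) :: o).
by rewrite !rev_cons !map_rcons !cat_rcons.
Qed.

Lemma runs_out_fraction ds a0 a1 a2 a3 a4 a8 a9 o : column_val ds jden != 0 ->
  exists2 x : fraction, fraction_ok x /\
    (rat_of_fraction x = ((column_val ds jpos)%:R - (column_val ds jneg)%:R) / (column_val ds jden)%:R)%R &
  runs out_fraction
    [:: a0; a1; a2; a3; a4; [::]; map sym_digits ds; [::]; a8; a9; o]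
    (11 * size ds + 12) tt
    [:: a0; a1; a2; a3; a4; [::]; map sym_digits ds; [::]; a8; a9;
       map sym_letter (code_fraction x) ++ o].
Proof.
move=> den0; case e1 : (sub_bits false (signed_pairs ds)) => [d1 b1].
case e2 : (sub_bits false [seq (z.2, z.1) | z <- signed_pairs ds]) => [d2 b2].
pose u := if b1 then d2 else d1; pose v := [seq d jden | d : {ffun J -> bool} <- ds].
have sz1 : size d1 = size ds.
  by have := sub_bitsP false (signed_pairs ds); rewrite e1 size_map => -[].
have sz2 : size d2 = size ds.
  by have := sub_bitsP false [seq (z.2, z.1) | z <- signed_pairs ds]; rewrite e2 !size_map => -[].
exists (b1, u, v); first split => //.
  have := sub_bits_abs e1 e2; rewrite /= -/u -/v /signed_pairs -!map_comp /=.
  rewrite -[nat_of_bits [seq (fst \o _) i | i <- ds]]/(column_val ds jpos).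
  rewrite -[nat_of_bits [seq (snd \o _) i | i <- ds]]/(column_val ds jneg).
  case: b1 @u {e1} => /= ->; rewrite natrD; congr (_ / _)%R; ring.
have -> : map sym_letter (code_fraction (b1, u, v)) ++ o = sym_letter (Some b1) ::
   map sym_letter [seq Some z | z <- u] ++ sym_letter None ::
   map sym_letter [seq Some (d jden) | d : {ffun J -> bool} <- rev (rev ds)] ++ sym_letter None :: o.
  rewrite revK /code_fraction /code_bits /= map_cat !map_rcons -!cats1 -!catA /=.
  by rewrite -!map_comp.
apply: runs_leq.
  apply: runs_bind; first exact: (sub_loop ds (false, false) [::] [::]).
  rewrite /= e1 e2 /= !cats0; apply: runs_push.
  apply: runs_bind; first exact: (den_loop (rev ds) [::]).
  rewrite revK cats0; apply: runs_push.
  apply: runs_bind; first exact: num_loop.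
  have -> : [seq Some (if b1 then z.2 else z.1) | z <- rev (rev (zip d1 d2))] = [seq Some z | z <- u].
    rewrite revK /u; have s12 : size d1 = size d2 by rewrite sz1.
    case: (b1); last by rewrite -[in RHS](unzip1_zip (s := d1) (t := d2)) ?s12 // -map_comp.
    by rewrite -[in RHS](unzip2_zip (s := d1) (t := d2)) ?s12 // -map_comp.
  exact: runs_push1.
by rewrite !size_rev size_zip sz1 sz2 minnn; lia.
Qed.

End OutputFraction.

(** * Elimination on the stacks *)

Section Rounds.
Variables (R : finComNzRingType) (Y J : finType) (bez : R -> R -> R * R * R * R).
Local Notation H := (cell R Y).
Local Notation symbol := (symbol H R J).
Local Notation machine := (machine H R J).
Local Notation sym_letter := (sym_letter H R J).
Local Notation sym_cell := (@sym_cell H R J).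
Local Notation sym_coef := (@sym_coef H R J).
Local Notation sym_digits := (@sym_digits H R J).
Local Notation sep := (sym_letter None).

Definition enc_vecs (vs : seq (seq H)) : seq symbol :=
  flatten [seq map sym_cell v ++ [:: sep] | v <- vs].

Definition enc_ann (us : seq (R * seq H)) : seq symbol :=
  flatten [seq sym_coef a.1 :: map sym_cell a.2 ++ [:: sep] | a <- us].

Definition get_coef (o : option symbol) : R :=
  if o is Some (inr (inl (inl (inr r)))) then r else 0.

Section Annotate.

(** A vector may be shorter than [c]. When its separator shows up early, it is put back and a zero
    is written, so that the annotated copy has full length. *)
Definition dot_body (x : R) : machine (R + R)%type :=
  bind (pop st_prev) (fun o =>
    if o is Some (inr (inl (inl (inl c)))) then
      bind (push st_tmp (sym_cell c)) (fun _ =>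
      bind (pop st_vec) (fun o' =>
      match o' with
      | Some (inr (inl (inl (inl u)))) =>
        bind (push st_out (sym_cell u)) (fun _ => ret (inl (x + bcell c u)))
      | _ =>
        bind (push st_vec sep) (fun _ => bind (push st_out (sym_cell 0)) (fun _ => ret (inl x)))
      end))
    else ret (inr x)).

Definition annotate_one : machine unit :=
  bind (push st_out sep) (fun _ =>
  bind (loop dot_body 0) (fun x =>
  bind (pop st_vec) (fun _ =>
  bind (push st_out (sym_coef x)) (fun _ => move_stack st_tmp st_prev)))).

Definition annotate : machine unit :=
  loop (fun _ : unit => bind (pop st_vec) (fun o =>
    if o is Some x then bind (push st_vec x) (fun _ => bind annotate_one (fun _ => ret (inl tt)))
    else ret (inr tt : unit + unit)%type)) tt.

Fixpoint dot_list (c v : seq H) : R :=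
  if c is x :: c' then bcell x (head 0 v) + dot_list c' (behead v) else 0.

Fixpoint pad_list (n : nat) (v : seq H) : seq H :=
  if n is n'.+1 then head 0 v :: pad_list n' (behead v) else [::].

Definition ann (c v : seq H) : R * seq H := (dot_list c v, rev (pad_list (size c) v)).

Lemma bcell0 c : bcell c (0 : H) = 0 :> R.
Proof. by have := bcellP c 0 0 0 0; rewrite !scale0r !mul0r !addr0. Qed.

Local Open Scope nat_scope.

Lemma dot_loop c v x rest acc tmp o a0 a3 a6 a7 a8 a9 a10 : size v <= size c ->
  runs (loop dot_body x)
    [:: a0; map sym_cell v ++ sep :: rest; map sym_cell acc ++ o; a3; map sym_cell c; map sym_cell tmp;
         a6; a7; a8; a9; a10]
    (6 * size c + 2) (x + dot_list c v)%R
    [:: a0; sep :: rest; map sym_cell (rev (pad_list (size c) v) ++ acc) ++ o; a3; [::];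
         map sym_cell (rev c ++ tmp); a6; a7; a8; a9; a10].
Proof.
elim: c v x acc tmp => [|y c IH] v x acc tmp vc.
  case: v vc => // _; apply: runs_loop_done; rewrite /= addr0.
  by apply: runs_pop; apply: runs_ret.
have -> : 6 * size (y :: c) + 2 = 6 + (6 * size c + 2) by rewrite /=; lia.
case: v vc => [|u v] vc.
  apply: (@runs_loop_next _ _ _ _ _ _ _ _ x).
    apply: runs_pop; apply: runs_push; apply: runs_pop; apply: runs_push; apply: runs_push.
    exact: runs_ret.
  have := IH [::] x (0%R :: acc) (y :: tmp) isT.
  by rewrite /= bcell0 add0r !rev_cons !cat_rcons.
apply: (@runs_loop_next _ _ _ _ _ _ _ _ (x + bcell y u)%R).
  apply: (@runs_leq _ _ _ _ _ 5) => //.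
  apply: runs_pop; apply: runs_push; apply: runs_pop; apply: runs_push.
  exact: runs_ret.
have := IH v (x + bcell y u)%R (u :: acc) (y :: tmp) vc.
by rewrite /= addrA !rev_cons !cat_rcons.
Qed.

Lemma runs_annotate_one c v rest us a0 a3 a6 a7 a8 a9 a10 : size v <= size c ->
  runs annotate_one
    [:: a0; map sym_cell v ++ sep :: rest; enc_ann us; a3; map sym_cell c; [::]; a6; a7; a8; a9; a10]
    (9 * size c + 7) tt
    [:: a0; rest; enc_ann (ann c v :: us); a3; map sym_cell c; [::]; a6; a7; a8; a9; a10].
Proof.
move=> vc; apply: runs_leq.
  apply: runs_push; rewrite /=.
  apply: runs_bind; first exact: (dot_loop 0%R rest [::] [::] (sep :: enc_ann us) a0 a3 a6 a7 a8 a9 a10 vc).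
  apply: runs_pop; apply: runs_push; rewrite /= !cats0 add0r.
  have := @runs_move 10 symbol st_tmp st_prev
   [:: a0; rest; sym_coef (dot_list c v) :: map sym_cell (rev (pad_list (size c) v)) ++ sep :: enc_ann us;
      a3; [::]; map sym_cell (rev c); a6; a7; a8; a9; a10] isT isT.
  rewrite /= cats0 -map_rev revK /enc_ann /= -catA; exact.
by rewrite ?size_map ?size_rev; set n := size c; lia.
Qed.

Lemma runs_annotate c vs us a0 a3 a6 a7 a8 a9 a10 : all (fun v => size v <= size c) vs ->
  runs annotate
    [:: a0; enc_vecs vs; enc_ann us; a3; map sym_cell c; [::]; a6; a7; a8; a9; a10]
    (size vs * (9 * size c + 10) + 2) tt
    [:: a0; [::]; enc_ann (rev [seq ann c v | v <- vs] ++ us); a3; map sym_cell c; [::]; a6; a7; a8; a9; a10].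
Proof.
elim: vs us => [|v vs IH] us.
  by move=> _; apply: runs_loop_done; apply: runs_pop; apply: runs_ret.
have e1 : enc_vecs (v :: vs) = map sym_cell v ++ sep :: enc_vecs vs by rewrite /enc_vecs /= -catA.
have [x [r e2]] : exists x r, enc_vecs (v :: vs) = x :: r.
  by rewrite e1; case: (v) => [|x v']; do 2!eexists.
move=> /= /andP[vc vsc]; apply: runs_leq.
  apply: (@runs_loop_next _ _ _ _ _ _ _ _ tt).
    rewrite e2; apply: runs_pop; apply: runs_push; rewrite /= -e2 e1.
    by apply: runs_bind; [exact: runs_annotate_one | exact: runs_ret].
  by have := IH (ann c v :: us) vsc; rewrite rev_cons cat_rcons; exact.
by set n := size c; lia.
Qed.

End Annotate.
End Rounds.

Section Folding.
Variables (R : finComNzRingType) (Y J : finType) (bez : R -> R -> R * R * R * R).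
Variables (B : nat) (upd : R -> R -> J -> J -> nat).
Local Notation H := (cell R Y).
Local Notation symbol := (symbol H R J).
Local Notation machine := (machine H R J).
Local Notation sym_letter := (sym_letter H R J).
Local Notation sym_cell := (@sym_cell H R J).
Local Notation sym_coef := (@sym_coef H R J).
Local Notation sym_digits := (@sym_digits H R J).
Local Notation sep := (sym_letter None).
Local Notation enc_vecs := (@enc_vecs R Y J).
Local Notation enc_ann := (@enc_ann R Y J).
Local Notation get_coef := (@get_coef R Y J).

Definition take_body (_ : unit) : machine (unit + unit)%type :=
  bind (pop st_out) (fun o =>
    if o is Some (inr (inl (inl (inl c)))) then
      bind (push st_tmp (sym_cell c)) (fun _ => ret (inl tt))
    else ret (inr tt)).

Definition take_first : machine unit :=
  bind (loop take_body tt) (fun _ => move_stack st_tmp st_carry).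

Definition get_cell (o : option symbol) : H :=
  if o is Some (inr (inl (inl (inl c)))) then c else 0.

Definition cell_comb (p s : R) (c u : H) : H := p *: c + s *: u.

Definition comb_body (z : R * R * R * R) (_ : unit) : machine (unit + unit)%type :=
  bind (pop st_carry) (fun o =>
    if o is Some (inr (inl (inl (inl c)))) then
      bind (pop st_out) (fun o' =>
      bind (push st_tmp (sym_cell (cell_comb z.1.1.1 z.1.2 c (get_cell o')))) (fun _ =>
      bind (push st_vec (sym_cell (cell_comb z.1.1.2 z.2 c (get_cell o')))) (fun _ => ret (inl tt))))
    else ret (inr tt)).

Definition fold_body (g : R) : machine (R + R)%type :=
  bind (pop st_out) (fun o =>
    if o is None then ret (inr g) else
    let l := get_coef o in
    let z := bez g l in
    bind (push st_vec sep) (fun _ =>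
    bind (loop (comb_body z) tt) (fun _ =>
    bind (pop st_out) (fun _ =>
    bind (move_stack st_tmp st_carry) (fun _ => ret (inl (z.1.1.1 * g + z.1.2 * l)))))))%R.

Definition clear_body (_ : unit) : machine (unit + unit)%type :=
  bind (pop st_prev) (fun o => if o is Some _ then ret (inl tt) else ret (inr tt)).

Definition qform_body (x : R) : machine (R + R)%type :=
  bind (pop st_carry) (fun o =>
    if o is Some (inr (inl (inl (inl c)))) then
      bind (push st_prev (sym_cell c)) (fun _ => ret (inl (x + qcell c)))
    else ret (inr x)).

(** The first annotated vector starts as the pivot. The final pivot replaces the old c on [st_prev],
    and q of it is accumulated on the way; with g this selects the matrix to apply to the table. *)
Definition round_body (_ : unit) : machine (unit + unit)%type :=
  bind (pop st_vec) (fun o =>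
    if o is Some x then
      bind (push st_vec x) (fun _ =>
      bind (annotate R Y J) (fun _ =>
      bind (pop st_out) (fun g0 =>
      bind take_first (fun _ =>
      bind (loop fold_body (get_coef g0)) (fun g =>
      bind (loop clear_body tt) (fun _ =>
      bind (loop qform_body 0) (fun x =>
      bind (apply_matrix H R B (upd g x)) (fun _ => ret (inl tt)))))))))
    else ret (inr tt)).

Definition list_comb (p s : R) (c u : seq H) : seq H := [seq cell_comb p s z.1 z.2 | z <- zip c u].

(** [bezout_fold] on lists as the stacks hold them: annotated vectors and pivot are reversed during
    a round, whereas the vectors in [acc] are turned back to their original orientation. *)
Fixpoint list_fold (g : R) (c : seq H) acc rest : R * seq H * seq (seq H) :=
  if rest is (l, u) :: rest' then
    let: (p, q, s, t) := bez g l in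
    list_fold (p * g + s * l) (list_comb p s c u) (rev (list_comb q t c u) :: acc) rest'
  else (g, c, acc).

Local Open Scope nat_scope.
Implicit Types (c u v : seq H) (us : seq (R * seq H)) (vs acc : seq (seq H)).

Lemma runs_take_first u rest a0 a1 a4 a6 a7 a8 a9 a10 :
  runs take_first
    [:: a0; a1; map sym_cell u ++ sep :: rest; [::]; a4; [::]; a6; a7; a8; a9; a10]
    (6 * size u + 4) tt
    [:: a0; a1; rest; map sym_cell u; a4; [::]; a6; a7; a8; a9; a10].
Proof.
have loop_ tmp : runs (loop take_body tt)
    [:: a0; a1; map sym_cell u ++ sep :: rest; [::]; a4; tmp; a6; a7; a8; a9; a10]
    (3 * size u + 2) tt
    [:: a0; a1; rest; [::]; a4; rev (map sym_cell u) ++ tmp; a6; a7; a8; a9; a10].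
  elim: u tmp => [|c u IH] tmp.
    by apply: runs_loop_done; apply: runs_pop; apply: runs_ret.
  have -> : 3 * size (c :: u) + 2 = 3 + (3 * size u + 2) by rewrite /=; lia.
  apply: (@runs_loop_next _ _ _ _ _ _ _ _ tt).
    by apply: runs_pop; apply: runs_push; apply: runs_ret.
  by rewrite /= rev_cons cat_rcons; apply: IH.
apply: runs_leq; first apply: runs_bind; first exact: loop_.
  have := @runs_move 10 symbol st_tmp st_carry
   [:: a0; a1; rest; [::]; a4; rev (map sym_cell u) ++ [::]; a6; a7; a8; a9; a10] isT isT.
  by rewrite /= !cats0 revK; exact.
by rewrite ?size_rev ?size_map; set n := size u; lia.
Qed.

Lemma comb_loop p q s t c u rest tmp w a0 a4 a6 a7 a8 a9 a10 : size c = size u ->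
  runs (loop (comb_body (p, q, s, t)) tt)
    [:: a0; w; map sym_cell u ++ rest; map sym_cell c; a4; tmp; a6; a7; a8; a9; a10]
    (5 * size c + 2) tt
    [:: a0; rev (map sym_cell (list_comb q t c u)) ++ w; rest; [::]; a4;
      rev (map sym_cell (list_comb p s c u)) ++ tmp; a6; a7; a8; a9; a10].
Proof.
elim: c u tmp w => [|x c IH] [|y u] tmp w // => [_|[/IH cu]].
  by apply: runs_loop_done; apply: runs_pop; apply: runs_ret.
have -> : 5 * size (x :: c) + 2 = 5 + (5 * size c + 2) by rewrite /=; lia.
apply: (@runs_loop_next _ _ _ _ _ _ _ _ tt).
  by apply: runs_pop; apply: runs_pop; apply: runs_push; apply: runs_push; apply: runs_ret.
by rewrite /= !rev_cons !cat_rcons; apply: cu.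
Qed.

Lemma size_list_comb p s c u : size c = size u -> size (list_comb p s c u) = size c.
Proof. by move=> cu; rewrite size_map size_zip cu minnn. Qed.

Lemma fold_loop n g c acc us a0 a4 a6 a7 a8 a9 a10 :
  size c = n -> all (fun a => size a.2 == n) us ->
  let: (g', c', acc') := list_fold g c acc us in
  runs (loop fold_body g)
    [:: a0; enc_vecs acc; enc_ann us; map sym_cell c; a4; [::]; a6; a7; a8; a9; a10]
    (size us * (8 * n + 8) + 2) g'
    [:: a0; enc_vecs acc'; [::]; map sym_cell c'; a4; [::]; a6; a7; a8; a9; a10].
Proof.
elim: us g c acc => [|[l u] us IH] g c acc cn.
  by move=> _; apply: runs_loop_done; apply: runs_pop; apply: runs_ret.
move=> /andP[/eqP /= un usn]; rewrite /=; case z : (bez g l) => [[[p q] s] t].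
have cu : size c = size u by rewrite cn.
have szc : size (list_comb p s c u) = n := etrans (size_list_comb p s cu) cn.
have := IH (p * g + s * l)%R (list_comb p s c u) (rev (list_comb q t c u) :: acc) szc usn.
case: list_fold => [[g' c'] acc'] r.
apply: runs_leq.
  apply: (@runs_loop_next _ _ _ _ _ _ _ _ (p * g + s * l)%R); last exact: r.
  have -> : enc_ann ((l, u) :: us) = sym_coef l :: map sym_cell u ++ sep :: enc_ann us.
    by rewrite /enc_ann /= -catA.
  apply: runs_pop; rewrite /= z /=; apply: runs_push.
  apply: runs_bind; first exact: comb_loop.
  apply: runs_pop; rewrite /=.
  apply: runs_bind; last first.
    apply: runs_ret.
  have := @runs_move 10 symbol st_tmp st_carry
   [:: a0; rev (map sym_cell (list_comb q t c u)) ++ sep :: enc_vecs acc; enc_ann us; [::]; a4;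
      rev (map sym_cell (list_comb p s c u)) ++ [::]; a6; a7; a8; a9; a10] isT isT.
  rewrite /= !cats0 revK /enc_vecs /= -catA map_rev; exact.
rewrite ?size_rev ?size_map cn; move: szc; rewrite size_map => ->.
set k := size us; lia.
Qed.

Lemma clear_loop (s : seq symbol) a0 a1 a2 a3 a5 a6 a7 a8 a9 a10 :
  runs (loop clear_body tt)
    [:: a0; a1; a2; a3; s; a5; a6; a7; a8; a9; a10] (2 * size s + 2) tt
    [:: a0; a1; a2; a3; [::]; a5; a6; a7; a8; a9; a10].
Proof.
elim: s => [|x s IH].
  by apply: runs_loop_done; apply: runs_pop; apply: runs_ret.
have -> : 2 * size (x :: s) + 2 = 2 + (2 * size s + 2) by rewrite /=; lia.
apply: (@runs_loop_next _ _ _ _ _ _ _ _ tt) IH.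
by apply: runs_pop; apply: runs_ret.
Qed.

Lemma qform_loop c x s a0 a1 a2 a5 a6 a7 a8 a9 a10 :
  runs (loop qform_body x)
    [:: a0; a1; a2; map sym_cell c; s; a5; a6; a7; a8; a9; a10] (3 * size c + 2)
    (x + \sum_(y <- c) qcell y)%R
    [:: a0; a1; a2; [::]; map sym_cell (rev c) ++ s; a5; a6; a7; a8; a9; a10].
Proof.
elim: c x s => [|y c IH] x s.
  by rewrite big_nil addr0; apply: runs_loop_done; apply: runs_pop; apply: runs_ret.
have -> : 3 * size (y :: c) + 2 = 3 + (3 * size c + 2) by rewrite /=; lia.
apply: (@runs_loop_next _ _ _ _ _ _ _ _ (x + qcell y)%R).
  by apply: runs_pop; apply: runs_push; apply: runs_ret.
by rewrite big_cons addrA rev_cons map_rcons cat_rcons; apply: IH.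
Qed.

Lemma list_fold_size n g c acc us : size c = n -> all (fun a => size a.2 == n) us ->
  all (fun v => size v == n) acc ->
  let: (g', c', acc') := list_fold g c acc us in
  [/\ size c' = n, size acc' = size us + size acc & all (fun v => size v == n) acc'].
Proof.
elim: us g c acc => [|[l u] us IH] g c acc cn //= /andP[/eqP un usn] accn.
case: (bez g l) => [[[p q] s] t].
have cu : size c = size u by rewrite cn.
have szc : size (list_comb p s c u) = n := etrans (size_list_comb p s cu) cn.
have szq : size (list_comb q t c u) = n := etrans (size_list_comb q t cu) cn.
have := IH (p * g + s * l)%R (list_comb p s c u) (rev (list_comb q t c u) :: acc) szc usn.
rewrite /= size_rev szq eqxx addnS; move=> /(_ accn).
by case: list_fold => [[g' c'] acc'].
Qed.

Lemma size_pad_list n (v : seq H) : size (pad_list n v) = n.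
Proof. by elim: n v => //= n IH v; rewrite IH. Qed.

Hypothesis updB : forall g x j, \sum_i upd g x j i <= B.

Lemma runs_round c v vs ds a0 a8 a9 a10 : all (fun v => size v <= size c) (v :: vs) ->
  exists g u us, rev [seq ann c v | v <- v :: vs] = (g, u) :: us /\
  let: (g', c', vs') := list_fold g u [::] us in
  exists2 ds',
    [/\ size ds' <= size ds + B.+1, size c' = size c, size vs' = size vs,
      all (fun v => size v <= size c') vs' &
      forall j, column_val ds' j = \sum_i upd g' (\sum_(y <- c') qcell y)%R j i * column_val ds i] &
    runs (round_body tt)
      [:: a0; enc_vecs (v :: vs); [::]; [::]; map sym_cell c; [::]; map sym_digits ds; [::]; a8; a9; a10]
      (size (v :: vs) * (17 * size c + 18) + 11 * size c + 6 * (size ds + B.+1) + 30) (inl tt)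
      [:: a0; enc_vecs vs'; [::]; [::]; map sym_cell (rev c'); [::]; map sym_digits ds'; [::]; a8; a9; a10].
Proof.
move=> vsc.
case eus : (rev [seq ann c v | v <- v :: vs]) => [|[g u] us].
  by have := congr1 size eus; rewrite size_rev.
exists g, u, us; split => //.
have sz : all (fun a => size a.2 == size c) ((g, u) :: us).
  rewrite -eus all_rev; apply/allP => _ /mapP[x _ ->].
  by rewrite /= size_rev size_pad_list.
have szus : size us = size vs.
  by have := congr1 size eus; rewrite size_rev size_map => -[].
move: sz => /= /andP[/eqP su usc].
have := @list_fold_size _ g u [::] us su usc isT.
have := fold_loop g [::] a0 (map sym_cell c) (map sym_digits ds) [::] a8 a9 a10 su usc.
case: list_fold => [[g' c'] vs'] r [sc' svs' vsc'].
have [ds' [szd val] ra] := @runs_apply H R J B _ (updB g' (\sum_(y <- c') qcell y)%R) ds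
  a0 (enc_vecs vs') [::] [::] (map sym_cell (rev c') ++ [::]) [::] a8 a9 a10.
exists ds'.
  split => //; first by rewrite svs' addn0.
  by apply: sub_all vsc' => w /eqP ws; apply: eq_leq; exact: etrans ws (esym sc').
have [x [rst e2]] : exists x rst, enc_vecs (v :: vs) = x :: rst.
  by rewrite /enc_vecs /=; case: (v) => [|x v']; do 2!eexists.
apply: runs_leq.
  rewrite e2; apply: runs_pop; apply: runs_push; rewrite /= -e2.
  apply: runs_bind; first exact: (@runs_annotate _ _ J c (v :: vs) [::] _ _ _ _ _ _ _ vsc).
  have -> : enc_ann (rev [seq ann c v0 | v0 <- v :: vs] ++ [::]) =
      sym_coef g :: map sym_cell u ++ sep :: enc_ann us.
    by rewrite cats0 eus /enc_ann /= -catA.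
  apply: runs_pop; rewrite /=.
  apply: runs_bind; first exact: runs_take_first.
  apply: runs_bind; first exact: r.
  apply: runs_bind; first exact: clear_loop.
  apply: runs_bind; first exact: qform_loop.
  rewrite add0r; apply: runs_bind; first exact: ra.
  rewrite cats0; exact: runs_ret.
rewrite !size_map sc' szus su; set n := size c; set k := size vs; set d := size ds; rewrite /=; lia.
Qed.

End Folding.

Section Elimination.
Variables (C : comNzRingType) (R : finComNzRingType) (Y J : finType).
Variables (bez : R -> R -> R * R * R * R) (e : R -> C).
Hypothesis bezP : forall a b, let: (p, q, s, t) := bez a b in
  p * t - q * s = 1 /\ q * a + t * b = 0.
Hypothesis e0 : e 0 = 1.
Hypothesis eD : {morph e : x y / x + y >-> x * y}.
Local Notation H := (cell R Y).
Implicit Types (c u v : seq H) (us : seq (R * seq H)) (vs acc : seq (seq H)).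

Definition embed (n : nat) (v : seq H) : {ffun 'I_n -> H} := [ffun i => nth 0 v (nat_of_ord i)].

Lemma lsum_rev (U : lmodType R) (f : U -> C) l : lsum f (rev l) = lsum f l.
Proof.
elim: l f => [|u l IH] f //; rewrite rev_cons -cats1 lsum_catCA cats0.
by apply: lsum_cons_eq => g; apply: IH.
Qed.

Lemma nth_pad_list n v i : (i < n)%N -> nth 0 (pad_list n v) i = nth 0 v i.
Proof.
elim: n v i => // n IH v [|i] ni /=; first by case: v.
by rewrite IH // nth_behead.
Qed.

Lemma dot_listE c v : dot_list c v = bvec (embed (size c) c) (embed (size c) v).
Proof.
rewrite /bvec; under eq_bigr => i _ do rewrite !ffunE.
elim: c v => [|x c IH] v; first by rewrite big_ord0.
rewrite /= big_ord_recl /= nth0 IH; congr (_ + _); apply: eq_bigr => i _.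
by rewrite nth_behead.
Qed.

Lemma embed_ann c v : embed (size c) (rev (ann c v).2) = embed (size c) v.
Proof. by apply/ffunP => i; rewrite !ffunE /= revK nth_pad_list. Qed.

Lemma embed_comb n p s c u : size c = n -> size u = n ->
  embed n (rev (list_comb p s c u)) = p *: embed n (rev c) + s *: embed n (rev u).
Proof.
move=> cn un; apply/ffunP => i; rewrite !ffunE.
have sz : size (zip c u) = n by rewrite size_zip cn un minnn.
rewrite !nth_rev ?cn ?un ?size_map ?sz // (nth_map (0, 0)) ?sz; last by rewrite ltn_subrL; case: (n) i => [[]|].
by rewrite nth_zip ?cn ?un.
Qed.

Lemma qvec_embed n c : size c = n -> qvec (embed n (rev c)) = \sum_(y <- c) qcell y.
Proof.
move=> cn; rewrite -(perm_big _ (permEl (perm_rev c))) /= (big_nth 0) big_mkord size_rev cn.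
by rewrite /qvec; apply: eq_bigr => i _; rewrite ffunE.
Qed.

Lemma list_foldE n g c acc us : size c = n -> all (fun a => size a.2 == n) us ->
  let: (g', c', acc') := list_fold bez g c acc us in
  bezout_fold bez g (embed n (rev c)) (map (embed n) acc) [seq (a.1, embed n (rev a.2)) | a <- us] =
    (g', embed n (rev c'), map (embed n) acc').
Proof.
elim: us g c acc => [|[l u] us IH] g c acc cn //= /andP[/eqP un usn].
case: (bez g l) => [[[p q] s] t].
have cu : size c = size u by rewrite cn.
have szc : size (list_comb p s c u) = n := etrans (size_list_comb p s cu) cn.
rewrite -!embed_comb //.
exact: (IH (p * g + s * l)%R (list_comb p s c u) (rev (list_comb q t c u) :: acc) szc usn).
Qed.

(** The stacks reverse the order of the vectors, to which [lsum] is insensitive; otherwise this is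
    [lsum_round] for the embedded lists. *)
Lemma lsum_list_round V c v vs g u us : rev [seq ann c w | w <- v :: vs] = (g, u) :: us ->
  let: (g', c', vs') := list_fold bez g u [::] us in
  lsum (gauss_fn (@qvec R Y _) (@bvec R Y _) e V (embed (size c) c)) (map (embed (size c)) (v :: vs)) =
  lsum (gauss_fn (@qvec R Y _) (@bvec R Y _) e (gauss_step e g' (\sum_(y <- c') qcell y) V)
    (embed (size c) (rev c'))) (map (embed (size c)) vs').
Proof.
move=> eus; have sz : all (fun a => size a.2 == size c) ((g, u) :: us).
  rewrite -eus all_rev; apply/allP => _ /mapP[x _ ->].
  by rewrite /= size_rev size_pad_list.
have /andP[/eqP su usc] := sz.
have := list_foldE g [::] su usc; have := list_fold_size bez g su usc (acc := [::]) isT.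
case: list_fold => [[g' c'] vs'] [szc' _ _] foldE.
pose E (a : R * seq H) := embed (size c) (rev a.2).
set f := gauss_fn _ _ _ V _.
transitivity (lsum f (E (g, u) :: map E us)).
  apply: etrans (esym (lsum_rev f _)) _; congr lsum.
  rewrite -[RHS]/(map E ((g, u) :: us)) -eus -map_rev -map_comp map_rev; congr rev.
  by apply: eq_map => w; rewrite /E /= -embed_ann.
have annE : forall a, a \in (g, u) :: us -> a.1 = bvec (embed (size c) c) (E a).
  move=> a; rewrite -eus mem_rev => /mapP[w _ ->].
  by rewrite /E embed_ann /= dot_listE.
rewrite /f (lsum_round bezP (@bvecP _ _ _) (@qvecP _ _ _) eD) -map_comp.
have -> : [seq ((fun w => (bvec (embed (size c) c) w, w)) \o E) a | a <- us] = [seq (a.1, E a) | a <- us].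
  by apply/eq_in_map => a ain /=; rewrite -annE // inE ain orbT.
rewrite -(annE (g, u)) ?mem_head //= foldE.
by rewrite qvec_embed.
Qed.

Variables (B : nat) (upd : R -> R -> J -> J -> nat) (rep : (J -> nat) -> (R -> C) -> Prop).
Hypothesis updB : forall g x j, (\sum_i upd g x j i <= B)%N.
Hypothesis rep_upd : forall nv V g x, rep nv V ->
  rep (fun j => \sum_i upd g x j i * nv i)%N (gauss_step e g x V).

Local Notation sym_cell := (@sym_cell H R J).
Local Notation sym_digits := (@sym_digits H R J).
Local Open Scope nat_scope.

(** Each round uses up one vector and adds at most [B.+1] digits. When no vector is left the sum is
    its value at u = 0, namely V(0), since b(c,0) = 0 and e(q(0)) = 1. *)
Lemma runs_elimination n c vs ds V a0 a8 a9 a10 : size c = n ->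
  all (fun v => size v <= n) vs -> rep (column_val ds) V ->
  exists c' ds' V', [/\ rep (column_val ds') V',
      V' 0%R = lsum (gauss_fn (@qvec R Y n) (@bvec R Y n) e V (embed n c)) (map (embed n) vs),
      size ds' <= size ds + size vs * B.+1 &
    runs (loop (@round_body R Y J bez B upd) tt)
      [:: a0; enc_vecs J vs; [::]; [::]; map sym_cell c; [::]; map sym_digits ds; [::]; a8; a9; a10]
      (size vs * (size vs * (17 * n + 18) + 11 * n + 6 * (size ds + size vs * B.+1) + 30) + 2) tt
      [:: a0; [::]; [::]; [::]; map sym_cell c'; [::]; map sym_digits ds'; [::]; a8; a9; a10]].
Proof.
move k : (size vs) => m; elim: m vs k c ds V => [|m IH] [|v vs] // k c ds V cn vsn rp.
  exists c, ds, V; split; rewrite ?addn0 //; last first.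
    by apply: runs_loop_done; apply: runs_pop; apply: runs_ret.
  rewrite /= /gauss_fn (bf0 (@bvecP R Y n)) -[LHS]mulr1 -e0; congr (_ * e _)%R.
  rewrite /qvec big1 // => i _; rewrite /qcell big1 // => a _.
  by rewrite !ffunE mul0r.
have vsn' : all (fun v => size v <= size c) (v :: vs) by rewrite cn.
have [g [u [us [eus]]]] := runs_round bez updB ds a0 a8 a9 a10 vsn'.
have := lsum_list_round V eus; case: list_fold => [[g' c1] vs1] eL.
case=> ds1 [szd szc1 szvs1 vs1c val1] r1.
have cn1 : size (rev c1) = n := etrans (size_rev c1) (etrans szc1 cn).
have szm : size vs1 = m by rewrite szvs1; case: k.
have vs1n : all (fun v => size v <= n) vs1.
  by apply: sub_all vs1c => w ws; apply: leq_trans ws _; rewrite -cn1 size_rev.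
have rp1 : rep (column_val ds1) (gauss_step e g' (\sum_(y <- c1) qcell y)%R V).
  have -> : column_val ds1 = (fun j => \sum_i upd g' (\sum_(y <- c1) qcell y)%R j i * column_val ds i).
    by apply: funext => j; rewrite val1.
  exact: rep_upd.
have [c2 [ds2 [V2 [rp2 eV sz2 r2]]]] := IH vs1 szm (rev c1) ds1 _ cn1 vs1n rp1.
exists c2, ds2, V2; split=> //.
- rewrite eV; move: eL; rewrite cn => ->; by rewrite -cn1 size_rev.
- by apply: leq_trans sz2 _; rewrite mulSn addnA leq_add2r.
apply: runs_leq; first by apply: runs_loop_next r2; exact: r1.
rewrite -/(size (v :: vs)) k cn.
move: szd; set d1 := size ds1; set d := size ds; set X := 17 * n + 18; set Z := 11 * n => szd.
(* The digits gained in this round are paid for by the vector it removes. *)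
have le2 : m * X + Z + 6 * (d1 + m * B.+1) + 30 <= m.+1 * X + Z + 6 * (d + m.+1 * B.+1) + 30.
  by rewrite !mulSn; lia.
rewrite [X in _ <= X + 2]mulSn addnA leq_add2r; apply: leq_add.
  by rewrite !mulSn; lia.
by rewrite leq_mul2l le2 orbT.
Qed.
End Elimination.

(** * Reading the braid word *)

Section Compare.
Local Open Scope nat_scope.

Definition cmp_state : finType := (bool * (bool * bool))%type.

(* The running comparison of two numerals x and y, least significant bits first: whether x = y so
   far, whether x = y + 1 so far, and the carry of y + 1. *)
Definition cmp_upd (st : cmp_state) (x y : bool) : cmp_state :=
  (st.1 && (x == y), (st.2.1 && (x == y (+) st.2.2), y && st.2.2)).

(** A carry left at the end is one more digit of y + 1, which x does not have. *)
Definition cmp_end (st : cmp_state) : bool * bool := (st.1, st.2.1 && ~~ st.2.2).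

Fixpoint cmp_bits st (xs ys : seq bool) : bool * bool :=
  if xs is x :: xs' then cmp_bits (cmp_upd st x (head false ys)) xs' (behead ys)
  else cmp_end (foldl (fun st y => cmp_upd st false y) st ys).

Lemma cmp_bitsE a b c xs ys : cmp_bits (a, (b, c)) xs ys =
  (a && (nat_of_bits xs == nat_of_bits ys), b && (nat_of_bits xs == nat_of_bits ys + c)).
Proof.
elim: xs a b c ys => [|x xs IH] a b c ys /=.
  elim: ys a b c => [|y ys IH] a b c /=; first by rewrite andbT; case: c.
  rewrite /cmp_upd /= IH; move: (nat_of_bits ys) => v.
  by case: a; case: b; case: y; case: c => //=; congr (_, _); lia.
rewrite IH /=; have -> : nat_of_bits ys = head false ys + (nat_of_bits (behead ys)).*2 by case: ys.
move: (nat_of_bits xs) (nat_of_bits (behead ys)) (head false ys) => u v y.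
by case: a; case: b; case: x; case: y; case: c => //=; congr (_, _); lia.
Qed.

End Compare.

Section Build.
Variables (R : finComNzRingType) (Y J : finType).
Local Notation H := (cell R Y).
Local Notation symbol := (symbol H R J).
Local Notation machine := (machine H R J).
Local Notation sym_letter := (sym_letter H R J).
Local Notation sym_cell := (@sym_cell H R J).
Local Notation sym_digits := (@sym_digits H R J).
Local Notation sep := (sym_letter None).
Local Notation enc_vecs := (@enc_vecs R Y J).
Variables (ownc : bool -> Y -> H) (pairc : bool * bool -> Y -> H) (linc : bool -> H).
Variables (B : nat) (Mn : J -> J -> nat) (Mw : bool -> J -> J -> nat).

Definition sym_bit (b : bool) : symbol := sym_letter (Some b).

Definition read_bits : machine unit :=
  loop (fun _ : unit => bind (pop st_in) (fun o =>
    if o is Some (inl (Some b)) then bind (push st_tmp (sym_bit b)) (fun _ => ret (inl tt))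
    else ret (inr tt : unit + unit)%type)) tt.

Definition double_loop : machine unit :=
  loop (fun _ : unit => bind (pop st_cur) (fun o =>
    if o is Some x then bind (push st_past x) (fun _ => bind (push st_past x) (fun _ => ret (inl tt)))
    else ret (inr tt : unit + unit)%type)) tt.

Definition double_cur : machine unit := bind double_loop (fun _ => move_stack st_past st_cur).

(** Horner's scheme on the bits, most significant first. A stack of n symbols is affordable as the
    time may be polynomial in n, and it counts the applications of the scalar D / beta. *)
Definition unary : machine unit :=
  loop (fun _ : unit => bind (pop st_tmp) (fun o =>
    if o is Some x then bind double_cur (fun _ =>
      if x is inl (Some true) then bind (push st_cur (sym_bit true)) (fun _ => ret (inl tt))
      else ret (inl tt))
    else ret (inr tt : unit + unit)%type)) tt.

Definition apply_cur : machine unit :=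
  loop (fun _ : unit => bind (pop st_cur) (fun o =>
    if o is Some _ then bind (apply_matrix H R B Mn) (fun _ => ret (inl tt))
    else ret (inr tt : unit + unit)%type)) tt.

Definition cmp_past (st : cmp_state) : machine cmp_state :=
  loop (fun st : cmp_state => bind (pop st_past) (fun o =>
    if o is Some (inl (Some x)) then
      bind (push st_out (sym_bit x)) (fun _ => bind (pop st_cur) (fun o' =>
        if o' is Some (inl (Some y)) then
          bind (push st_tmp (sym_bit y)) (fun _ => ret (inl (cmp_upd st x y)))
        else ret (inl (cmp_upd st x false))))
    else bind (push st_out sep) (fun _ => ret (inr st : cmp_state + cmp_state)%type))) st.

Definition cmp_rest (st : cmp_state) : machine cmp_state :=
  loop (fun st : cmp_state => bind (pop st_cur) (fun o =>
    if o is Some (inl (Some y)) then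
      bind (push st_tmp (sym_bit y)) (fun _ => ret (inl (cmp_upd st false y)))
    else ret (inr st : cmp_state + cmp_state)%type)) st.

(** The comparison starts from x = y and x = y + 1 both possible, with carry 1 for y + 1. The
    earlier record moves to [st_out], and the current index is restored on [st_cur] for the next
    comparison. *)
Definition traverse_body (a : Y) (_ : unit) : machine (unit + unit)%type :=
  bind (pop st_past) (fun o =>
    if o is Some x then
      bind (push st_out x) (fun _ =>
      bind (cmp_past (true, (true, true))) (fun st =>
      bind (cmp_rest st) (fun st' =>
      bind (push st_vec (sym_cell (pairc (cmp_end st') a))) (fun _ =>
      bind (move_stack st_tmp st_cur) (fun _ => ret (inl tt))))))
    else ret (inr tt)).

Definition traverse (a : Y) : machine unit :=
  bind (loop (traverse_body a) tt) (fun _ => move_stack st_out st_past).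

Definition emit_vec (s : bool) (a : Y) : machine unit :=
  bind (push st_vec sep) (fun _ => bind (push st_vec (sym_cell (ownc s a))) (fun _ => traverse a)).

(** The scalar of each letter is applied to the table at once. Its vectors, one for each element of
    Y, need only the records of earlier letters on [st_past], to which the letter is then added. *)
Definition read_letters : machine unit :=
  loop (fun _ : unit => bind (pop st_in) (fun o =>
    if o is Some (inl (Some s)) then
      bind (apply_matrix H R B (Mw s)) (fun _ =>
      bind read_bits (fun _ =>
      bind (move_stack st_tmp st_cur) (fun _ =>
      bind (seq_mach (emit_vec s) (enum Y)) (fun _ =>
      bind (push st_past sep) (fun _ =>
      bind (move_stack st_cur st_tmp) (fun _ =>
      bind (move_stack st_tmp st_past) (fun _ =>
      bind (push st_past (sym_bit s)) (fun _ => ret (inl tt)))))))))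
    else ret (inr tt : unit + unit)%type)) tt.

Definition skip_past : machine unit :=
  loop (fun _ : unit => bind (pop st_past) (fun o =>
    if o is Some (inl (Some _)) then ret (inl tt) else ret (inr tt : unit + unit)%type)) tt.

Definition build_prev : machine unit :=
  loop (fun _ : unit => bind (pop st_past) (fun o =>
    if o is Some (inl (Some s)) then
      bind (push st_prev (sym_cell (linc s))) (fun _ => bind skip_past (fun _ => ret (inl tt)))
    else ret (inr tt : unit + unit)%type)) tt.

Local Open Scope nat_scope.
Implicit Types (bs : seq bool) (rs ps : seq (bool * seq bool)).

Lemma runs_read_bits bs rest t a1 a2 a3 a4 a6 a7 a8 a9 a10 :
  runs read_bits
    [:: map sym_bit bs ++ sep :: rest; a1; a2; a3; a4; t; a6; a7; a8; a9; a10] (3 * size bs + 2) tt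
    [:: rest; a1; a2; a3; a4; map sym_bit (rev bs) ++ t; a6; a7; a8; a9; a10].
Proof.
elim: bs t => [|b bs IH] t.
  by apply: runs_loop_done; apply: runs_pop; apply: runs_ret.
have -> : 3 * size (b :: bs) + 2 = 3 + (3 * size bs + 2) by rewrite /=; lia.
apply: (@runs_loop_next _ _ _ _ _ _ _ _ tt).
  by apply: runs_pop; apply: runs_push; apply: runs_ret.
by rewrite rev_cons map_rcons cat_rcons; apply: IH.
Qed.

Lemma runs_double_loop k j a0 a1 a2 a3 a4 a5 a6 a7 a10 :
  runs double_loop
    [:: a0; a1; a2; a3; a4; a5; a6; a7; nseq j (sym_bit true); nseq k (sym_bit true); a10] (4 * k + 2) tt
    [:: a0; a1; a2; a3; a4; a5; a6; a7; nseq (k.*2 + j) (sym_bit true); [::]; a10].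
Proof.
elim: k j => [|k IH] j.
  by apply: runs_loop_done; apply: runs_pop; apply: runs_ret.
have -> : 4 * k.+1 + 2 = 4 + (4 * k + 2) by lia.
apply: (@runs_loop_next _ _ _ _ _ _ _ _ tt).
  by apply: runs_pop; apply: runs_push; apply: runs_push; apply: runs_ret.
by have := IH j.+2; rewrite doubleS !addSn !addnS.
Qed.

Lemma runs_double k a0 a1 a2 a3 a4 a5 a6 a7 a10 :
  runs double_cur
    [:: a0; a1; a2; a3; a4; a5; a6; a7; [::]; nseq k (sym_bit true); a10] (10 * k + 4) tt
    [:: a0; a1; a2; a3; a4; a5; a6; a7; [::]; nseq k.*2 (sym_bit true); a10].
Proof.
apply: runs_leq.
  apply: runs_bind; first exact: (runs_double_loop _ 0).
  rewrite addn0; have := @runs_move 10 symbol st_past st_cur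
   [:: a0; a1; a2; a3; a4; a5; a6; a7; nseq k.*2 (sym_bit true); [::]; a10] isT isT.
  by rewrite /= cats0 rev_nseq; exact.
by rewrite size_nseq; lia.
Qed.

Lemma runs_unary bs k K a0 a1 a2 a3 a4 a6 a7 a10 :
  foldl (fun k (b : bool) => k.*2 + b) k bs <= K ->
  runs unary
    [:: a0; a1; a2; a3; a4; map sym_bit bs; a6; a7; [::]; nseq k (sym_bit true); a10]
    (size bs * (10 * K + 7) + 2) tt
    [:: a0; a1; a2; a3; a4; [::]; a6; a7; [::];
      nseq (foldl (fun k (b : bool) => k.*2 + b) k bs) (sym_bit true); a10].
Proof.
have mono l j : j <= foldl (fun k (b : bool) => k.*2 + b) j l.
  by elim: l j => //= b l IH j; apply: leq_trans (IH _); lia.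
elim: bs k => [|b bs IH] k kK.
  by apply: runs_loop_done; apply: runs_pop; apply: runs_ret.
have k1 : k <= K by apply: leq_trans kK; apply: mono.
apply: runs_leq.
  apply: (@runs_loop_next _ _ _ _ _ _ _ _ tt); last exact: IH kK.
  apply: runs_pop; rewrite /=; apply: runs_bind; first exact: runs_double.
  instantiate (1 := 2); case: b {kK}.
    by rewrite addn1; apply: runs_push; apply: runs_ret.
  by rewrite addn0; apply: runs_leq; first exact: runs_ret.
by rewrite /= mulSn; set z := size bs * _; lia.
Qed.

Lemma foldl_bits bs : foldl (fun k (b : bool) => k.*2 + b) 0 (rev bs) = nat_of_bits bs.
Proof. by rewrite foldl_rev; elim: bs => //= b bs ->; rewrite addnC. Qed.

End Build.

Section BuildRuns.
Variables (C : comNzRingType) (R : finComNzRingType) (Y J : finType).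
Local Notation H := (cell R Y).
Local Notation symbol := (symbol H R J).
Local Notation machine := (machine H R J).
Local Notation sym_letter := (sym_letter H R J).
Local Notation sym_cell := (@sym_cell H R J).
Local Notation sym_digits := (@sym_digits H R J).
Local Notation sym_bit := (@sym_bit R Y J).
Local Notation sep := (sym_letter None).
Local Notation enc_vecs := (@enc_vecs R Y J).
Variables (ownc : bool -> Y -> H) (pairc : bool * bool -> Y -> H) (linc : bool -> H).
Variables (B : nat) (Mn : J -> J -> nat) (Mw : bool -> J -> J -> nat).
Local Open Scope nat_scope.
Implicit Types (bs xs ys : seq bool) (rs ps : seq (bool * seq bool)) (r : bool * seq bool)
  (vs : seq (seq H)) (ds : seq {ffun J -> bool}).

Definition enc_rec r : seq symbol := sym_bit r.1 :: map sym_bit r.2 ++ [:: sep].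
Definition enc_recs ps : seq symbol := flatten (map enc_rec ps).
Definition relb xs ys : bool * bool :=
  (nat_of_bits xs == nat_of_bits ys, nat_of_bits xs == (nat_of_bits ys).+1).

Fixpoint cmp_fold (st : cmp_state) xs ys : cmp_state :=
  if xs is x :: xs' then cmp_fold (cmp_upd st x (head false ys)) xs' (behead ys) else st.

Lemma cmp_bits_fold st xs ys : cmp_bits st xs ys =
  cmp_end (foldl (fun st y => cmp_upd st false y) (cmp_fold st xs ys) (drop (size xs) ys)).
Proof. by elim: xs st ys => [|x xs IH] st [|y ys] //=; rewrite IH ?drop0. Qed.

Lemma runs_cmp_past st xs ys rest t o a0 a1 a3 a4 a6 a7 a10 :
  runs (cmp_past R Y J st)
    [:: a0; a1; o; a3; a4; t; a6; a7; map sym_bit xs ++ sep :: rest; map sym_bit ys; a10]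
    (5 * size xs + 3) (cmp_fold st xs ys)
    [:: a0; a1; sep :: map sym_bit (rev xs) ++ o; a3; a4;
      map sym_bit (rev (take (size xs) ys)) ++ t; a6; a7; rest; map sym_bit (drop (size xs) ys); a10].
Proof.
elim: xs st ys t o => [|x xs IH] st ys t o.
  rewrite take0 drop0; apply: runs_loop_done; apply: runs_pop; apply: runs_push; exact: runs_ret.
have -> : 5 * size (x :: xs) + 3 = 5 + (5 * size xs + 3) by rewrite /=; lia.
apply: (@runs_loop_next _ _ _ _ _ _ _ _ (cmp_upd st x (head false ys))
   [:: a0; a1; sym_bit x :: o; a3; a4; map sym_bit (take 1 ys) ++ t; a6; a7; map sym_bit xs ++ sep :: rest;
     map sym_bit (behead ys); a10]).
  case: ys => [|y ys].
    by apply: (@runs_leq _ _ _ _ _ 4) => //; apply: runs_pop; apply: runs_push; apply: runs_pop; apply: runs_ret.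
  by apply: runs_pop; apply: runs_push; apply: runs_pop; apply: runs_push; rewrite /= take0; apply: runs_ret.
have := IH (cmp_upd st x (head false ys)) (behead ys) (map sym_bit (take 1 ys) ++ t) (sym_bit x :: o).
rewrite rev_cons map_rcons cat_rcons; case: ys => [|y ys] //=.
by rewrite take0 rev_cons map_rcons cat_rcons.
Qed.

Lemma runs_cmp_rest st ys t a0 a1 a2 a3 a4 a6 a7 a8 a10 :
  runs (cmp_rest R Y J st)
    [:: a0; a1; a2; a3; a4; t; a6; a7; a8; map sym_bit ys; a10]
    (3 * size ys + 2) (foldl (fun st y => cmp_upd st false y) st ys)
    [:: a0; a1; a2; a3; a4; map sym_bit (rev ys) ++ t; a6; a7; a8; [::]; a10].
Proof.
elim: ys st t => [|y ys IH] st t.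
  by apply: runs_loop_done; apply: runs_pop; apply: runs_ret.
have -> : 3 * size (y :: ys) + 2 = 3 + (3 * size ys + 2) by rewrite /=; lia.
apply: (@runs_loop_next _ _ _ _ _ _ _ _ (cmp_upd st false y)).
  by apply: runs_pop; apply: runs_push; apply: runs_ret.
by rewrite rev_cons map_rcons cat_rcons; apply: IH.
Qed.

Lemma enc_recs_cons r ps : enc_recs (r :: ps) = sym_bit r.1 :: map sym_bit r.2 ++ sep :: enc_recs ps.
Proof. by rewrite /enc_recs /= /enc_rec -catA. Qed.

Lemma runs_traverse_loop n ys ps a o v a0 a3 a4 a6 a7 a10 :
  size ys <= n -> all (fun r => size r.2 <= n) ps ->
  runs (loop (traverse_body J pairc a) tt)
    [:: a0; v; o; a3; a4; [::]; a6; a7; enc_recs ps; map sym_bit ys; a10]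
    (size ps * (11 * n + 11) + 2) tt
    [:: a0; rev [seq sym_cell (pairc (relb p.2 ys) a) | p <- ps] ++ v; rev (enc_recs ps) ++ o; a3; a4; [::];
      a6; a7; [::]; map sym_bit ys; a10].
Proof.
move=> ysn; elim: ps o v => [|r ps IH] o v.
  by move=> _; apply: runs_loop_done; apply: runs_pop; apply: runs_ret.
move=> /andP[/= rn psn].
have -> : rev (enc_recs (r :: ps)) ++ o =
    rev (enc_recs ps) ++ sep :: map sym_bit (rev r.2) ++ sym_bit r.1 :: o.
  by rewrite enc_recs_cons rev_cons cat_rcons rev_cat rev_cons -catA cat_rcons map_rev.
rewrite rev_cons cat_rcons; apply: runs_leq.
  apply: (@runs_loop_next _ _ _ _ _ _ _ _ tt); last exact: IH psn.
  rewrite enc_recs_cons; apply: runs_pop; apply: runs_push.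
  apply: runs_bind; first exact: runs_cmp_past.
  apply: runs_bind; first exact: runs_cmp_rest.
  apply: runs_push; rewrite -cmp_bits_fold cmp_bitsE /= -/(relb _ _) addn1 cats0.
  rewrite -map_cat -rev_cat cat_take_drop.
  apply: runs_bind; last exact: runs_ret.
  have := @runs_move 10 symbol st_tmp st_cur
     [:: a0; sym_cell (pairc (relb r.2 ys) a) :: v; sep :: map sym_bit (rev r.2) ++ sym_bit r.1 :: o; a3; a4;
        map sym_bit (rev ys); a6; a7; enc_recs ps; [::]; a10] isT isT.
  rewrite /= cats0 -map_rev revK; exact.
rewrite size_map size_rev size_drop mulSn.
by set z := size ps * _; lia.
Qed.

Lemma size_enc_recs n ps : all (fun r => size r.2 <= n) ps -> size (enc_recs ps) <= size ps * (n + 2).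
Proof.
elim: ps => // r ps IH; rewrite enc_recs_cons => /andP[/= rn /IH]; rewrite size_cat /= size_map mulSn.
by set z := size ps * _; set y := size (enc_recs ps); lia.
Qed.

(** [ps] lists the earlier letters latest first; after the reversal entry j belongs to letter j and
    the own cell comes last. The missing entries of later letters count as 0. *)
Definition letter_vec ps r (a : Y) : seq H :=
  rev (ownc r.1 a :: [seq pairc (relb p.2 r.2) a | p <- ps]).

Lemma runs_emit_vec n ps r a vs a0 a3 a4 a6 a7 a10 :
  size r.2 <= n -> all (fun r => size r.2 <= n) ps ->
  runs (emit_vec J ownc pairc r.1 a)
    [:: a0; enc_vecs vs; [::]; a3; a4; [::]; a6; a7; enc_recs ps; map sym_bit r.2; a10]
    (size ps * (14 * n + 17) + 6) tt
    [:: a0; enc_vecs (letter_vec ps r a :: vs); [::]; a3; a4; [::]; a6; a7; enc_recs ps; map sym_bit r.2; a10].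
Proof.
move=> rn psn; have -> : enc_vecs (letter_vec ps r a :: vs) =
    rev [seq sym_cell (pairc (relb p.2 r.2) a) | p <- ps] ++ sym_cell (ownc r.1 a) :: sep :: enc_vecs vs.
  by rewrite /enc_vecs /= /letter_vec rev_cons map_rcons cat_rcons map_rev -map_comp -catA.
apply: runs_leq.
  apply: runs_push; apply: runs_push; apply: runs_bind; first exact: runs_traverse_loop rn psn.
  have := @runs_move 10 symbol st_out st_past
     [:: a0; rev [seq sym_cell (pairc (relb p.2 r.2) a) | p <- ps] ++ sym_cell (ownc r.1 a) :: sep :: enc_vecs vs;
        rev (enc_recs ps) ++ [::]; a3; a4; [::]; a6; a7; [::]; map sym_bit r.2; a10] isT isT.
  rewrite /= !cats0 revK; exact.
rewrite size_rev; have := size_enc_recs psn.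
have -> : size ps * (14 * n + 17) = size ps * (11 * n + 11) + 3 * (size ps * (n + 2)) by ring.
by set z := size (enc_recs ps); set x := size ps * (n + 2); set y := size ps * _; lia.
Qed.

Lemma runs_emit_vecs n ps r l vs a0 a3 a4 a6 a7 a10 :
  size r.2 <= n -> all (fun r => size r.2 <= n) ps ->
  runs (seq_mach (emit_vec J ownc pairc r.1) l)
    [:: a0; enc_vecs vs; [::]; a3; a4; [::]; a6; a7; enc_recs ps; map sym_bit r.2; a10]
    (size l * (size ps * (14 * n + 17) + 6) + 1) tt
    [:: a0; enc_vecs (rev [seq letter_vec ps r a | a <- l] ++ vs); [::]; a3; a4; [::]; a6; a7;
      enc_recs ps; map sym_bit r.2; a10].
Proof.
move=> rn psn; elim: l vs => [|a l IH] vs; first exact: runs_ret.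
rewrite /= rev_cons cat_rcons mulSn -addnA.
by apply: runs_bind; [exact: runs_emit_vec rn psn | exact: IH].
Qed.

Fixpoint word_vecs ps rs vs : seq (seq H) :=
  if rs is r :: rs' then word_vecs (r :: ps) rs' (rev [seq letter_vec ps r a | a <- enum Y] ++ vs)
  else vs.

Lemma runs_skip bs rest a0 a1 a2 a3 a4 a5 a6 a7 a9 a10 :
  runs (skip_past R Y J)
    [:: a0; a1; a2; a3; a4; a5; a6; a7; map sym_bit bs ++ sep :: rest; a9; a10] (2 * size bs + 2) tt
    [:: a0; a1; a2; a3; a4; a5; a6; a7; rest; a9; a10].
Proof.
elim: bs => [|b bs IH].
  by apply: runs_loop_done; apply: runs_pop; apply: runs_ret.
have -> : 2 * size (b :: bs) + 2 = 2 + (2 * size bs + 2) by rewrite /=; lia.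
apply: (@runs_loop_next _ _ _ _ _ _ _ _ tt) IH.
by apply: runs_pop; apply: runs_ret.
Qed.

Lemma runs_build_prev n ps c a0 a1 a2 a3 a5 a6 a7 a9 a10 : all (fun r => size r.2 <= n) ps ->
  runs (build_prev J linc)
    [:: a0; a1; a2; a3; map sym_cell c; a5; a6; a7; enc_recs ps; a9; a10] (size ps * (2 * n + 5) + 2) tt
    [:: a0; a1; a2; a3; map sym_cell (rev [seq linc r.1 | r <- ps] ++ c); a5; a6; a7; [::]; a9; a10].
Proof.
elim: ps c => [|r ps IH] c.
  by move=> _; apply: runs_loop_done; apply: runs_pop; apply: runs_ret.
move=> /andP[/= rn psn]; rewrite rev_cons cat_rcons; apply: runs_leq.
  apply: (@runs_loop_next _ _ _ _ _ _ _ _ tt); last exact: (IH (linc r.1 :: c) psn).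
  rewrite enc_recs_cons; apply: runs_pop; apply: runs_push.
  by apply: runs_bind; [exact: runs_skip | exact: runs_ret].
by rewrite mulSn; set z := size ps * _; lia.
Qed.

Variables (rep : (J -> nat) -> (R -> C) -> Prop) (kn : C) (kw : bool -> C).
Hypotheses (MnB : forall j, \sum_i Mn j i <= B) (MwB : forall s j, \sum_i Mw s j i <= B).
Hypothesis rep_n : forall nv V, rep nv V ->
  rep (fun j => \sum_i Mn j i * nv i) (fun x => kn * V x)%R.
Hypothesis rep_w : forall s nv V, rep nv V ->
  rep (fun j => \sum_i Mw s j i * nv i) (fun x => kw s * V x)%R.

Lemma runs_apply_cur k s ds V a0 a1 a2 a3 a4 a5 a8 a10 : rep (column_val ds) V ->
  size ds + k * B.+1 <= s ->
  exists2 ds', rep (column_val ds') (fun x => kn ^+ k * V x)%R /\ size ds' <= size ds + k * B.+1 &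
  runs (apply_cur R Y B Mn)
    [:: a0; a1; a2; a3; a4; a5; map sym_digits ds; [::]; a8; nseq k (sym_bit true); a10]
    (k * (6 * (s + B.+1) + 4) + 2) tt
    [:: a0; a1; a2; a3; a4; a5; map sym_digits ds'; [::]; a8; [::]; a10].
Proof.
elim: k ds V => [|k IH] ds V rp les.
  exists ds; first by rewrite addn0; split=> //; have -> : (fun x => kn ^+ 0 * V x)%R = V
    by apply: funext => x; rewrite mul1r.
  by apply: runs_loop_done; apply: runs_pop; apply: runs_ret.
have [ds1 [sz1 val1] r1] := @runs_apply H R J B _ MnB ds a0 a1 a2 a3 a4 a5 a8 (nseq k (sym_bit true)) a10.
have rp1 : rep (column_val ds1) (fun x => kn * V x)%R.
  have -> : column_val ds1 = (fun j => \sum_i Mn j i * column_val ds i) by apply: funext => j; exact: val1.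
  exact: rep_n.
have les1 : size ds1 + k * B.+1 <= s by rewrite mulSn in les; set z := k * _ in les *; lia.
have [ds2 [rp2 sz2] r2] := IH ds1 _ rp1 les1.
exists ds2.
  split; last by rewrite mulSn; set z := k * _ in sz2 *; lia.
  have -> // : (fun x => kn ^+ k.+1 * V x)%R = (fun x => kn ^+ k * (kn * V x))%R.
  by apply: funext => x; rewrite exprSr mulrA.
apply: runs_leq.
  apply: (@runs_loop_next _ _ _ _ _ _ _ _ tt); last exact: r2.
  apply: runs_pop; rewrite /=; apply: runs_bind; [exact: r1 | exact: runs_ret].
by rewrite mulSn; set z := k * _; rewrite mulSn in les; lia.
Qed.

Lemma runs_read_letters n p s rs ps vs ds V a3 a4 a10 :
  all (fun r => size r.2 <= n) rs -> all (fun r => size r.2 <= n) ps ->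
  size rs + size ps <= p -> rep (column_val ds) V -> size ds + size rs * B.+1 <= s ->
  exists2 ds', rep (column_val ds') (fun x => (\prod_(r <- rs) kw r.1) * V x)%R /\
      size ds' <= size ds + size rs * B.+1 &
  runs (read_letters ownc pairc B Mw)
    [:: enc_recs rs; enc_vecs vs; [::]; a3; a4; [::]; map sym_digits ds; [::]; enc_recs ps; [::]; a10]
    (size rs * (6 * (s + B.+1) + 12 * n + #|Y| * (p * (14 * n + 17) + 6) + 20) + 2) tt
    [:: [::]; enc_vecs (word_vecs ps rs vs); [::]; a3; a4; [::]; map sym_digits ds'; [::];
       enc_recs (rev rs ++ ps); [::]; a10].
Proof.
move=> + + + + les; elim: rs ps vs ds V les => [|r rs IH] ps vs ds V les rsn psn lep rp.
  exists ds.
    split; last exact: leq_addr.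
    by rewrite (_ : (fun x => _) = V) //; apply: funext => x; rewrite big_nil mul1r.
  by apply: runs_loop_done; apply: runs_pop; apply: runs_ret.
have /andP[rn rsn'] := rsn.
have [ds1 [sz1 val1] r1] := @runs_apply H R J B _ (MwB r.1) ds (map sym_bit r.2 ++ sep :: enc_recs rs)
  (enc_vecs vs) [::] a3 a4 [::] (enc_recs ps) [::] a10.
have rp1 : rep (column_val ds1) (fun x => kw r.1 * V x)%R.
  have -> : column_val ds1 = (fun j => \sum_i Mw r.1 j i * column_val ds i) by apply: funext => j; exact: val1.
  exact: rep_w.
have les1 : size ds1 + size rs * B.+1 <= s.
  by move: les; rewrite /= mulSn; set z := size rs * _; lia.
have [//||ds2 [rp2 sz2] r2] :=
  IH (r :: ps) (rev [seq letter_vec ps r a | a <- enum Y] ++ vs) ds1 _ les1 rsn' _ _ rp1.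
- by rewrite /= rn.
- by rewrite /= addnS.
exists ds2.
  split; last by rewrite /= mulSn; set z := size rs * _ in sz2 *; lia.
  have -> // : (fun x => (\prod_(r <- r :: rs) kw r.1) * V x)%R =
      (fun x => (\prod_(r <- rs) kw r.1) * (kw r.1 * V x))%R.
  by apply: funext => x; rewrite big_cons [(kw _ * _)%R]mulrC mulrA.
apply: runs_leq.
  apply: (@runs_loop_next _ _ _ _ _ _ _ _ tt); last by rewrite rev_cons cat_rcons; exact: r2.
  rewrite enc_recs_cons; apply: runs_pop; rewrite /=; apply: runs_bind; first exact: r1.
  apply: runs_bind; first exact: runs_read_bits.
  apply: runs_bind.
    have := @runs_move 10 symbol st_tmp st_cur [:: enc_recs rs; enc_vecs vs; [::]; a3; a4;
       map sym_bit (rev r.2) ++ [::]; map sym_digits ds1; [::]; enc_recs ps; [::]; a10] isT isT.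
    rewrite /= !cats0 -map_rev revK; exact.
  apply: runs_bind; first exact: runs_emit_vecs rn psn.
  apply: runs_push; apply: runs_bind.
    have := @runs_move 10 symbol st_cur st_tmp [:: enc_recs rs;
       enc_vecs (rev [seq letter_vec ps r a | a <- enum Y] ++ vs); [::]; a3; a4;
       [::]; map sym_digits ds1; [::]; sep :: enc_recs ps; map sym_bit r.2; a10] isT isT.
    rewrite /= !cats0; exact.
  apply: runs_bind.
    have := @runs_move 10 symbol st_tmp st_past [:: enc_recs rs;
       enc_vecs (rev [seq letter_vec ps r a | a <- enum Y] ++ vs); [::]; a3; a4;
       rev (map sym_bit r.2); map sym_digits ds1; [::]; sep :: enc_recs ps; [::]; a10] isT isT.
    rewrite /= revK; exact.
  by apply: runs_push; rewrite /= -enc_recs_cons; apply: runs_ret.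
rewrite ?size_map ?size_rev ?size_map -enumT -cardE.
have lep' : size ps <= p by apply: leq_trans lep; rewrite leq_addl.
have := leq_mul (leqnn #|Y|) (leq_add (leq_mul lep' (leqnn (14 * n + 17))) (leqnn 6)).
move: les; rewrite /= !mulSn; set z := size rs * B.+1; set z1 := #|Y| * (p * _ + _); set z2 := #|Y| * _.
set z3 := size rs * _; lia.
Qed.

End BuildRuns.

(** * Exact arithmetic in a number field *)

Section NumberRepresentation.
Variables (C : numClosedFieldType) (K : fieldExtType rat) (iota : {rmorphism K -> C}).
Variables (d : nat) (b : d.-tuple K).
Hypothesis bP : basis_of {:K} b.
Variable R : finType.

(** D is the product of all denominators; p and m are the positive and negative parts of the
    resulting integers. *)
Lemma common_denominator (I : finType) (f : I -> rat) :
  exists (D : nat) (p m : I -> nat), D != 0%N /\ forall i, (p i)%:R - (m i)%:R = f i * D%:R.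
Proof.
pose D := (\prod_i `|denq (f i)|)%N.
have fD i : exists z : int, f i * D%:R = z%:~R.
  exists (numq (f i) * (\prod_(j | j != i) `|denq (f j)|)%N%:Z).
  rewrite /D (bigD1 i) //= natrM mulrA rmorphM /= -{1}(divq_num_den (f i)).
  congr (_ * _).
  by rewrite -[`|denq _|%N%:R]/(`|denq (f i)|%N%:Z%:~R) gez0_abs ?denq_ge0 // mulfVK // intr_eq0 denq_neq0.
pose z i := projT1 (cid (fD i)); have zP i : f i * D%:R = (z i)%:~R by rewrite /z; case: cid.
exists D, (fun i => if z i is Posz k then k else 0%N), (fun i => if z i is Negz k then k.+1 else 0%N).
split; first by rewrite /D -lt0n prodn_gt0 // => i; rewrite absz_gt0 denq_neq0.
by move=> i; rewrite zP; case: (z i) => k; rewrite ?subr0 // NegzE sub0r rmorphN.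
Qed.

(* An index (x, (i, s)) stands for the coefficient of (-1)^s b_i in the value at x; None stands for
   the common denominator. *)
Definition num_idx : finType := option (R * ('I_d * bool))%type.

Definition num_coef (nv : num_idx -> nat) (x : R) (i : 'I_d) : rat :=
  ((nv (Some (x, (i, false))))%:R - (nv (Some (x, (i, true))))%:R) / (nv None)%:R.

Definition num_rep (nv : num_idx -> nat) (V : R -> C) : Prop :=
  nv None != 0%N /\ forall x, V x = iota (\sum_i num_coef nv x i *: tnth b i).

Lemma basis_coord (u : K) : u = \sum_i coord b i u *: tnth b i.
Proof.
have ub : u \in <<b>>%VS by rewrite (span_basis bP) memvf.
rewrite [LHS](coord_span ub); apply: eq_bigr => i _; by rewrite (tnth_nth 0).
Qed.

(** Multiplication by [a x y] has a rational matrix in the basis; cleared by D, its entries are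
    differences p - m. Between slots of equal sign p is used, between opposite signs m, so that M
    has natural entries; the denominator slot is multiplied by D. *)
Lemma num_operator (a : R -> R -> K) : exists M : num_idx -> num_idx -> nat,
  forall nv V, num_rep nv V ->
    num_rep (fun j => \sum_i M j i * nv i)%N (fun x => \sum_y iota (a x y) * V y).
Proof.
have [D [p [m [D0 pm]]]] := @common_denominator (R * 'I_d * (R * 'I_d))%type
  (fun z => coord b z.1.2 (a z.1.1 z.2.1 * tnth b z.2.2)).
pose M : num_idx -> num_idx -> nat := fun j i => match j, i with
  | None, None => D
  | Some (x, (k, s)), Some (y, (l, t)) => if s == t then p ((x, k), (y, l)) else m ((x, k), (y, l))
  | _, _ => 0%N end.
exists M.
move=> nv V [nv0 VE].
pose rat_ (n : nat) : rat := n%:R.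
have sumJ (F : num_idx -> nat) : (\sum_i F i =
    F None + \sum_y \sum_l (F (Some (y, (l, false))) + F (Some (y, (l, true)))))%N.
  rewrite (bigD1 None) //=; congr (_ + _)%N.
  rewrite (reindex_omap Some (@id _)) /=; last by case.
  rewrite pair_big /=.
  transitivity (\sum_(z : R * ('I_d * bool)) F (Some z))%N.
    by apply: eq_bigl => z; rewrite eqxx.
  rewrite (reindex (fun z : (R * 'I_d) * bool => (z.1.1, (z.1.2, z.2)))) /=; last first.
    by exists (fun z : R * ('I_d * bool) => ((z.1, z.2.1), z.2.2)); [move=> [[x i] s] _|move=> [x [i s]] _].
  rewrite -(pair_big xpredT xpredT (fun (z : R * 'I_d) s => F (Some (z.1, (z.2, s))))) /=.
  by apply: eq_bigr => z _; rewrite big_bool addnC.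
split; first by rewrite sumJ big1 ?addn0 ?muln_eq0 ?negb_or ?D0 // => y _; rewrite big1.
move=> x; have coefE k : num_coef (fun j => \sum_i M j i * nv i)%N x k =
  \sum_y \sum_l coord b k (a x y * tnth b l) * num_coef nv y l.
  rewrite /num_coef [X in _ / X%:R](_ : _ = D * nv None)%N; last first.
    by rewrite sumJ big1 ?addn0 // => y _; rewrite big1.
  rewrite !sumJ /= !mul0n !add0n !natr_sum -sumrB mulr_suml; apply: eq_bigr => y _.
  rewrite !natr_sum -sumrB mulr_suml; apply: eq_bigr => l _.
  have := pm ((x, k), (y, l)); rewrite /= natrM !natrD !natrM.
  set P := (p _)%:R; set Q := (m _)%:R; set N0 := (nv _)%:R; set N1 := (nv _)%:R; set N2 := (nv _)%:R => e.
  have D1 : (D%:R : rat) != 0 by rewrite pnatr_eq0.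
  have n0 : N2 != 0 by rewrite pnatr_eq0.
  have -> : P * N0 + Q * N1 - (Q * N0 + P * N1) = (P - Q) * (N0 - N1) by ring.
  by rewrite e; field; rewrite D1 n0.
under eq_bigr => y _ do rewrite VE -rmorphM.
rewrite -rmorph_sum; congr (iota _).
under [RHS]eq_bigr => k _ do rewrite coefE.
transitivity (\sum_y \sum_l num_coef nv y l *: (a x y * tnth b l)).
  apply: eq_bigr => y _; rewrite mulr_sumr; apply: eq_bigr => l _.
  by rewrite scalerAr.
transitivity (\sum_y \sum_l \sum_k (coord b k (a x y * tnth b l) * num_coef nv y l) *: tnth b k).
  apply: eq_bigr => y _; apply: eq_bigr => l _.
  rewrite [in LHS](basis_coord (a x y * tnth b l)) scaler_sumr; apply: eq_bigr => k _.
  by rewrite scalerA mulrC.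
rewrite (eq_bigr (fun y => \sum_k \sum_l (coord b k (a x y * tnth b l) * num_coef nv y l) *: tnth b k)).
  rewrite exchange_big; apply: eq_bigr => k _; rewrite scaler_suml; apply: eq_bigr => y _.
  by rewrite scaler_suml.
by move=> y _; rewrite exchange_big.
Qed.

Lemma num_scalar (a : K) : exists M : num_idx -> num_idx -> nat,
  forall nv V, num_rep nv V -> num_rep (fun j => \sum_i M j i * nv i)%N (fun x => iota a * V x).
Proof.
have [M MP] := num_operator (fun x y : R => if x == y then a else 0).
exists M => nv V /MP; rewrite (_ : (fun x => _) = (fun x => iota a * V x)) //.
apply: funext => x; rewrite (bigD1 x) //= eqxx big1 ?addr0 // => y /negPf yx.
by rewrite eq_sym yx rmorph0 mul0r.
Qed.

(** A single column holds only digits 0 and 1. It encodes the table with value b_0 at [x0] and 0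
    elsewhere, and the operator with kernel f(x) / b_0 at [x0] spreads it to f. *)
Lemma num_init (f : R -> K) (x0 : R) : exists (ds0 : {ffun num_idx -> bool}) (M : num_idx -> num_idx -> nat),
  num_rep (fun j => \sum_i M j i * ds0 i)%N (fun x => iota (f x)).
Proof.
have d_gt0 : (0 < d)%N.
  have : (\dim {:K} != 0)%N.
    rewrite dimv_eq0 -subv0 -[X in (_ <= X)%VS]/0%VS; apply/negP => /subvP/(_ 1 (memvf _)).
    by rewrite memv0 oner_eq0.
  have := size_basis bP.
  by rewrite lt0n => e; rewrite -e.
pose i0 := Ordinal d_gt0.
have b0 : tnth b i0 != 0 by apply: (free_not0 (basis_free bP)); rewrite mem_tnth.
have [M MP] := num_operator (fun x y : R => if y == x0 then f x / tnth b i0 else 0).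
pose ds0 : {ffun num_idx -> bool} := [ffun j => (j == None) || (j == Some (x0, (i0, false)))].
have ds0E x i s : ds0 (Some (x, (i, s))) = [&& x == x0, i == i0 & ~~ s].
  by rewrite ffunE /= -[Some _ == _]/((x, (i, s)) == (x0, (i0, false))) !xpair_eqE eqbF_neg.
exists ds0, M.
have /MP : num_rep (fun j => ds0 j : nat) (fun x => if x == x0 then iota (tnth b i0) else 0).
  split; first by rewrite ffunE.
  move=> x; rewrite (bigD1 i0) //= big1 => [|i /negPf ii0].
    rewrite /num_coef !ds0E ffunE /= ?eqxx ?divr1 addr0.
    by case: (x == x0); rewrite /= ?subr0 ?scale1r ?subrr ?scale0r ?rmorph0.
  by rewrite /num_coef !ds0E ii0 !andbF subrr mul0r scale0r.
rewrite (_ : (fun x => _) = (fun x => iota (f x))) //.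
apply: funext => x; rewrite (bigD1 x0) //= eqxx big1 ?addr0 => [|y /negPf yx].
  by rewrite -rmorphM /= mulfVK.
by rewrite yx rmorph0 mul0r.
Qed.

End NumberRepresentation.

(** * The complete machine *)

Section LetterVectors.
Variables (R : finComNzRingType) (Y : finType).
Local Notation H := (cell R Y).

(** The stack grows at its top, so the vectors of the last letter come first, and for each letter
    the enumeration of Y is reversed. *)
Lemma word_vecsE ownc pairc r0 ps rs (vs : seq (seq H)) : word_vecs ownc pairc ps rs vs =
  [seq letter_vec ownc pairc (rev (take k rs) ++ ps) (nth r0 rs k) a |
     k <- rev (iota 0%N (size rs)), a <- rev (enum Y)] ++ vs.
Proof.
elim: rs ps vs => [|r rs IH] ps vs //.
rewrite [LHS]/= IH -[size (r :: rs)]/(size rs).+1 -[iota _ _.+1]/(0%N :: iota 1%N (size rs)) rev_cons -cats1.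
have -> : iota 1%N (size rs) = map S (iota 0%N (size rs)) by rewrite -[1%N]/(1 + 0)%N iotaDl.
move: (enum Y) => E; rewrite -!map_rev map_cat flatten_cat -catA.
congr (_ ++ _); last by rewrite /= cats0.
rewrite -map_comp; congr flatten; apply: eq_map => k; apply: eq_map => a.
by rewrite /= rev_cons cat_rcons.
Qed.

Lemma nth_letter_vec ownc pairc ps r a i (p0 : bool * seq bool) :
  nth 0 (letter_vec ownc pairc ps r a : seq H) i =
  if i == size ps then ownc r.1 a
  else if (i < size ps)%N then pairc (relb (nth p0 (rev ps) i).2 r.2) a else 0.
Proof.
rewrite /letter_vec rev_cons nth_rcons -map_rev size_map size_rev.
by case: ltngtP => // ips; rewrite (nth_map p0) ?size_rev.
Qed.

End LetterVectors.

Section WordLists.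
Variables (R : finComNzRingType) (Y : finZmodType).
Local Notation H := (cell R Y).
Variables (own : bool -> Y -> Y -> R) (lin : bool -> Y -> R) (cpl : bool * bool -> Y -> Y -> R).
Variables (l : nat) (rs : seq (bool * seq bool)) (s : 'I_l -> bool) (rel : 'I_l -> 'I_l -> bool * bool).
Variable r0 : bool * seq bool.
Hypotheses (sz : size rs = l) (sE : forall k, s k = (nth r0 rs k).1).
Hypothesis relE : forall j k, rel j k = relb (nth r0 rs j).2 (nth r0 rs k).2.

Definition word_enum : seq ('I_l * Y) := [seq (k, a) | k <- rev (enum 'I_l), a <- rev (enum Y)].

Lemma word_enum_uniq : uniq word_enum.
Proof. by apply: allpairs_uniq; rewrite ?rev_uniq ?enum_uniq // => -[i x] [j y]. Qed.

Lemma size_word_enum : size word_enum = (l * #|Y|)%N.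
Proof. by rewrite size_allpairs !size_rev -!cardE card_ord. Qed.

Lemma word_vecs_embed :
  map (embed l) (word_vecs (own_cell own) (pair_cell cpl) [::] rs [::]) =
  [seq word_vec own cpl s rel i | i <- word_enum].
Proof.
rewrite (word_vecsE _ _ r0) cats0 /word_enum !map_allpairs sz -val_enum_ord -map_rev -map_comp.
congr flatten; apply: eq_map => k; apply: eq_map => a /=.
apply/ffunP => j; rewrite !ffunE (nth_letter_vec _ _ _ _ _ _ r0) cats0 size_rev revK.
have kl : (k <= size rs)%N by rewrite sz ltnW.
rewrite (size_takel kl) sE -[j == k]/(nat_of_ord j == nat_of_ord k).
by case: (ltngtP j k) => jk //; rewrite nth_take // relE.
Qed.

Lemma size_word_vecs :
  size (word_vecs (own_cell own) (pair_cell cpl) [::] rs [::]) = (l * #|Y|)%N.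
Proof. by rewrite -(size_map (embed l)) word_vecs_embed size_map size_word_enum. Qed.

Lemma word_vecs_size :
  all (fun v => size v <= l)%N (word_vecs (own_cell own) (pair_cell cpl) [::] rs [::]).
Proof.
rewrite (word_vecsE _ _ r0) cats0; apply/allP => _ /allpairsP[[k a] [kin _ ->]].
rewrite mem_rev mem_iota sz in kin.
by rewrite size_rev /= size_map cats0 size_rev size_takel ?sz // ltnW.
Qed.

Lemma embed_lin : embed l [seq lin_cell lin r.1 | r <- rs] = lin_vec lin s.
Proof. by apply/ffunP => j; rewrite !ffunE (nth_map r0) ?sz // sE. Qed.

End WordLists.

Lemma lsum_scale (C : comNzRingType) (R : finComNzRingType) (U : lmodType R) (k : C) (f : U -> C) vs :
  lsum (fun u => k * f u) vs = k * lsum f vs.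
Proof.
by elim: vs f => //= v vs IH f; rewrite mulr_sumr; apply: eq_bigr => x _; apply: IH.
Qed.

Section Phases.
Variables (C : numClosedFieldType) (L : link_data C) (ql : quadratic_letters L).
Local Notation G := (tgrp L).
Local Notation pr := (ql_pair ql).

Definition letter_form (s : bool) (y y' : G * G) : C :=
  ql_form ql s y.1 y'.1 * (pr y.2 y'.1 * pr y'.2 y.1).

Lemma bichar_comp (Z Z' : zmodType) (chi : Z' -> Z' -> C) (f g : Z -> Z') :
  {morph f : x y / x + y} -> {morph g : x y / x + y} -> U1_bicharacter chi ->
  U1_bicharacter (fun y y' => chi (f y) (g y')).
Proof.
by move=> fD gD [l r]; split=> y; [apply: U1_comp gD (l _) | apply: U1_comp fD (r _)].
Qed.

Lemma bichar_mul (Z : zmodType) (chi chi' : Z -> Z -> C) : U1_bicharacter chi ->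
  U1_bicharacter chi' -> U1_bicharacter (fun y y' => chi y y' * chi' y y').
Proof.
by move=> [l r] [l' r']; split=> y; [apply: U1_mul (l _) (l' _) | apply: U1_mul (r _) (r' _)].
Qed.

Lemma bichar_flip (Z : zmodType) (chi : Z -> Z -> C) :
  U1_bicharacter chi -> U1_bicharacter (fun y y' => chi y' y).
Proof. by case. Qed.

Lemma letter_form_bichar s : U1_bicharacter (letter_form s).
Proof.
apply: bichar_mul; first exact: (bichar_comp (f := fst) (g := fst)) (ql_form_bichar ql s).
apply: bichar_mul; first exact: (bichar_comp (f := snd) (g := fst)) (ql_pair_bichar ql).
apply: (bichar_flip (chi := fun y y' => pr y.2 y'.1)).
exact: (bichar_comp (f := snd) (g := fst)) (ql_pair_bichar ql).
Qed.

Lemma letter_phase_U1 s : U1_valued (letter_phase ql s).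
Proof. by move=> y; rewrite normrM (ql_fun_U1 ql) ((ql_pair_bichar ql).1 _).1 mulr1. Qed.

Lemma letter_phaseD s y y' :
  letter_phase ql s (y + y') = letter_phase ql s y * letter_phase ql s y' * letter_form s y y'.
Proof.
have [l r] := ql_pair_bichar ql.
rewrite /letter_phase /letter_form /= (ql_funD ql) (l _).2 !(r _).2.
by ring.
Qed.

Lemma pair_phase_bichar r : U1_bicharacter (pair_phase ql r).
Proof.
apply: bichar_mul.
  case: r.1; last exact: U1_one_bichar.
  apply: bichar_mul; first exact: (bichar_comp (f := fst) (g := fst)) (ql_nu_bichar ql).
  apply: bichar_mul; first exact: (bichar_comp (f := snd) (g := fst)) (ql_pair_bichar ql).
  apply: (bichar_flip (chi := fun y y' => pr y.2 y'.1)).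
  exact: (bichar_comp (f := snd) (g := fst)) (ql_pair_bichar ql).
case: r.2; last exact: U1_one_bichar.
apply: (bichar_flip (chi := fun y y' => (ttau y.1 y'.1)^-1)).
have [l' r'] : U1_bicharacter (fun y y' : G * G => @ttau C L y.1 y'.1).
  exact: (bichar_comp (f := fst) (g := fst)) (ttau_bichar L).
by split=> y; apply: U1_inv.
Qed.

End Phases.

(** * Polynomial bounds and the operators of the algorithm *)

Definition polyfun (f : nat -> nat) := exists p : {poly nat}, forall x, p.[x] = f x.

Lemma polyfun_const c : polyfun (fun=> c).
Proof. by exists c%:P => x; rewrite hornerC. Qed.

Lemma polyfun_id : polyfun id.
Proof. by exists 'X => x; rewrite hornerX. Qed.

Lemma polyfun_add f g : polyfun f -> polyfun g -> polyfun (fun x => f x + g x)%N.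
Proof. by move=> [p pf] [q qg]; exists (p + q) => x; rewrite hornerD pf qg. Qed.

Lemma polyfun_mul f g : polyfun f -> polyfun g -> polyfun (fun x => f x * g x)%N.
Proof. by move=> [p pf] [q qg]; exists (p * q) => x; rewrite hornerM pf qg. Qed.

Section Operators.
Variables (C : numClosedFieldType) (K : fieldExtType rat) (iota : {rmorphism K -> C}).
Variables (d : nat) (b : d.-tuple K).
Hypothesis bP : basis_of {:K} b.
Variables (R : finComNzRingType) (eK : R -> K).
Local Notation e := (fun x => iota (eK x)).
Local Notation J := (num_idx d R).
Local Notation rep := (num_rep iota b (R := R)).

(** As g may be a zero divisor, y -> yg is not injective; the kernel at (x,z) collects all y with yg
    = z. *)
Lemma num_gauss_step g s : exists M : J -> J -> nat, forall nv V, rep nv V ->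
  rep (fun j => \sum_i M j i * nv i)%N (gauss_step e g s V).
Proof.
have [M MP] := num_operator iota bP (fun x z => \sum_(y | y * g == z) eK (y * y * s + y * x)).
exists M => nv V /MP; rewrite (_ : (fun x => \sum_z iota _ * V z) = gauss_step e g s V) //.
apply: funext => x; rewrite /gauss_step [RHS](partition_big (fun y => y * g) xpredT) //=.
apply: eq_bigr => z _; rewrite rmorph_sum mulr_suml; apply: eq_bigr => y /eqP <-.
by rewrite mulrC.
Qed.

Local Notation row_sum M j := (\sum_i (M : J -> J -> nat) j i)%N.

Lemma exists_operators (k0 : K) (kw : bool -> K) :
  exists (B : nat) (ds0 : {ffun J -> bool}) (Mi Mn : J -> J -> nat) (Mw : bool -> J -> J -> nat)
    (upd : R -> R -> J -> J -> nat),
  [/\ forall j, [/\ row_sum Mi j <= B, row_sum Mn j <= B, forall s, row_sum (Mw s) j <= B &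
        forall g x, row_sum (upd g x) j <= B],
      rep (fun j => \sum_i Mi j i * ds0 i) e,
      forall nv V, rep nv V -> rep (fun j => \sum_i Mn j i * nv i) (fun x => iota k0 * V x)%R,
      forall s nv V, rep nv V -> rep (fun j => \sum_i Mw s j i * nv i) (fun x => iota (kw s) * V x)%R &
      forall nv V g x, rep nv V -> rep (fun j => \sum_i upd g x j i * nv i) (gauss_step e g x V)]%N.
Proof.
have [ds0 [Mi Mi_rep]] := num_init iota bP eK 0.
have [Mn Mn_rep] := num_scalar iota bP R k0.
pose Mw s := projT1 (cid (num_scalar iota bP R (kw s))).
pose upd g x := projT1 (cid (num_gauss_step g x)).
pose rb (M : J -> J -> nat) := (\sum_j row_sum M j)%N.
have le_sum (I : finType) (F : I -> nat) i : (F i <= \sum_i F i)%N by rewrite (bigD1 i) //= leq_addr.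
(* One carry bound for all matrices: there are finitely many, and the sum of all their entries
   dominates every row sum. *)
exists (rb Mi + rb Mn + \sum_s rb (Mw s) + \sum_g \sum_x rb (upd g x))%N, ds0, Mi, Mn, Mw, upd.
split=> // [j|s|nv V g x]; last 2 first.
- by rewrite /Mw; case: cid.
- by rewrite /upd; case: cid => M MP /MP.
have i1 : (row_sum Mi j <= rb Mi)%N := le_sum _ _ j.
have i2 : (row_sum Mn j <= rb Mn)%N := le_sum _ _ j.
split; [by lia | by lia | move=> s | move=> g x].
  have i3 : (row_sum (Mw s) j <= rb (Mw s))%N := le_sum _ _ j.
  have i4 : (rb (Mw s) <= \sum_s rb (Mw s))%N := le_sum _ (fun s => rb (Mw s)) s.
  by lia.
have i5 : (row_sum (upd g x) j <= rb (upd g x))%N := le_sum _ _ j.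
have i6 : (rb (upd g x) <= \sum_x rb (upd g x))%N := le_sum _ (fun x => rb (upd g x)) x.
have i7 : (\sum_x rb (upd g x) <= \sum_g \sum_x rb (upd g x))%N := le_sum _ (fun g => \sum_x rb (upd g x))%N g.
by lia.
Qed.

End Operators.

Definition word_lsum (C : numClosedFieldType) (R : finComNzRingType) (Y : finZmodType) (e : R -> C)
    (own : bool -> Y -> Y -> R) (lin : bool -> Y -> R) (cpl : bool * bool -> Y -> Y -> R)
    (n : nat) (w : braid_word n) : C :=
  let letter k := tnth (in_tuple w) k in let l := size w in
  @lsum C R _ (gauss_fn (@qvec R Y l) (@bvec R Y l) e e (lin_vec lin (fun k => (letter k).2)))
   [seq word_vec own cpl (fun k => (letter k).2) (fun j k => word_rel (letter j) (letter k)) i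
      | i <- word_enum Y l].

Section WordMachine.
Variables (C : numClosedFieldType) (K : fieldExtType rat) (iota : {rmorphism K -> C}).
Variables (d : nat) (b : d.-tuple K) (R : finComNzRingType) (Y : finZmodType).
Variables (bez : R -> R -> R * R * R * R) (eK : R -> K).
Local Notation e := (fun x => iota (eK x)).
Local Notation J := (num_idx d R).
Local Notation H := (cell R Y).
Local Notation rep := (num_rep iota b (R := R)).
Hypothesis bezP : forall a b, let: (p, q, s, t) := bez a b in p * t - q * s = 1 /\ q * a + t * b = 0.
Hypotheses (e0 : e 0 = 1) (eD : {morph e : x y / x + y >-> x * y}).
Variables (own : bool -> Y -> Y -> R) (lin : bool -> Y -> R) (cpl : bool * bool -> Y -> Y -> R).
Variables (B : nat) (ds0 : {ffun J -> bool}) (Mi Mn : J -> J -> nat) (Mw : bool -> J -> J -> nat).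
Variables (upd : R -> R -> J -> J -> nat) (k0 : C) (kw : bool -> C).
Hypotheses (MiB : forall j, (\sum_i Mi j i <= B)%N) (MnB : forall j, (\sum_i Mn j i <= B)%N).
Hypotheses (MwB : forall s j, (\sum_i Mw s j i <= B)%N) (updB : forall g x j, (\sum_i upd g x j i <= B)%N).
Hypothesis rep0 : rep (fun j => \sum_i Mi j i * ds0 i)%N e.
Hypothesis rep_n : forall nv V, rep nv V -> rep (fun j => \sum_i Mn j i * nv i)%N (fun x => k0 * V x).
Hypothesis rep_w : forall s nv V, rep nv V ->
  rep (fun j => \sum_i Mw s j i * nv i)%N (fun x => kw s * V x).
Hypothesis rep_upd : forall nv V g x, rep nv V ->
  rep (fun j => \sum_i upd g x j i * nv i)%N (gauss_step e g x V).

Local Notation machine := (machine H R J).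
Local Notation sym_cell := (@sym_cell H R J).
Local Notation sym_digits := (@sym_digits H R J).
Local Notation sym_letter := (sym_letter H R J).
Local Notation sym_bit := (@sym_bit R Y J).

Definition coord_fraction (i : 'I_d) : machine unit :=
  out_fraction H R (None : J) (Some (0 : R, (i, false))) (Some (0 : R, (i, true))).

(** The coordinates of the table at 0 are written last first, since the output stack is filled from
    the end. *)
Definition word_machine : machine unit :=
  bind (push st_num (sym_digits ds0)) (fun _ =>
  bind (apply_matrix H R B Mi) (fun _ =>
  bind (read_bits R Y J) (fun _ =>
  bind (unary R Y J) (fun _ =>
  bind (apply_cur R Y B Mn) (fun _ =>
  bind (read_letters (own_cell own) (pair_cell cpl) B Mw) (fun _ =>
  bind (build_prev J (lin_cell lin)) (fun _ =>
  bind (loop (@round_body R Y J bez B upd) tt) (fun _ =>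
  seq_mach coord_fraction (rev (enum 'I_d)))))))))).

Lemma runs_coord_fractions ds (V : R -> C) (js : seq 'I_d) a0 a1 a2 a3 a4 a8 a9 o : rep (column_val ds) V ->
  exists2 xs : seq fraction, all fraction_ok xs /\
      map rat_of_fraction xs = [seq num_coef (column_val ds) 0 i | i <- rev js] &
  runs (seq_mach coord_fraction js)
    [:: a0; a1; a2; a3; a4; [::]; map sym_digits ds; [::]; a8; a9; o] (size js * (11 * size ds + 12) + 1)%N tt
    [:: a0; a1; a2; a3; a4; [::]; map sym_digits ds; [::]; a8; a9;
        map sym_letter (flatten (map code_fraction xs)) ++ o].
Proof.
move=> [den0 _]; elim: js o => [|i js IH] o; first by exists [::] => //; apply: runs_ret.
have [x [xok xE] rx] := @runs_out_fraction H R J None (Some (0 : R, (i, false))) (Some (0 : R, (i, true)))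
  ds a0 a1 a2 a3 a4 a8 a9 o den0.
have [xs [xsok xsE] rxs] := IH (map sym_letter (code_fraction x) ++ o).
exists (rcons xs x).
  by split; [rewrite all_rcons xok | rewrite map_rcons xsE xE rev_cons map_rcons].
rewrite map_rcons flatten_rcons map_cat -catA [size _]/= (mulSn (size js)) -addnA.
exact: runs_bind rx rxs.
Qed.

Section Run.
Variables (n : nat) (w : braid_word n).
Local Notation l := (size w).

Definition word_recs : seq (bool * seq bool) := [seq (s.2, bits_of_nat (val s.1).+1) | s <- w].

Lemma size_bits m : (size (bits_of_nat m) <= m)%N.
Proof.
rewrite /bits_of_nat; have le k j : (size (bits_rec k j) <= k)%N by elim: k j => [|k IH] [|j] //=; rewrite ltnS.
exact: le.
Qed.

Lemma code_recs (ps : seq (bool * seq bool)) :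
  map sym_letter (flatten [seq Some r.1 :: code_bits r.2 | r <- ps]) = enc_recs R Y J ps.
Proof.
elim: ps => // r ps IH; rewrite /= map_cat IH enc_recs_cons /code_bits map_rcons cat_rcons.
by rewrite -map_comp.
Qed.

Lemma code_braidE : map sym_letter (code_braid w) =
  map sym_bit (bits_of_nat n) ++ sym_letter None :: enc_recs R Y J word_recs.
Proof.
rewrite -code_recs /word_recs -map_comp /code_braid map_cat /code_bits map_rcons cat_rcons -map_comp.
by [].
Qed.

Lemma word_recs_size : all (fun r => size r.2 <= n + l)%N word_recs.
Proof.
apply/allP => _ /mapP[[i s] _ ->]; apply: (leq_trans (size_bits (val i).+1)).
by have := ltn_ord i; rewrite /=; lia.
Qed.

(** Initialisation gives at most 1 + [B.+1] digits; each strand, each letter and each elimination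
    round adds at most [B.+1] more. *)
Definition digit_bound N := (B + 2 + N * B.+1 + N * B.+1 + N * #|Y| * B.+1)%N.

Definition word_time N :=
  (1 + (6 * (1 + B.+1) + 2 + (3 * N + 2 + (N * (10 * N + 7) + 2 +
   (N * (6 * (digit_bound N + B.+1) + 4) + 2 +
   (N * (6 * (digit_bound N + B.+1) + 12 * N + #|Y| * (N * (14 * N + 17) + 6) + 20) + 2 +
   (N * (2 * N + 5) + 2 +
   (N * #|Y| * (N * #|Y| * (17 * N + 18) + 11 * N + 6 * digit_bound N + 30) + 2 +
    (d * (11 * digit_bound N + 12) + 1)))))))))%N.

Lemma runs_word_machine : exists z' out,
  [/\ runs word_machine (map inl (code_braid w) :: nseq 10 [::]) (word_time (n + l)) tt z',
      nth [::] z' 10 = map inl out &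
      represents iota b out (k0 ^+ n * (\prod_(s <- w) kw s.2) * word_lsum e own lin cpl w)].
Proof.
pose N := (n + l)%N; pose D := digit_bound N; pose rs := word_recs.
have [nN lN] : (n <= N)%N /\ (l <= N)%N by rewrite leq_addr leq_addl.
have szr : size rs = l by rewrite size_map.
have [rsN rsN'] : all (fun r => size r.2 <= N)%N rs /\ all (fun r => size r.2 <= N)%N (rev rs ++ [::]).
  by rewrite cats0 all_rev word_recs_size.
have [ds1 [sz1 val1] r1] := @runs_apply H R J B Mi MiB [:: ds0]
  (map sym_letter (code_braid w)) [::] [::] [::] [::] [::] [::] [::] [::].
have rp1 : rep (column_val ds1) e.
  rewrite (_ : column_val ds1 = fun j => \sum_i Mi j i * ds0 i)%N //.
  apply: funext => j; rewrite val1; apply: eq_bigr => i _.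
  by rewrite column_val_cons column_val_nil addn0.
have r2 := @runs_read_bits R Y J (bits_of_nat n) (enc_recs R Y J rs) [::]
  [::] [::] [::] [::] (map sym_digits ds1) [::] [::] [::] [::].
have bn : (foldl (fun k (b : bool) => k.*2 + b) 0 (rev (bits_of_nat n)) <= n)%N.
  by rewrite foldl_bits bits_of_natK.
have r3 := @runs_unary R Y J (rev (bits_of_nat n)) 0 n (enc_recs R Y J rs) [::] [::] [::] [::]
  (map sym_digits ds1) [::] [::] bn.
rewrite foldl_bits bits_of_natK in r3.
have le_n : (n * B.+1 <= N * B.+1)%N by rewrite leq_mul2r nN orbT.
have le_l : (l * B.+1 <= N * B.+1)%N by rewrite leq_mul2r lN orbT.
have leD : (B + 2 + n * B.+1 <= D)%N by rewrite /D /digit_bound -!addnA !leq_add2l (leq_trans le_n) ?leq_addr.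
have le4 : (size ds1 + n * B.+1 <= D)%N.
  by apply: leq_trans leD; rewrite leq_add2r; apply: leq_trans sz1 _; rewrite /= addnC addSnnS.
have [ds2 [rp2 sz2] r4] := @runs_apply_cur C R Y J B Mn rep k0 MnB rep_n n D ds1 e
  (enc_recs R Y J rs) [::] [::] [::] [::] [::] [::] [::] rp1 le4.
have le5 : (size ds2 + size rs * B.+1 <= D)%N.
  rewrite szr; apply: leq_trans (_ : B + 2 + N * B.+1 + N * B.+1 <= _)%N; last exact: leq_addr.
  rewrite leq_add //; apply: leq_trans sz2 _; rewrite leq_add //.
  by apply: leq_trans sz1 _; rewrite /= addnC addSnnS.
have lep : (size rs + size ([::] : seq (bool * seq bool)) <= N)%N by rewrite addn0 szr.
have [ds3 [rp3 sz3] r5] := @runs_read_letters C R Y J (own_cell own) (pair_cell cpl) B Mw rep kw MwB rep_w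
  N N D rs [::] [::] ds2 _ [::] [::] [::] rsN isT lep rp2 le5.
pose c : seq H := [seq lin_cell lin r.1 | r <- rs].
pose vs := word_vecs (own_cell own) (pair_cell cpl) [::] rs [::].
have szc : size c = l by rewrite size_map.
have r6 := @runs_build_prev R Y J (lin_cell lin) N (rev rs ++ [::]) [::] [::] (enc_vecs J vs) [::] [::] [::]
  (map sym_digits ds3) [::] [::] [::] rsN'.
rewrite cats0 map_rev revK cats0 -/c in r6.
pose r0 : bool * seq bool := (true, [::]).
have tE x (k : 'I_l) : nth x w k = tnth (in_tuple w) k := esym (tnth_nth x (in_tuple w) k).
have sE k : (tnth (in_tuple w) k).2 = (nth r0 rs k).1.
  by rewrite (nth_map (tnth (in_tuple w) k)) // tE.
have relE j k : word_rel (tnth (in_tuple w) j) (tnth (in_tuple w) k) = relb (nth r0 rs j).2 (nth r0 rs k).2.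
  (* The code numbers the generators from 1, which affects neither equality nor succession of
     indices. *)
  rewrite !(nth_map (tnth (in_tuple w) k)) // !tE /relb !bits_of_natK eqSS.
  by congr (_, _); rewrite -val_eqE.
have vsE := word_vecs_embed own cpl szr sE relE.
have szvs : size vs = (l * #|Y|)%N := size_word_vecs own cpl szr sE relE.
have vsl := word_vecs_size own cpl r0 szr.
have [c' [ds4 [V' [rp4 V0 sz4 r7]]]] := @runs_elimination C R Y J bez e bezP e0 eD B upd rep updB rep_upd
  l c vs ds3 _ [::] [::] [::] [::] szc vsl rp3.
have le6 : (size ds3 + size vs * B.+1 <= D)%N.
  rewrite szvs; apply: leq_add; last by rewrite leq_mul2r leq_mul2r lN !orbT.
  apply: leq_trans sz3 _; rewrite szr leq_add //.
  apply: leq_trans sz2 _; rewrite leq_add //.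
  by apply: leq_trans sz1 _; rewrite /= addnC addSnnS.
have [xs [xsok xsE] r8] := @runs_coord_fractions ds4 V' (rev (enum 'I_d)) [::] [::] [::] [::] (map sym_cell c')
  [::] [::] [::] rp4.
exists [:: [::]; [::]; [::]; [::]; map sym_cell c'; [::]; map sym_digits ds4; [::]; [::]; [::];
        map sym_letter (flatten (map code_fraction xs)) ++ [::]].
exists (flatten (map code_fraction xs)); split; last 1 first.
- have szxs : size xs == d.
    by rewrite -(size_map rat_of_fraction) xsE revK size_map size_enum_ord.
  exists (Tuple szxs); split=> //.
  (* The scalars were multiplied into the table before the elimination, and the sum is linear in the
     table. *)
  have -> : k0 ^+ n * (\prod_(s <- w) kw s.2) * word_lsum e own lin cpl w = V' 0.
    rewrite V0 vsE (embed_lin lin szr sE) /word_lsum -lsum_scale; apply: eq_lsum => u.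
    by rewrite /gauss_fn big_map mulrA; congr (_ * _); rewrite [RHS]mulrCA mulrA.
  rewrite rp4.2; congr (iota _); apply: eq_bigr => i _; congr (_ *: _).
  rewrite (tnth_nth (false, [::], [::])) /= -(nth_map _ 0) ?(eqP szxs) // xsE revK.
  by rewrite (nth_map i) ?size_enum_ord // nth_ord_enum.
- rewrite code_braidE in r1; rewrite cats0 in r5.
  rewrite -[map inl _]/(map sym_letter (code_braid w)) code_braidE /word_time -/N -/D add1n.
  have bnN : (size (bits_of_nat n) <= N)%N := leq_trans (size_bits n) nN.
  apply: runs_push; apply: runs_bind; first exact: r1.
  apply: runs_bind; first by apply: runs_leq r2 _; rewrite leq_add2r leq_mul.
  apply: runs_bind.
    rewrite cats0; apply: runs_leq r3 _; rewrite size_rev leq_add2r leq_mul // leq_add2r leq_mul //.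
  apply: runs_bind.
    apply: runs_leq r4 _; rewrite leq_add2r leq_mul //.
  apply: runs_bind.
    apply: runs_leq r5 _; rewrite leq_add2r leq_mul // szr //.
  apply: runs_bind.
    apply: runs_leq r6 _; rewrite ?cats0 size_rev szr leq_add2r leq_mul //.
  apply: runs_bind.
    apply: runs_leq r7 _; rewrite szvs leq_add2r leq_mul ?leq_mul // leq_add2r.
    apply: leq_add; last by rewrite -szvs leq_mul2l le6.
    by rewrite leq_add ?leq_mul // leq_add2r leq_mul.
  apply: runs_leq r8 _; rewrite size_rev size_enum_ord leq_add2r leq_mul // leq_add2r leq_mul //.
  by apply: leq_trans sz4 _.
by rewrite /= cats0.
Qed.

End Run.
End WordMachine.

Section AbstractRing.
Variables (C : numClosedFieldType) (L : link_data C) (ql : quadratic_letters L).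
Local Notation Y := (tgrp L * tgrp L)%type.
Local Notation alg := (algebraicOver (@ratr C)).
Variables (R : finComNzRingType) (bez : R -> R -> R * R * R * R) (e : R -> C).
Hypothesis bezP : forall a b, let: (p, q, s, t) := bez a b in p * t - q * s = 1 /\ q * a + t * b = 0.
Hypotheses (e0 : e 0 = 1) (eD : {morph e : x y / x + y >-> x * y}).
Variable cover : (Y -> R) -> Y.
Hypothesis coverD : forall x x', cover (fun a => x a + x' a) = cover x + cover x'.
Hypothesis cover_delta : forall y, cover (fun a => (a == y)%:R) = y.
Variables (own : bool -> Y -> Y -> R) (lin : bool -> Y -> R) (cpl : bool * bool -> Y -> Y -> R).
Hypothesis phiE : forall s (x : Y -> R), letter_phase ql s (cover x) =
  e (\sum_a x a * lin s a + \sum_a \sum_a' x a * (own s a a' * x a')).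
Hypothesis chiE : forall r (x x' : Y -> R), pair_phase ql r (cover x) (cover x') =
  e (\sum_a \sum_a' x a * (cpl r a a' * x' a')).
Hypotheses (alpha0 : lalpha L != 0) (alg_alpha : alg (lalpha L)) (alg_ratio : alg (lD L / lbeta L)).
Hypotheses (alg_const : forall s, alg (ql_const ql s)) (alg_e : forall x, alg (e x)).

(** All that one letter contributes outside the lattice sum: its power of alpha, its constant, the
    [#|G|^-1] of the delta function, and the factor of the lift from Y to R^Y. *)
Definition letter_factor (s : bool) : C :=
  (if s then (lalpha L)^-1 else lalpha L) * ql_const ql s / #|tgrp L|%:R *
  (#|{: Y}|%:R / #|R|%:R ^+ #|{: Y}|).

Lemma algebraic_factor s : alg (letter_factor s).
Proof.
have alg_nat k : alg k%:R by apply: algebraic_nat.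
apply: algebraic_mul; apply: algebraic_mul.
- apply: algebraic_mul; last exact: alg_const.
  by case: s => //; apply: algebraic_inv.
- exact: algebraic_inv.
- exact: alg_nat.
by apply: algebraic_inv; rewrite -natrX.
Qed.

Lemma link_invariant_lsum n (w : braid_word n) :
  link_invariant L w = (lD L / lbeta L) ^+ n * (\prod_(s <- w) letter_factor s.2) *
    word_lsum e own lin cpl w.
Proof.
rewrite (link_invariantE ql) // /word_sum.
rewrite (word_sum_lsum e0 eD coverD cover_delta phiE chiE _ _ (word_enum_uniq _ _) (size_word_enum _ _)).
rewrite [in RHS]big_split /= big_const_seq count_predT iter_mulr_1 -/(word_lsum _ _ _ _ _).
by rewrite -!mulrA.
Qed.

Lemma polyfun_digit_bound B c : polyfun (fun N => B + 2 + N * B.+1 + N * B.+1 + N * c * B.+1)%N.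
Proof.
by do ?[apply: polyfun_const | apply: polyfun_id | apply: polyfun_add | apply: polyfun_mul].
Qed.

Lemma invariant_computable : exists (K : fieldExtType rat) (iota : {rmorphism K -> C})
    (d : nat) (b : d.-tuple K) (M : tm) (p : {poly nat}), basis_of {:K} b /\
  forall (n : nat) (w : braid_word n), exists (t : nat) (out : seq letter),
    [/\ (t <= p.[(n + size w)%N])%N, computes_within M (code_braid w) t out &
        represents iota b out (link_invariant L w)].
Proof.
(* These finitely many numbers, independent of the word, determine the number field. *)
pose vals := [:: lD L / lbeta L, letter_factor true, letter_factor false & [seq e x | x <- enum R]].
have [|K [iota iotaP]] := @number_field_seq C vals.
  move=> x; rewrite !inE => /or4P[/eqP ->|/eqP ->|/eqP ->|/mapP[y _ ->]] //; exact: algebraic_factor.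
have [k0 k0E] : exists k, lD L / lbeta L = iota k by apply: iotaP; rewrite mem_head.
have /choice[kw kwE] s : exists k, letter_factor s = iota k.
  by apply: iotaP; rewrite !inE; case: s; rewrite eqxx ?orbT.
have /choice[eK eKE] x : exists k, e x = iota k.
  by apply: iotaP; rewrite !inE map_f ?orbT ?mem_enum.
have eE : e = (fun x => iota (eK x)) by apply: funext.
have bP := vbasisP {:K}.
have [B [ds0 [Mi [Mn [Mw [upd [MB rep0 rep_n rep_w rep_upd]]]]]]] := exists_operators iota bP eK k0 kw.
move: e0 eD link_invariant_lsum; rewrite eE => e0' eD' invE.
pose m := word_machine bez own lin cpl B ds0 Mi Mn Mw upd.
have [p pE] : polyfun (word_time (\dim {:K}) Y B).
  have D := polyfun_digit_bound B #|{: Y}|.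
  rewrite /word_time.
  by do ?[apply: polyfun_const | apply: polyfun_id | exact: D | apply: polyfun_add | apply: polyfun_mul].
exists K, iota, _, (vbasis {:K}), (ctm m), (p + p); split=> // n w.
have Bi j : (\sum_i Mi j i <= B)%N by case: (MB j).
have Bn j : (\sum_i Mn j i <= B)%N by case: (MB j).
have Bw s j : (\sum_i Mw s j i <= B)%N by case: (MB j).
have Bu g x j : (\sum_i upd g x j i <= B)%N by case: (MB j).
have [z' [out [r zout zrep]]] :=
  runs_word_machine bezP e0' eD' own lin cpl Bi Bn Bw Bu rep0 rep_n rep_w rep_upd w.
have [t tle tc] := ctm_computes r zout.
exists t, out; split=> //.
  (* The Turing machine takes twice the time of the stack machine, hence the polynomial [p + p]. *)
  by rewrite hornerD pE -[(_ + _)%R]/(_ + _)%N addnn.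
rewrite invE k0E; have -> // : \prod_(s <- w) letter_factor s.2 = \prod_(s <- w) iota (kw s.2).
by apply: eq_bigr => s _.
Qed.

End AbstractRing.

Theorem theorem7p10 (R : realType) (A : finZmodType) (q : metric_form R[i] A)
    (F : link_family q) :
  exists (K : fieldExtType rat) (iota : {rmorphism K -> R[i]})
         (d : nat) (b : d.-tuple K) (M : tm) (p : {poly nat}),
    basis_of {:K} b /\
    forall (n : nat) (w : braid_word n), (1 <= n)%N ->
      exists (t : nat) (out : seq letter),
        [/\ (t <= p.[(n + size w)%N])%N,
            computes_within M (code_braid w) t out &
            represents iota b out (link_invariant (family_data F) w)].
Proof.
set L := family_data F; have [alpha0 alg_alpha alg_ratio [ql alg_const]] := family_quadratic_letters F.
pose Y : finZmodType := (tgrp L * tgrp L)%type.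
(* The form [m.+2] of the modulus gives ['I_m.+2] its ring structure. *)
have [m cardY] : exists m, m.+2 = (4 * #|Y|)%N.
  have : (0 < #|Y|)%N by apply/card_gt0P; exists 0.
  by exists (4 * #|Y| - 2)%N; lia.
have [zeta zetaP] := exists_prim_root R[i] (ltn0Sn m.+1).
have alg_zchar (x : 'I_m.+2) : algebraicOver ratr (zchar zeta x).
  apply: (@algebraic_exp_nat _ _ m.+1 1).
  by rewrite /zchar -exprM mulnC exprM (prim_expr_order zetaP) expr1n.
have /choice[own] s :=
  quadratic_cover zetaP cardY (letter_phase_U1 ql s) (letter_form_bichar ql s) (letter_phaseD ql s).
move=> /choice[lin phiE].
have /choice[cpl chiE] r := bicharacter_cover zetaP cardY (pair_phase_bichar ql r).
have [K [iota [d [b [M [p [bP H]]]]]]] := invariant_computable (@bezoutP m) (@zchar0 _ m zeta) (zcharD zetaP)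
  (coverD cardY) (@cover_delta m Y) phiE chiE alpha0 alg_alpha alg_ratio alg_const alg_zchar.
by exists K, iota, d, b, M, p; split=> // n w _; apply: H.
Qed.
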